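(* Let $T:\Sigma\times G\to\Sigma\times G$ be the extension, by a group $G$, of a Gibbs–Markov map $\theta:\Sigma\to\Sigma$ of finite type as described in the context. Assume that $G$ is a non-elementary, word hyperbolic group, that $T$ is topologically transitive, and that there is a constant $C_0\ge 1$ with $$C_0^{-1}\,\mathbb{G}_R(\mathbf 1_{\Sigma\times\{\mathrm{id}\}})(x,g)\le \mathbb{G}_R(\mathbf 1_{\Sigma\times\{g\}})(x,\mathrm{id})\le C_0\,\mathbb{G}_R(\mathbf 1_{\Sigma\times\{\mathrm{id}\}})(x,g)\quad\text{for all }x\in\Sigma,\ g\in G .$$ Then for every $D>0$ there exists $C\ge1$ such that for all $g,z,h\in G$ for which the distance between $z$ and a geodesic segment $[g,h]$ is smaller than $D$, all $r\in[1,1/\rho]$ and all $x\in\Sigma$, $$C^{-1}\,\mathbb{G}_r(\mathbf 1_{\Sigma\times\{h\}})(x,z)\,\mathbb{G}_r(\mathbf 1_{\Sigma\times\{z\}})(x,g)\le \mathbb{G}_r(\mathbf 1_{\Sigma\times\{h\}})(x,g)\le C\,\mathbb{G}_r(\mathbf 1_{\Sigma\times\{h\}})(x,z)\,\mathbb{G}_r(\mathbf 1_{\Sigma\times\{z\}})(x,g).$$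
   Context: **Base map.** $\Sigma\subset\alpha^{\mathbb N}$ is a one-sided topological Markov chain (subshift given by a $0$-$1$ transition rule) over a finite alphabet $\alpha$, $\theta$ is the left shift on $\Sigma$, assumed topologically mixing and noninvertible. $\mathcal W^n$ is the set of admissible words of length $n$ and $[w]\subset\Sigma$ is the cylinder of $w\in\mathcal W^n$. $\mu$ is a $\theta$-invariant Borel probability measure on $\Sigma$, positive on cylinders. For $w\in\mathcal W^n$, $\tau_w:\theta^n([w])\to[w]$ is the inverse of $\theta^n|_{[w]}$ and $\varphi_w:=d(\mu\circ\tau_w)/d\mu$ (continuous version). The Gibbs–Markov property (of finite type) means: there are $C>0$, $s\in(0,1)$ with $|\log\varphi_w(x)-\log\varphi_w(y)|\le C\,d_s(x,y)$ for all finite admissible $w$ and $x,y\in\theta^{|w|}([w])$, where $d_s(x,y)=s^{\min\{i:x_i\ne y_i\}}$. **Extension.** $G$ is a discrete group, $\kappa:\Sigma\to G$ is constant on cylinders of length one, and $T(x,g)=(\theta(x),g\kappa(x))$ on $\Sigma\times G$. For $w\in\mathcal W^n$ put $\kappa_w=\kappa(x)\kappa(\theta x)\cdots\kappa(\theta^{n-1}x)$, $x\in[w]$. $T$ is topologically transitive if for all $a,b\in\alpha$ and $g,h\in G$ there is $n\in\mathbb N$ with $T^n([a]\times\{g\})\cap([b]\times\{h\})\neq\emptyset$. **Operators.** $\mathcal L^n(f)(x,g)=\sum_{v\in\mathcal W^n,\,x\in\theta^n([v])}\varphi_v(x)\,f(\tau_v(x),g\kappa_v^{-1})$; invariance of $\mu$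 gives $\mathcal L(\mathbf 1)=\mathbf 1$. $\mathbb G_r(f)=\sum_{n\ge0}r^n\mathcal L^n(f)$ (for $f\ge0$, with values in $[0,\infty]$). $\rho=\limsup_n\sqrt[n]{\mathcal L^n(\mathbf 1_{\Sigma\times\{g\}})(x,h)}$, which by transitivity does not depend on $g,h\in G$, $x\in\Sigma$; $R:=1/\rho\geq 1$. **Group.** $G$ is equipped with the word metric $d$ of a finite symmetric generating set and is word hyperbolic if for some $\delta>0$, $(x\cdot z)_o\ge\min\{(x\cdot y)_o,(y\cdot z)_o\}-\delta$ for all $x,y,z,o\in G$, where $(x\cdot y)_o=\frac12(d(x,o)+d(y,o)-d(x,y))$. $G$ is elementary if it has a cyclic subgroup of finite index. A geodesic segment $[g,h]$ is a path of length $d(g,h)$ from $g$ to $h$ in the Cayley graph. *)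

(* Defs.v *)
From HB Require Import structures.
From mathcomp Require Import all_boot all_order all_algebra.
From mathcomp Require Import all_classical all_reals all_analysis.

Set Implicit Arguments.
Unset Strict Implicit.
Unset Printing Implicit Defensive.

Import Order.TTheory GRing.Theory Num.Theory.
Import numFieldNormedType.Exports.

Local Open Scope classical_set_scope.
Local Open Scope ring_scope.

Definition least (P : set nat) : nat :=
  xget 0%N [set n | P n /\ forall m, P m -> (n <= m)%N].

(** ** One-sided topological Markov chains *)

Definition admissible_seqs (alpha : finType) (A : rel alpha) :
    set {ptws nat -> discrete_topology alpha} :=
  [set x | forall i, A (x i) (x i.+1)].

Definition tmc (alpha : finType) (A : rel alpha) : Type :=
  set_type (admissible_seqs A).

Arguments tmc {alpha} A.

HB.instance Definition _ (alpha : finType) (A : rel alpha) :=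
  Topological.copy (tmc A) (set_type (admissible_seqs A)).

(* [T] with its Borel sigma-algebra; measurable types of the library are
   pointed, whence the base point, which plays no other role. *)
Definition borel (T : topologicalType) (pt : T) : Type := T.

Section borel.
Variables (T : topologicalType) (pt : T).

HB.instance Definition _ := Topological.on (borel pt).
HB.instance Definition _ := isPointed.Build (borel pt) pt.

Let borel_setC (B : set (borel pt)) : <<s open >> B -> <<s open >> (~` B).
Proof. by move=> ?; rewrite -setTD; exact: sigma_algebraCD. Qed.

HB.instance Definition _ := @isMeasurable.Build
  (sigma_display (@open T)) (borel pt) <<s open >>
  (@sigma_algebra0 _ setT open) borel_setC (@sigma_algebra_bigcup _ setT open).

End borel.

Section markov_chain.
Variables (alpha : finType) (A : rel alpha).
Implicit Types (x y : tmc A) (w : seq alpha).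

Definition letter x : nat -> alpha := set_val x.

Lemma theta_subproof x : (fun i => letter x i.+1) \in admissible_seqs A.
Proof. by apply/mem_set => i; exact: (set_valP x i.+1). Qed.

Definition theta x : tmc A :=
  exist (fun u => u \in admissible_seqs A) _ (theta_subproof x).

Definition topologically_mixing : Prop :=
  forall U V : set (tmc A), open U -> U !=set0 -> open V -> V !=set0 ->
  exists N, forall n, (N <= n)%N -> (iter n theta @` U) `&` V !=set0.

Definition admissible w : bool := sorted A w.

Definition cylinder w : set (tmc A) :=
  [set x | mkseq (letter x) (size w) = w].

(* theta^{|w|}([w]), the domain of the inverse branch [tau w] *)
Definition branch_dom w : set (tmc A) := iter (size w) theta @` cylinder w.

(* Off [branch_dom w] the value is a dummy. *)
Definition tau w : tmc A -> tmc A :=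
  'pinv_ id (cylinder w) (iter (size w) theta).

Definition dist_s (R : realType) (s : R) x y : R :=
  if x == y then 0 else s ^+ least [set i | letter x i <> letter y i].

Section measure.
Variables (R : realType) (pt : tmc A) (mu : probability (borel pt) R).

Definition shift_invariant : Prop :=
  forall B : set (borel pt), measurable B -> mu (theta @^-1` B) = mu B.

Definition positive_on_cylinders : Prop :=
  forall w, admissible w -> (0 < mu (cylinder w))%E.

(* [phi w] is the continuous version of d(mu o tau_w)/d(mu); it is unique on
   [branch_dom w], which is open, as [mu] is positive on cylinders. *)
Definition is_jacobian (phi : seq alpha -> tmc A -> R) : Prop :=
  forall w, admissible w ->
    {within branch_dom w, continuous (phi w)} /\
    forall B : set (borel pt), measurable B -> B `<=` branch_dom w ->
      mu (tau w @` B) = (\int[mu]_(x in B) (phi w x)%:E)%E.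

End measure.

(* Positivity is what makes log(phi_w) meaningful: the library's [ln] is 0 on
   nonpositive reals. *)
Definition gibbs_markov (R : realType) (phi : seq alpha -> tmc A -> R) : Prop :=
  (forall w x, admissible w -> branch_dom w x -> 0 < phi w x) /\
  exists C s : R, [/\ 0 < C, 0 < s, s < 1 &
    forall w x y, admissible w -> branch_dom w x -> branch_dom w y ->
      `|ln (phi w x) - ln (phi w y)| <= C * dist_s s x y].

End markov_chain.

Arguments theta {alpha A}.
Arguments topologically_mixing {alpha} A.
Arguments cylinder {alpha} A w.
Arguments branch_dom {alpha} A w.

(** ** Group extensions *)

Section extension.
Variables (alpha : finType) (A : rel alpha) (G : groupType).
Variable kappa : tmc A -> G.

Definition constant_on_letters : Prop :=
  forall a x y, cylinder A [:: a] x -> cylinder A [:: a] y -> kappa x = kappa y.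

Definition skew (p : tmc A * G) : tmc A * G :=
  (theta p.1, (p.2 * kappa p.1)%g).

Definition topologically_transitive : Prop :=
  forall (a b : alpha) (g h : G), exists n : nat,
    (iter n skew @` (cylinder A [:: a] `*` [set g])) `&`
    (cylinder A [:: b] `*` [set h]) !=set0.

(* kappa(x) kappa(theta x) ... kappa(theta^{n-1} x), in this order *)
Definition kappa_prod (n : nat) (x : tmc A) : G :=
  (\prod_(0 <= i < n) kappa (iter i theta x))%g.

Variables (R : realType) (phi : seq alpha -> tmc A -> R).

(* kappa_v is evaluated at the point tau_v(x) of [v]. *)
Definition transfer (n : nat) (f : tmc A * G -> R) (p : tmc A * G) : R :=
  \sum_(v : n.-tuple alpha | admissible A v && (p.1 \in branch_dom A v))
    phi v p.1 * f (tau v p.1, (p.2 * (kappa_prod n (tau v p.1))^-1)%g).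

Definition green (r : R) (f : tmc A * G -> R) (p : tmc A * G) : \bar R :=
  (\sum_(0 <= n <oo) (r ^+ n * transfer n f p)%:E)%E.

Definition fiber (g : G) : tmc A * G -> R := \1_([set: tmc A] `*` [set g]).

(* The limsup of the n-th roots of L^n(1_{Sigma x {g}})(x,h); the exponent
   0^-1 = 0 at n = 0 is irrelevant. *)
Definition growth_rate (x : tmc A) (g h : G) : R :=
  fine (limn_esup (fun n => (transfer n (fiber g) (x, h) `^ n%:R^-1)%:E)).

End extension.

(** ** Finitely generated groups *)

Section word_metric.
Variables (G : groupType) (S : seq G).

Definition spells (w : seq G) (g : G) : Prop :=
  {subset w <= S} /\ (\prod_(s <- w) s)%g = g.

Definition symmetric_generating : Prop :=
  (forall s, s \in S -> (s^-1)%g \in S) /\ (forall g, exists w, spells w g).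

Definition word_length (g : G) : nat :=
  least [set n | exists2 w, size w = n & spells w g].

Definition word_dist (g h : G) : nat := word_length (g^-1 * h)%g.

Definition cayley_adj (g h : G) : bool := (g^-1 * h)%g \in S.

(* [g :: p] is the sequence of vertices of a geodesic segment from g to h *)
Definition geodesic (g h : G) (p : seq G) : Prop :=
  [/\ path cayley_adj g p, last g p = h & size p = word_dist g h].

Definition gromov_product (R : realType) (o x y : G) : R :=
  ((word_dist x o)%:R + (word_dist y o)%:R - (word_dist x y)%:R) / 2.

Definition hyperbolic (R : realType) : Prop :=
  exists2 delta : R, 0 < delta & forall x y z o : G,
    Num.min (gromov_product R o x y) (gromov_product R o y z) - delta
      <= gromov_product R o x z.

End word_metric.

Section elementary.
Variable G : groupType.

Definition cyclic_subgroup (c : G) : set G :=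
  [set h | exists n : nat, h = (c ^+ n)%g \/ h = (c ^- n)%g].

Definition left_coset (g : G) (H : set G) : set G := [set (g * h)%g | h in H].

Definition finite_index (H : set G) : Prop :=
  finite_set [set left_coset g H | g in [set: G]].

Definition elementary : Prop := exists c : G, finite_index (cyclic_subgroup c).

End elementary.

(* Main.v *)
(** Up to factors independent of r, x, g and h, the Green function
    G_r(1_{Sigma x {h}})(x, g) is V_r(h^-1 g), the sum of r^|u| mu([u]) over the
    words u with kappa_u = h^-1 g. The Gibbs property makes the weight mu([u])
    quasi-multiplicative, and by transitivity any two words can be joined by a word
    with prescribed image in G; this gives Harnack inequalities and the lower bound.

    For the upper bound, elements of a nonelementary hyperbolic group can be joined
    almost without cancellation, so that the sums of V_r(g) V_r(g^-1) over spheres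
    are almost multiplicative in the radius. As they are summable for r < R, they
    are bounded, uniformly in r; excursions through a fixed element then bound
    V_r(1), and everything passes to the limit r = R. By the symmetry hypothesis
    the sums of V_R(g)^2 over spheres are bounded. A path joining the two sides of
    a ball of radius n around a point of the geodesic, without entering the ball,
    crosses M n barriers cut out by level sets of the visual metric, where M is
    arbitrary. The matrices of V_R between successive barriers have small
    Hilbert-Schmidt norm by square summability, whence such paths have total weight
    at most L^n for every L > 0 and n large. Sorting all paths by the least dyadic
    scale at which they come close to the geodesic on both sides of the given point,
    this decay beats the Harnack factors and the resulting series converges. *)

Require Import Defs.
From mathcomp Require Import all_boot all_order all_algebra.
From mathcomp Require Import all_classical all_reals all_analysis.
From mathcomp Require Import zify ring lra.

Set Implicit Arguments.
Unset Strict Implicit.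
Unset Printing Implicit Defensive.

Import Order.TTheory GRing.Theory Num.Theory.
Import numFieldNormedType.Exports.

Local Open Scope classical_set_scope.
Local Open Scope ring_scope.

(** * Word metrics and hyperbolicity *)

(** All estimates are made for the abstract class [quasi_mult] of weights on words, whose constants
    do not involve r. The weights r^|u| mu([u]) lie in this class with the same constants for all r
    >= 1/2, and the decay of the weight of avoiding paths, computed once at r = R, passes to smaller
    r because the weights increase with r; this is the source of the uniformity in r. The range
    begins at 1/2 because R may be equal to 1, while R is reached only as a limit of smaller
    parameters.

    The obstacle throughout is that concatenation is neither always admissible nor injective on
    pairs of words. A lower bound for a product of sums therefore needs a connecting word, taken
    from a finite list, and a marker from which the cut can be read off: a first passage, a first
    return, a last exit, or a known length. Where a loop has to be removed to create the marker, a
    factor V(1) appears, which is why a bound of V(1) uniform in r < R is indispensable. Upper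
    bounds by splitting need no such care, as a word is determined by its pieces. *)

Lemma least_min (P : set nat) n : P n -> P (least P) /\ (forall m, P m -> (least P <= m)%N).
Proof.
move=> Pn; suff: [set n | P n /\ forall m, P m -> (n <= m)%N] (least P) by [].
have exP : exists k, `[< P k >] by exists n; apply/asboolP.
apply: (@xgetPex _ 0%N [set n | P n /\ forall m, P m -> (n <= m)%N]).
case: (ex_minnP exP) => m /asboolP Pm mmin; exists m; split=> // k Pk.
by apply: mmin; apply/asboolP.
Qed.

Section WordMetric.
Variables (R : realType) (G : groupType) (S : seq G).
Hypothesis hS : symmetric_generating S.
Implicit Types (g h x y z : G) (k n : nat).
Local Notation len := (word_length S).

Lemma len_le w g : spells S w g -> (len g <= size w)%N.
Proof.
move=> sw; have P : [set n | exists2 w, size w = n & spells S w g] (size w) by exists w.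
by have [_ ] := least_min P; apply.
Qed.

Lemma len_spells g : exists2 w, size w = len g & spells S w g.
Proof.
have [w sw] := hS.2 g.
have P : [set n | exists2 w, size w = n & spells S w g] (size w) by exists w.
by have [] := least_min P.
Qed.

Lemma len1 : len 1%g = 0%N.
Proof.
apply/eqP; rewrite -leqn0; apply: (@len_le [::]); split=> //.
by rewrite big_nil.
Qed.

Lemma len_eq0 g : len g = 0%N -> g = 1%g.
Proof.
by have [w sw [_ wg]] := len_spells g; rewrite -sw -wg => /size0nil ->; rewrite big_nil.
Qed.

Lemma lenM g h : (len (g * h)%g <= len g + len h)%N.
Proof.
have [w <- [ws wg]] := len_spells g; have [v <- [vs vh]] := len_spells h.
rewrite -size_cat; apply: len_le; split; last by rewrite big_cat /= wg vh.
by move=> s; rewrite mem_cat => /orP[/ws|/vs].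
Qed.

Lemma len_gen s : s \in S -> (len s <= 1)%N.
Proof.
move=> sS; apply: (@len_le [:: s]); split; first by move=> t; rewrite inE => /eqP ->.
by rewrite big_seq1.
Qed.

Lemma lenV_le g : (len g^-1%g <= len g)%N.
Proof.
have [w <- [ws <-]] := len_spells g; elim: w ws => [|s w IH] ws.
  by rewrite big_nil invg1 len1.
rewrite big_cons invgM; apply: leq_trans (lenM _ _) _.
have sS : s \in S by apply: ws; rewrite mem_head.
have := len_gen (hS.1 _ sS).
have : (len (\prod_(j <- w) j)^-1%g <= size w)%N.
  by apply: IH => t tw; apply: ws; rewrite inE tw orbT.
by move=> h1 h2; apply: leq_trans (leq_add h1 h2) _; rewrite addn1.
Qed.

Lemma lenV g : len g^-1%g = len g.
Proof. by apply/eqP; rewrite eqn_leq lenV_le -{1}(invgK g) lenV_le. Qed.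

Lemma lenC g h : len (g^-1 * h)%g = len (h^-1 * g)%g.
Proof. by rewrite -lenV invgM invgK. Qed.

Lemma len_tri g h x : (len (g^-1 * h)%g <= len (g^-1 * x)%g + len (x^-1 * h)%g)%N.
Proof. by apply: leq_trans (lenM _ _); rewrite mulgA -(mulgA g^-1%g) mulgV mulg1. Qed.

Lemma len_split g k : (k <= len g)%N ->
  exists m : G, len m = k /\ len (m^-1 * g)%g = (len g - k)%N.
Proof.
move=> kg; have [w sw [ws wg]] := len_spells g.
pose a := (\prod_(s <- take k w) s)%g; pose b := (\prod_(s <- drop k w) s)%g.
have ab : (a * b)%g = g by rewrite /a /b -big_cat cat_take_drop.
have la : (len a <= k)%N.
  apply: leq_trans (_ : (size (take k w) <= k)%N); last by rewrite size_take; case: ifP => //; lia.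
  by apply: len_le; split=> // s /mem_take /ws.
have lb : (len b <= len g - k)%N.
  rewrite -sw -size_drop.
  by apply: len_le; split=> // s /mem_drop /ws.
have := lenM a b; rewrite ab => lab.
exists a; rewrite -ab mulKg ab; split; lia.
Qed.

Fixpoint wball n : seq G :=
  if n is m.+1 then undup (wball m ++ [seq (x * s)%g | x <- wball m, s <- S]) else [:: 1%g].

Lemma wball_uniq n : uniq (wball n).
Proof. by case: n => [|n] //=; exact: undup_uniq. Qed.

Lemma mem_wball n g : (g \in wball n) = (len g <= n)%N.
Proof.
elim: n g => [|n IH] g.
  rewrite inE leqn0; apply/eqP/eqP => [->|/len_eq0 //]; exact: len1.
rewrite mem_undup mem_cat IH; apply/idP/idP.
  case/orP => [|/allpairsP[[x s] /= [xb sS ->]]]; first by move=> /leqW.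
  move: xb; rewrite IH => xb; apply: leq_trans (lenM _ _) _.
  by have := len_gen sS; lia.
move=> gn; case: (leqP (len g) n) => //= ng.
have e : len g = n.+1 by lia.
have [m [lm lmg]] := @len_split g n (ltnW ng).
have [w sw [ws wg]] := len_spells (m^-1 * g)%g.
have sz1 : size w = 1%N by rewrite sw lmg e subSnn.
case: w sw ws wg sz1 => [//|s [|//]] _ ws wg _.
apply/allpairsP; exists (m, s) => /=; split.
- by rewrite IH lm.
- by apply: ws; rewrite mem_head.
- by move: wg; rewrite big_seq1 => ->; rewrite mulVKg.
Qed.

Definition sphere k : seq G := [seq g <- wball k | len g == k].

Lemma mem_sphere k g : (g \in sphere k) = (len g == k).
Proof. by rewrite mem_filter mem_wball; case: eqP => //= ->; rewrite leqnn. Qed.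

Lemma sphere_uniq k : uniq (sphere k).
Proof. exact/filter_uniq/wball_uniq. Qed.

Lemma size_wball n : (size (wball n) <= (size S).+1 ^ n)%N.
Proof.
elim: n => [|n IH] //=; apply: leq_trans (size_undup _) _.
by rewrite size_cat size_allpairs expnS mulSn mulnC leq_add // leq_mul2l IH orbT.
Qed.

(** The Gromov product based at the identity; other base points reduce to it by left invariance. *)
Definition gp x y : R := ((len x)%:R + (len y)%:R - (len (x^-1 * y)%g)%:R) / 2.

Lemma gpE (o x y : G) : gromov_product S R o x y = gp (o^-1 * x)%g (o^-1 * y)%g.
Proof.
rewrite /gromov_product /gp /word_dist -!(lenC o).
by rewrite invgM invgK -mulgA mulVKg.
Qed.

Lemma gpC x y : gp x y = gp y x.
Proof. by rewrite /gp (lenC x y) (addrC (len x)%:R). Qed.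

Lemma gp_lel x y : gp x y <= (len x)%:R.
Proof.
have := lenM x (x^-1 * y)%g; rewrite mulVKg -(ler_nat R) natrD /gp => ?; lra.
Qed.

Lemma gp_ler x y : gp x y <= (len y)%:R.
Proof. by rewrite gpC gp_lel. Qed.

Lemma len_gp x y : (len (x^-1 * y)%g)%:R = (len x)%:R + (len y)%:R - 2 * gp x y :> R.
Proof. by rewrite /gp; lra. Qed.

Lemma gp_ge_len x y : (len x)%:R - (len (x^-1 * y)%g)%:R <= gp x y.
Proof.
have := lenM y (y^-1 * x)%g; rewrite mulVKg -lenC -(ler_nat R) natrD /gp => ?; lra.
Qed.

Lemma gp_trans h x y : gp x y - (len h)%:R <= gp (h * x)%g (h * y)%g.
Proof.
have := lenM h^-1%g (h * x)%g; have := lenM h^-1%g (h * y)%g.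
rewrite !mulKg lenV -!(ler_nat R) !natrD /gp invgM -mulgA mulKg => ? ?; lra.
Qed.

Section Hyperbolic.
Variable delta : R.
Hypothesis delta_gt0 : 0 < delta.
Hypothesis hyp : forall x y z, Num.min (gp x y) (gp y z) - delta <= gp x z.

Lemma hyp_le c x y z : c <= gp x y -> c <= gp y z -> c - delta <= gp x z.
Proof.
move=> xy yz; apply: le_trans (hyp x y z); rewrite lerD2r.
by rewrite le_min xy yz.
Qed.

(** * Busemann functions and escape from finitely many directions *)

Section Branching.

(** Equals d(a^-1, y) - d(1, y): for [y] far away, a Busemann function evaluated at a^-1. *)
Let bus y a : R := (len (a * y)%g)%:R - (len y)%:R.

Lemma bus_le y a : `|bus y a| <= (len a)%:R.
Proof.
rewrite /bus ler_norml; have := lenM a y; have := lenM a^-1%g (a * y)%g.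
rewrite mulKg lenV -!(ler_nat R) !natrD => ? ?; apply/andP; split; lra.
Qed.

Lemma bus_comp a y z : (len a)%:R <= gp y z -> `|bus z a - bus y a| <= 2 * delta.
Proof.
move=> ayz; have e x : bus x a = (len a)%:R - 2 * gp a^-1%g x.
  by have := len_gp a^-1%g x; rewrite invgK lenV /bus => ->; lra.
have h1 : gp a^-1%g y - delta <= gp a^-1%g z.
  by apply: (@hyp_le _ _ y) => //; apply: le_trans ayz; rewrite -lenV; exact: gp_lel.
have h2 : gp a^-1%g z - delta <= gp a^-1%g y.
  by apply: (@hyp_le _ _ z); rewrite // (gpC z y); apply: le_trans ayz; rewrite -lenV; exact: gp_lel.
by rewrite !e ler_norml; apply/andP; split; lra.
Qed.

(** Here [m] is the point at distance t on a geodesic from 1 to [y]. The translates of [y] by [a]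
    and [b] share a long initial segment, [a * m] and [b * m] both lie near it, and their heights on
    it are given by the Busemann values. *)
Lemma bus_close y a b m t C : (len a <= t)%N -> (len b <= t)%N ->
  len m = t -> (len m + len (m^-1 * y)%g = len y)%N ->
  2 * t%:R <= gp (a * y)%g (b * y)%g -> `|bus y a - bus y b| <= C ->
  (len ((a * m)^-1 * (b * m))%g)%:R <= C + 10 * delta.
Proof.
move=> at_ bt mt my ab Cab; have d0 := delta_gt0.
have gmy : gp m y = t%:R.
  by have := congr1 (fun n => n%:R : R) my; rewrite natrD /gp mt; lra.
have key c : (len c <= t)%N ->
    `|(len (c * m)%g)%:R - t%:R - bus y c| <= 2 * delta /\
    t%:R + bus y c - delta <= gp (c * m)%g (c * y)%g.
  move=> ct; have h : `|bus m c - bus y c| <= 2 * delta.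
    by apply: bus_comp; rewrite gpC gmy ler_nat.
  rewrite -mt; split; first exact: h.
  have e : ((c * m)^-1 * (c * y))%g = (m^-1 * y)%g by rewrite invgM -mulgA mulKg.
  move: h; rewrite ler_norml /bus /gp e => /andP[? ?].
  have := congr1 (fun n => n%:R : R) my; rewrite natrD => ?; lra.
have [a1 a2] := key a at_; have [b1 b2] := key b bt.
have ba := bus_le y a; have bb := bus_le y b.
(* The depth t + c to which both points follow the common segment is dictated by the smaller
   Busemann value. *)
have [c [cE ca cb cC]] : exists c : R, [/\ c <= t%:R, c <= bus y a, c <= bus y b &
    bus y a + bus y b - 2 * c <= C].
  move: Cab ba bb at_ bt; rewrite -!(ler_nat R) !ler_norml.
  move=> /andP[? ?] /andP[? ?] /andP[? ?] ? ?.
  by case: (lerP (bus y a) (bus y b)) => ?; [exists (bus y a)|exists (bus y b)]; split; lra.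
have h2 : t%:R + c - delta <= gp (b * y)%g (b * m)%g by rewrite gpC; lra.
have h3 : t%:R + c - delta - delta <= gp (a * m)%g (b * y)%g.
  by apply: (@hyp_le _ _ (a * y)%g) => //; lra.
have h4 : t%:R + c - delta - delta - delta <= gp (a * m)%g (b * m)%g.
  by apply: (@hyp_le _ _ (b * y)%g) => //; lra.
by rewrite len_gp; move: a1 b1; rewrite !ler_norml => /andP[? ?] /andP[? ?]; lra.
Qed.

(** With [m] as in [bus_close], translation by [m] carries [E] injectively into one ball of radius
    r. *)
Lemma size_bus_class y (E : seq G) t C r : uniq E ->
  {in E, forall a, (len a <= t)%N} -> (t <= len y)%N ->
  {in E &, forall a b, 2 * t%:R <= gp (a * y)%g (b * y)%g} ->
  {in E &, forall a b, `|bus y a - bus y b| <= C} ->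
  C + 10 * delta <= r%:R -> (size E <= size (wball r))%N.
Proof.
case: E => [//|a0 E] uE Et ty Eg EC Cr.
have [m [mt my]] := len_split ty.
set f := fun a => ((a0 * m)^-1 * (a * m))%g.
rewrite -(size_map f); apply: uniq_leq_size.
  by rewrite map_inj_uniq // => a b /mulgI /mulIg.
move=> _ /mapP[a aE ->]; rewrite mem_wball -(ler_nat R).
apply: le_trans Cr; apply: (@bus_close y _ _ m t) => //; rewrite ?Et ?mem_head //.
- by rewrite mt my; lia.
- by apply: Eg; rewrite ?mem_head.
- by apply: EC; rewrite ?mem_head.
Qed.

Lemma size_cover (T U : eqType) (E : seq T) (xs : seq U) (P : U -> pred T) k :
  {in E, forall a, exists2 x : U, x \in xs & P x a} ->
  (forall x : U, x \in xs -> size [seq a <- E | P x a] <= k)%N ->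
  (size E <= size xs * k)%N.
Proof.
move=> cov sz; apply: (@leq_trans (\sum_(x <- xs) size [seq a <- E | P x a])).
  elim: E cov {sz} => [//|a E IH] cov.
  have [x xs_x Pxa] := cov a (mem_head _ _).
  have {}IH : (size E <= \sum_(x <- xs) size [seq a <- E | P x a])%N.
    by apply: IH => b bE; apply: cov; rewrite inE bE orbT.
  apply: leq_trans (_ : (1 + \sum_(x <- xs) size [seq a <- E | P x a] <= _)%N).
    by rewrite /= add1n ltnS.
  have -> : (\sum_(x <- xs) size [seq b <- a :: E | P x b] =
      \sum_(x <- xs) ((P x a : nat) + size [seq b <- E | P x b]))%N.
    by apply: eq_bigr => z _ /=; case: (P z a).
  rewrite big_split /= leq_add2r (big_rem x) //= Pxa.
  by rewrite leq_addr.
rewrite big_seq; apply: (@leq_trans (\sum_(i <- xs | i \in xs) k)); first by apply: leq_sum.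
by rewrite -big_seq big_const_seq count_predT iter_addn_0 mulnC.
Qed.

(** Witness against [branching] at scale n: every translate of [y] by the ball of radius n points
    towards one of the few directions [xs]. *)
Let trapped M n xs y := (size xs <= M)%N /\
  forall a, (len a <= n)%N -> exists2 x, x \in xs & n%:R < gp x (a * y)%g.

Lemma trapped_len M n xs y : trapped M n xs y -> (n <= len y)%N.
Proof.
move=> [_ /(_ 1%g)]; rewrite len1 mul1g => /(_ isT)[x _ h].
by rewrite -(ler_nat R); apply/ltW/(lt_le_trans h); exact: gp_ler.
Qed.

Lemma trapped_class n x y a b : n%:R < gp x (a * y)%g -> n%:R < gp x (b * y)%g ->
  n%:R - delta <= gp (a * y)%g (b * y)%g.
Proof. by move=> xa xb; apply: (@hyp_le _ _ x); [rewrite gpC|]; exact: ltW. Qed.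

Lemma size_trapped M n xs y (E : seq G) t C r : trapped M n xs y -> uniq E ->
  {in E, forall a, (len a <= t)%N} -> 2 * t%:R + delta <= n%:R ->
  {in E &, forall a b, `|bus y a - bus y b| <= C} ->
  C + 10 * delta <= r%:R -> (size E <= M * size (wball r))%N.
Proof.
move=> tr uE Et tn EC Cr; have d0 := delta_gt0.
have tn' : (t <= n)%N by rewrite -(ler_nat R); have := ler0n R t; move: d0; lra.
apply: (@leq_trans (size xs * size (wball r))); last by rewrite leq_mul2r tr.1 orbT.
apply: (size_cover (P := fun x a => n%:R < gp x (a * y)%g)).
  by move=> a aE; apply: tr.2; apply: leq_trans tn'; exact: Et.
move=> x _; apply: (@size_bus_class y _ t C r) => //.
- exact: filter_uniq.
- by move=> a; rewrite mem_filter => /andP[_ /Et].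
- exact: leq_trans tn' (trapped_len tr).
- move=> a b; rewrite !mem_filter => /andP[xa _] /andP[xb _].
  by have := trapped_class xa xb; lra.
- by move=> a b; rewrite !mem_filter => /andP[_ aE] /andP[_ bE]; exact: EC.
Qed.

(** The cocycle identity bus y (h s) = bus (s y) h + bus y s is exact; the error comes only from
    replacing [s * y] by [y]. *)
Lemma bus_step y s h : (len h)%:R <= gp (s * y)%g y ->
  `|bus y (h * s)%g - bus y h - bus y s| <= 2 * delta.
Proof.
move=> hs; have -> : bus y (h * s)%g - bus y h - bus y s = bus (s * y)%g h - bus y h.
  by rewrite /bus mulgA; lra.
by apply: bus_comp; rewrite gpC.
Qed.

(** If the Busemann values within each cluster were close, the ball of radius k would have at most M
    times the size of the ball of radius r. So two elements a, b of one cluster have distant values,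
    and b^-1 a is the required shift; the summand 2 delta pays for its Busemann value being only
    approximately the difference. *)
Lemma bus_shift M n xs y k C r : trapped M n xs y ->
  2 * k%:R + delta <= n%:R -> (M * size (wball r) < size (wball k))%N ->
  C + 2 * delta + 10 * delta <= r%:R -> 0 <= C ->
  exists s, [/\ (len s <= k + k)%N, C <= bus y s & n%:R - delta - k%:R <= gp (s * y)%g y].
Proof.
move=> tr kn szk Cr C0; have d0 := delta_gt0.
have kn' : (k <= n)%N by rewrite -(ler_nat R); have := ler0n R k; move: d0; lra.
have [x [a [b [[xx ak bk] [xa xb ab]]]]] : exists x a b, [/\ x \in xs, (len a <= k)%N &
   (len b <= k)%N] /\ [/\ n%:R < gp x (a * y)%g, n%:R < gp x (b * y)%g &
   C + 2 * delta < bus y a - bus y b].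
  apply: contrapT => no.
  suff : (size (wball k) <= M * size (wball r))%N by rewrite leqNgt szk.
  apply: (@leq_trans (size xs * size (wball r))); last by rewrite leq_mul2r tr.1 orbT.
  apply: (size_cover (P := fun x a => n%:R < gp x (a * y)%g)).
    by move=> a; rewrite mem_wball => ak; apply: tr.2; apply: leq_trans kn'.
  move=> x xx; apply: (@size_bus_class y _ k (C + 2 * delta) r) => //.
  - exact/filter_uniq/wball_uniq.
  - by move=> a; rewrite mem_filter mem_wball => /andP[_].
  - exact: leq_trans kn' (trapped_len tr).
  - move=> a b; rewrite !mem_filter => /andP[xa _] /andP[xb _].
    by have := trapped_class xa xb; lra.
  - move=> a b; rewrite !mem_filter !mem_wball => /andP[xa ak] /andP[xb bk].
    rewrite ler_norml; apply/andP; split; apply: contrapT => /negP; rewrite -ltNge => h;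
      apply: no.
      by exists x, b, a; split; split => //; lra.
    by exists x, a, b; split; split => //; lra.
have gab := trapped_class xa xb; exists (b^-1 * a)%g.
have nk : n%:R - delta >= k%:R by have := ler0n R k; lra.
split.
- by apply: leq_trans (lenM _ _) _; rewrite lenV leq_add.
- have : `|bus (a * y)%g b^-1%g - bus (b * y)%g b^-1%g| <= 2 * delta.
    apply: bus_comp; rewrite lenV gpC; apply: le_trans gab.
    by apply: le_trans nk; rewrite ler_nat.
  by move: ab; rewrite /bus mulKg -mulgA ler_norml => ? /andP[? ?]; lra.
- have := gp_trans b^-1%g (a * y)%g (b * y)%g; rewrite mulKg lenV -mulgA.
  by have : (len b)%:R <= k%:R :> R by [rewrite ler_nat]; lra.
Qed.

Lemma discrete_ivt (f : nat -> R) N c : 0 <= c ->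
  (forall i, (i < N)%N -> 1 <= f i - f i.+1 <= c) -> 0 <= f 0%N <= N%:R ->
  exists2 i, (i <= N)%N & 0 <= f i <= c.
Proof.
move=> c0; elim: N f => [|N IH] f st /andP[f0 fN].
  by exists 0%N => //; rewrite f0 (le_trans fN).
have [fc|fc] := lerP (f 0%N) c; first by exists 0%N; rewrite // f0.
have /andP[s1 s2] := st 0%N isT.
have [i iN fi] : exists2 i, (i <= N)%N & 0 <= f i.+1 <= c.
  apply: (IH (fun i => f i.+1)); first by move=> i iN; exact: st.
  by apply/andP; split; [lra|rewrite -natr1 in fN; lra].
by exists i.+1.
Qed.

Lemma cyclic_subgroup_div (c h h' : G) : cyclic_subgroup c h -> cyclic_subgroup c h' ->
  cyclic_subgroup c (h^-1 * h')%g.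
Proof.
have sub m n : (c ^- m * c ^+ n)%g = (c ^+ (n - m))%g \/ (c ^- m * c ^+ n)%g = (c ^- (m - n))%g.
  case: (leqP m n) => mn.
    by left; rewrite -{1}(subnKC mn) expgnDr mulKg.
  by right; rewrite -{1}(subnKC (ltnW mn)) expgnDr invgM -mulgA mulVg mulg1.
move=> [m [] ->] [n [] ->]; rewrite ?invgK.
- by case: (sub m n) => ->; [exists (n - m)%N; left|exists (m - n)%N; right].
- by exists (n + m)%N; right; rewrite expgnDr invgM.
- by exists (m + n)%N; left; rewrite expgnDr.
- have -> : (c ^+ m * c ^- n = c ^- n * c ^+ m)%g.
    by apply: (mulgI (c ^+ n)%g); rewrite mulVKg mulgA -expgnDr addnC expgnDr mulgK.
  by case: (sub n m) => ->; [exists (m - n)%N; left|exists (n - m)%N; right].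
Qed.

Lemma left_coset_eq (c g g' h h' : G) : cyclic_subgroup c h -> cyclic_subgroup c h' ->
  (g * h = g' * h')%g -> left_coset g (cyclic_subgroup c) = left_coset g' (cyclic_subgroup c).
Proof.
move=> Hh Hh' e.
have main (k k' l l' : G) : cyclic_subgroup c l -> cyclic_subgroup c l' -> (k * l = k' * l')%g ->
    left_coset k (cyclic_subgroup c) `<=` left_coset k' (cyclic_subgroup c).
  move=> Hl Hl' kl _ [x Hx <-]; exists (l' * (l^-1 * x))%g; last first.
    by rewrite mulgA -kl -mulgA mulVKg.
  have Hlx := cyclic_subgroup_div Hl Hx.
  have H1 : cyclic_subgroup c 1%g by exists 0%N; left; rewrite expg0.
  have Hl'V := cyclic_subgroup_div Hl' H1.
  by have := cyclic_subgroup_div Hl'V Hlx; rewrite mulg1 invgK.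
by apply/seteqP; split; [exact: (main _ _ h h')|exact: (main _ _ h' h)].
Qed.

Hypothesis nonel : ~ elementary G.

(** Otherwise G is finite and its trivial subgroup has finite index. *)
Lemma wball_unbounded N : exists k, (N < size (wball k))%N.
Proof.
apply: contrapT => no; apply: nonel; exists 1%g.
have [k kmax] : exists k, forall j, (size (wball j) <= size (wball k))%N.
  apply: contrapT => nomax; apply: no.
  elim: N => [|N [k IH]]; first by exists 0%N.
  have [j jk] : exists j, (size (wball k) < size (wball j))%N.
    apply: contrapT => no; apply: nomax; exists k => j; rewrite leqNgt.
    by apply/negP => h; apply: no; exists j.
  by exists j; exact: leq_ltn_trans jk.
have all g : g \in wball k.
  have sub : {subset wball k <= wball (maxn k (len g))}.
    by move=> x; rewrite !mem_wball => /leq_trans; apply; exact: leq_maxl.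
  have [_ e] := uniq_min_size (wball_uniq k) sub (kmax _).
  by rewrite e mem_wball leq_maxr.
apply: (@sub_finite_set _ _ [set left_coset g (cyclic_subgroup 1%g) | g in [set` wball k]]).
  by move=> _ [g _ <-]; exists g => //=; exact: all.
by apply: finite_image; exact: finite_seq.
Qed.

Lemma nat_above (x : R) : exists n : nat, x <= n%:R.
Proof. by exists (Num.bound `|x|); rewrite (le_trans (ler_norm x)) ?ltW ?archi_boundP. Qed.

Lemma len_pow s n : (len (s ^+ n)%g <= n * len s)%N.
Proof.
elim: n => [|n IH]; first by rewrite expg0 len1.
by rewrite expgSr mulSn addnC; apply: leq_trans (lenM _ _) _; rewrite leq_add2r.
Qed.

(** Each multiplication by [s] raises the Busemann value by an amount between 1 and C, so at most L
    powers of [s] or of its inverse bring the value of [g], at most L in size, into a window of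
    length C around 0. *)
Lemma bus_reduce y s g L C : (len g <= L)%N -> 2 * delta + 1 <= bus y s ->
  (len s)%:R + 2 * delta <= C -> (L + L * len s)%:R <= gp (s * y)%g y ->
  exists2 h, cyclic_subgroup s h &
    (len (g * h)%g <= L + L * len s)%N /\ `|bus y (g * h)%g| <= C.
Proof.
move=> gL sb sC Lgp; have d0 := delta_gt0.
have short i j : (i <= L)%N -> (len (s ^+ j)%g <= i * len s)%N ->
    (len (g * s ^+ j)%g <= L + L * len s)%N /\ (len (g * s ^- j)%g <= L + L * len s)%N.
  move=> iL sj; have h : (L + i * len s <= L + L * len s)%N by rewrite leq_add2l leq_mul2r iL orbT.
  by split; apply: leq_trans h; apply: leq_trans (lenM _ _) _; rewrite ?lenV leq_add.
have bs := le_trans (ler_norm _) (bus_le y s).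
have bg := bus_le y g; have gL' : (len g)%:R <= L%:R :> R by rewrite ler_nat.
have C0 : 0 <= C by lra.
have step h : (len h <= L + L * len s)%N -> 1 <= bus y (h * s)%g - bus y h <= C.
  move=> hl; have := @bus_step y s h; rewrite (le_trans _ Lgp) ?ler_nat // => /(_ isT).
  by rewrite ler_norml => /andP[? ?]; apply/andP; split; lra.
have [b0|b0] := lerP 0 (bus y g).
  have [||i iL ib] := @discrete_ivt (fun i => bus y (g * s ^- i)%g) L C C0.
  - move=> i iL; have [_ sh] := short i.+1 i.+1 iL (len_pow s _).
    have := step _ sh; rewrite -mulgA; suff -> : (s ^- i.+1 * s = s ^- i)%g by [].
    by rewrite expgSr invgM -expgSr expgS invgM mulgVK || rewrite expgS invgM mulgVK.
  - rewrite expg0 invg1 mulg1 b0; move: bg; rewrite ler_norml => /andP[_ bg].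
    exact: le_trans bg gL'.
  exists (s ^- i)%g; first by exists i; right.
  have [_ ?] := short i i iL (len_pow s _); split=> //.
  by rewrite ger0_norm; case/andP: ib.
have [||i iL ib] := @discrete_ivt (fun i => - bus y (g * s ^+ i)%g) L C C0.
- move=> i iL; have [sh _] := short i i (ltnW iL) (len_pow s _).
  by have := step _ sh; rewrite -mulgA -expgSr => /andP[? ?]; apply/andP; split; lra.
- rewrite expg0 mulg1; move: bg; rewrite ler_norml => /andP[? ?]; apply/andP; split; lra.
exists (s ^+ i)%g; first by exists i; left.
have [? _] := short i i iL (len_pow s _); split=> //.
by rewrite -normrN ger0_norm; case/andP: ib.
Qed.

(* Otherwise some orbits [wball n * y] cluster at [M] boundary points for every
   [n]. The Busemann function [bus y] is then almost additive on the elements that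
   keep [y] in its cluster, it exceeds its own error on one of them, [s], and
   boundedly many cosets of the powers of [s] cover [G]. *)
Lemma branching M : exists (l : nat) (c : R), forall xs y, (size xs <= M)%N ->
  exists2 a, (len a <= l)%N & forall x, x \in xs -> gp x (a * y)%g <= c.
Proof.
apply: contrapT => no; have d0 := delta_gt0.
have {no} bad n : exists xs y, trapped M n xs y.
  apply: contrapT => ntr; apply: no; exists n, n%:R => xs y szM.
  apply: contrapT => na; apply: ntr; exists xs, y; split=> // a an.
  apply: contrapT => nx; apply: na; exists a => // x xx.
  by rewrite leNgt; apply/negP => h; apply: nx; exists x.
(* One more than the error in [bus_step], so that multiplication by [s] gains at least 1. *)
pose C := 2 * delta + 1.
have [r rC] := nat_above (C + 2 * delta + 10 * delta).
have [k kr] := wball_unbounded (M * size (wball r)).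
pose P s n := exists xs y, [/\ trapped M n xs y, C <= bus y s & n%:R - delta - k%:R <= gp (s * y)%g y].
(* The shift found at scale n depends on n but ranges over a fixed finite ball, so one [s] serves
   arbitrarily large n. *)
have [s [sk sP]] : exists s, (len s <= k + k)%N /\ forall N, exists2 n, (N <= n)%N & P s n.
  apply: contrapT => no.
  have /choice [Nf NfP] : forall s, exists N, (len s <= k + k)%N -> forall n, (N <= n)%N -> ~ P s n.
    move=> s; apply: contrapT => nN; apply: no; exists s.
    have [sk|sk] := leqP (len s) (k + k); last by exfalso; apply: nN; exists 0%N; rewrite leqNgt sk.
    split=> // N; apply: contrapT => nn; apply: nN; exists N => _ n Nn Psn.
    by apply: nn; exists n.
  have [N0 N0P] := nat_above (2 * k%:R + delta).
  pose n := maxn N0 (\max_(s <- wball (k + k)) Nf s).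
  have [xs [y tr]] := bad n.
  have kn : 2 * k%:R + delta <= n%:R by apply: le_trans N0P _; rewrite ler_nat leq_maxl.
  have C0 : 0 <= C by rewrite /C; lra.
  have [s [sk sb sg]] := bus_shift tr kn kr rC C0.
  apply: (NfP s sk n _); last by exists xs, y.
  by rewrite /n leq_max; apply/orP; right; apply: (@leq_bigmax_seq _ (wball (k + k)) xpredT Nf s); rewrite ?mem_wball.
apply: nonel; exists s; apply: contrapT => infH.
have [r1 r1P] := nat_above (2 * ((k + k)%:R + 2 * delta) + 10 * delta).
(* More cosets than [size_trapped] allows. Each gets a representative with bounded Busemann value;
   the scale n is chosen afterwards, larger than the lengths of these representatives require. *)
have [B [Buniq Bsub Bsz]] : exists B : seq (set G), [/\ uniq B,
    forall X, X \in B -> exists g, left_coset g (cyclic_subgroup s) = X &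
    (M * size (wball r1) < size B)%N].
  have [B Bsub Bsz] := infinite_set_fset (M * size (wball r1)).+1 infH.
  exists (finmap.enum_fset B); split=> //; first exact: finmap.fset_uniq.
  by move=> X XB; have [g _ gX] := Bsub X XB; exists g.
have /choice [rep repP] : forall X : set G, exists g, X \in B -> left_coset g (cyclic_subgroup s) = X.
  move=> X; have [XB|XB] := boolP (X \in B); last by exists 1%g.
  by have [g gX] := Bsub X XB; exists g.
pose L := \max_(X <- B) len (rep X).
have [N0 N0P] := nat_above ((L + L * len s)%:R + delta + k%:R + 2 * (L + L * len s)%:R + delta).
have [n Nn [xs [y [tr sb sg]]]] := sP N0.
have nN : (N0%:R : R) <= n%:R by rewrite ler_nat.
have k0 := ler0n R k; have L0 := ler0n R (L + L * len s).
have /choice [h hP] : forall X : set G, exists g, X \in B ->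
   [/\ cyclic_subgroup s g, (len (rep X * g)%g <= L + L * len s)%N &
     `|bus y (rep X * g)%g| <= (k + k)%:R + 2 * delta].
  move=> X; have [XB|XB] := boolP (X \in B); last by exists 1%g.
  have [| | | |g Hg [g1 g2]] := @bus_reduce y s (rep X) L ((k + k)%:R + 2 * delta).
  - by apply: (@leq_bigmax_seq _ B xpredT (fun X => len (rep X)) X).
  - by move: sb; rewrite /C.
  - by rewrite lerD2r ler_nat.
  - by lra.
  by exists g.
pose E := [seq (rep X * h X)%g | X <- B].
suff : (size E <= M * size (wball r1))%N.
  by rewrite size_map; apply/negP; rewrite -ltnNge.
apply: (@size_trapped M n xs y E (L + L * len s) (2 * ((k + k)%:R + 2 * delta))) => //.
- rewrite map_inj_in_uniq // => X Y XB YB e.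
  have [HX _ _] := hP X XB; have [HY _ _] := hP Y YB.
  by rewrite -(repP X XB) -(repP Y YB); exact: left_coset_eq e.
- by move=> _ /mapP[X XB ->]; have [] := hP X XB.
- by lra.
- move=> _ _ /mapP[X XB ->] /mapP[Y YB ->].
  have [_ _ hX] := hP X XB; have [_ _ hY] := hP Y YB.
  by apply: le_trans (ler_normB _ _) _; lra.
Qed.

End Branching.

(** * Joining without cancellation, and the growth of spheres *)

Section NonElementary.
Hypothesis nonel : ~ elementary G.

(** Branching away from the single direction [g^-1] bounds the Gromov product of [g^-1] and [a * h],
    which is the cancellation in the product. *)
Lemma connector : exists l c : nat, forall g h, exists2 a, (len a <= l)%N &
  (len g + len h <= len (g * a * h)%g + c)%N.
Proof.
have [l [c lc]] := branching nonel 1.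
have [c' cc'] := nat_above (2 * c + l%:R).
exists l, c' => g h; have [a al ac] := lc [:: g^-1%g] h isT.
exists a => //; have := ac _ (mem_head _ _).
have := len_gp g^-1%g (a * h)%g; rewrite invgK mulgA lenV => e.
have := lenM a^-1%g (a * h)%g; rewrite mulKg lenV.
by rewrite -!(ler_nat R) !natrD e => ? ?; have : (len a)%:R <= l%:R :> R by [rewrite ler_nat]; lra.
Qed.

(** A long element is moved off the directions already found by a shift of bounded length, which
    hardly shortens it. The bound c depends on m but not on L. *)
Lemma spread m : exists c : R, forall L, exists zs : seq G,
  [/\ size zs = m, {in zs, forall z, (L <= len z)%N} & pairwise (fun x y => gp x y <= c) zs].
Proof.
elim: m => [|m [c IH]]; first by exists 0 => L; exists [::].
have [l [c' lc]] := branching nonel m.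
exists (Num.max c c') => L; have [zs [szs zL zc]] := IH L.
have [k kk] := wball_unbounded nonel (size (wball (L + l))).
have [y yk] : exists y, (L + l < len y)%N.
  apply: contrapT => no; move: kk; rewrite ltnNge => /negP; apply.
  apply: uniq_leq_size; first exact: wball_uniq.
  by move=> x _; rewrite mem_wball leqNgt; apply/negP => h; apply: no; exists x.
have [|a al ac] := lc zs y; first by rewrite szs.
exists (rcons zs (a * y)%g); split.
- by rewrite size_rcons szs.
- move=> z; rewrite mem_rcons inE => /orP[/eqP ->|/zL //].
  by have := lenM a^-1%g (a * y)%g; rewrite mulKg lenV; lia.
- rewrite pairwise_rcons; apply/andP; split.
    by apply/allP => z /ac h; rewrite le_max h orbT.
  by apply: sub_pairwise zc => x z h; rewrite le_max h.
Qed.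

(** Geodesics to N spread out elements have separated before the distance L > c, so their points at
    distance L are distinct. *)
Lemma sphere_unbounded N : exists k, (N <= size (sphere k))%N.
Proof.
have [c sp] := spread N; have [L0 cL0] := nat_above c.
pose L := L0.+1; have cL : c < L%:R by rewrite (le_lt_trans cL0) // ltr_nat.
have [zs [szs zL zc]] := sp L; exists L.
have /choice [f fP] : forall z, exists p : G, (L <= len z)%N -> len p = L /\ len (p^-1 * z)%g = (len z - L)%N.
  move=> z; have [h|h] := leqP L (len z); last by exists 1%g.
  by have [p [p1 p2]] := len_split h; exists p.
rewrite -szs -(size_map f); apply: uniq_leq_size; last first.
  by move=> _ /mapP[z zz ->]; rewrite mem_sphere (fP z (zL z zz)).1.
have neq x y : (L <= len x)%N -> (L <= len y)%N -> gp x y <= c -> f x != f y.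
  move=> xL yL xy; apply/eqP => e.
  have [_ x2] := fP x xL; have [_ y2] := fP y yL.
  have := len_tri x y (f x); rewrite (lenC x (f x)) x2 e y2.
  rewrite -(ler_nat R) natrD !natrB // len_gp => ?; lra.
elim: zs zL zc {szs sp} => [//|z zs IH] zL /= /andP[zz zc].
rewrite IH // ?andbT; last by move=> x xz; apply: zL; rewrite inE xz orbT.
apply/mapP => -[x xzs e]; have := neq z x (zL _ (mem_head _ _)); rewrite e eqxx.
by move=> /(_ (zL _ _) (allP zz _ xzs)); rewrite inE xzs orbT => /(_ isT).
Qed.

End NonElementary.

(* A geodesic from [1] to [eta] nearly passes through [g], so [eta] and the
   length of [g] determine [g] up to a ball of bounded radius. *)
Lemma count_near k c r (E : seq (G * G)) (f : G -> R) : uniq E ->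
  (forall e, e \in E -> len e.1 = k /\ (k + len (e.1^-1 * e.2)%g <= len e.2 + c)%N) ->
  c%:R + 2 * delta <= r%:R -> (forall x, 0 <= f x) ->
  \sum_(e <- E) f e.2 <= (size (wball r))%:R * \sum_(x <- undup [seq e.2 | e <- E]) f x.
Proof.
move=> uE Ek cr f0; have d0 := delta_gt0.
have -> : \sum_(e <- E) f e.2 =
    \sum_(x <- undup [seq e.2 | e <- E]) \sum_(e <- E | e.2 == x) f e.2.
  rewrite (exchange_big_dep xpredT) //= [LHS]big_seq [RHS]big_seq; apply: eq_bigr => e eE.
  rewrite -big_filter (_ : [seq x <- _ | _] = [:: e.2]) ?big_seq1 //.
  rewrite -(filter_pred1_uniq (undup_uniq [seq e.2 | e <- E])) ?mem_undup ?map_f //.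
  by apply: eq_filter => x /=; rewrite eq_sym.
rewrite mulr_sumr big_seq [leRHS]big_seq; apply: ler_sum => x.
rewrite mem_undup => /mapP[e0 e0E xe0].
rewrite (eq_bigr (fun=> f x)); last by move=> e /eqP ->.
rewrite big_const_seq iter_addr_0 -[leLHS]mulr_natl ler_wpM2r // ler_nat.
(* The point at distance k on a geodesic to [x], near which every admissible [g] lies. The minimum
   is taken because [x] can be shorter than k, by at most c. *)
have [m [mk mx]] := @len_split x (minn k (len x)) (geq_minr _ _).
rewrite -size_filter -(size_map (fun e => m^-1 * e.1)%g); apply: uniq_leq_size.
  rewrite map_inj_in_uniq ?filter_uniq // => -[a b] [a' b'].
  by rewrite !mem_filter /= => /andP[/eqP -> _] /andP[/eqP -> _] /mulgI ->.
move=> u /mapP[[g b]]; rewrite mem_filter /= => /andP[/eqP -> gE] ->.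
have [/= gk kc] := Ek _ gE.
rewrite mem_wball -(ler_nat R); apply: le_trans cr.
have gmx : gp m x = (minn k (len x))%:R.
  by rewrite /gp mx mk natrB ?geq_minr //; lra.
have tri := lenM g (g^-1 * x)%g; rewrite mulVKg in tri.
have gx : k%:R - c%:R / 2 <= gp g x.
  by rewrite /gp gk; move: kc; rewrite -(ler_nat R) !natrD; lra.
rewrite len_gp mk gk.
have [kx|xk] := leqP k (len x).
  have /minn_idPl e := kx; rewrite e in gmx *.
  have : k%:R - c%:R / 2 - delta <= gp m g.
    by apply: (@hyp_le _ _ x); rewrite ?gmx 1?gpC //; have := ler0n R c; lra.
  by lra.
have e : minn k (len x) = len x by apply/minn_idPr/ltnW.
rewrite e in gmx *.
have kcx : k%:R - c%:R <= (len x)%:R :> R by rewrite lerBlDr -natrD ler_nat; lia.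
have xk' : (len x)%:R <= k%:R :> R by rewrite ler_nat ltnW.
have [h|h] := lerP (len x)%:R (k%:R - c%:R / 2 : R).
  have : (len x)%:R - delta <= gp m g.
    by apply: (@hyp_le _ _ x); rewrite ?gmx // gpC; exact: le_trans h gx.
  by lra.
have : k%:R - c%:R / 2 - delta <= gp m g.
  by apply: (@hyp_le _ _ x); rewrite ?gmx 1?gpC // ltW.
by lra.
Qed.

(* Frink's metrization argument for the visual quasi-metric. *)
Section Visual.
Variable eps : R.
Hypothesis eps_gt0 : 0 < eps.
Hypothesis eps_small : expR (2 * eps * delta) <= 2.

Definition vis x y : R := expR (- (eps * gp x y)).

Lemma vis_gt0 x y : 0 < vis x y.
Proof. exact: expR_gt0. Qed.

Lemma vis_tri T x y z : vis x y <= T -> vis y z <= T -> vis x z <= expR (eps * delta) * T.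
Proof.
move=> xy yz; have e0 := eps_gt0; have := hyp x y z.
have [h|h] := lerP (gp x y) (gp y z) => hy.
  apply: le_trans (_ : expR (eps * delta) * vis x y <= _); last by rewrite ler_wpM2l ?expR_ge0.
  by rewrite -expRD ler_expR; nra.
apply: le_trans (_ : expR (eps * delta) * vis y z <= _); last by rewrite ler_wpM2l ?expR_ge0.
by rewrite -expRD ler_expR; nra.
Qed.

Fixpoint chain_sum p (s : seq G) : R :=
  if s is v :: s' then vis p v + chain_sum v s' else 0.

Lemma chain_sum_ge0 p s : 0 <= chain_sum p s.
Proof.
elim: s p => [|v s IH] p //=.
by apply: addr_ge0; [exact/ltW/vis_gt0|exact: IH].
Qed.

Lemma chain_sum_rcons p s v : chain_sum p (rcons s v) = chain_sum p s + vis (last p s) v.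
Proof. by elim: s p => [|u s IH] p /=; rewrite ?addr0 ?add0r // IH addrA. Qed.

Lemma chain_sum_cat p s s' : chain_sum p (s ++ s') = chain_sum p s + chain_sum (last p s) s'.
Proof. by elim: s p => [|u s IH] p /=; rewrite ?add0r // IH addrA. Qed.

Lemma chain_cut p s c : 0 <= c -> c < chain_sum p s ->
  exists s1 v s2, [/\ s = s1 ++ v :: s2, chain_sum p s1 <= c &
    c <= chain_sum p s1 + vis (last p s1) v].
Proof.
elim: s p c => [|u s IH] p c c0 /= cs; first by have := le_lt_trans c0 cs; rewrite ltxx.
have [h|h] := lerP c (vis p u).
  by exists [::], u, s; split; rewrite //= add0r.
have [||s1 [v [s2 [-> h1 h2]]]] := IH u (c - vis p u); [lra|lra|].
by exists (u :: s1), v, s2; split => //=; lra.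
Qed.

(** The chain is cut at the link that crosses half of its sum T. By induction the two outer pieces
    span visual size at most T, and the link is itself at most T; joining the three pieces costs two
    quasi-triangle inequalities, hence a factor exp(2 eps delta) <= 2. *)
Lemma frink p s : s != [::] -> vis p (last p s) <= 2 * chain_sum p s.
Proof.
have [n] := ubnP (size s); elim: n => // n IH in p s *.
move=> sn s0; set T := chain_sum p s.
have T0 : 0 < T.
  rewrite /T; case: (s) s0 => [//|v s'] _ /=.
  by apply: ltr_pwDl; [exact: vis_gt0|exact: chain_sum_ge0].
have [||s1 [v [s2 [e h1 h2]]]] := @chain_cut p s (T / 2); [lra|rewrite -/T; lra|].
have eT : T = chain_sum p s1 + (vis (last p s1) v + chain_sum v s2) by rewrite /T e chain_sum_cat.
have c2 := chain_sum_ge0 v s2; have c1 := chain_sum_ge0 p s1.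
have Tmid : vis (last p s1) v <= T by lra.
have ed0 : 1 <= expR (eps * delta) by rewrite -expR0 ler_expR; have := delta_gt0; have := eps_gt0; nra.
have ed1 : expR (eps * delta) * (expR (eps * delta) * T) <= 2 * T.
  rewrite mulrA -expRD ler_pM2r //; apply: le_trans eps_small.
  by rewrite ler_expR; lra.
have edT : T <= expR (eps * delta) * T by rewrite ler_peMl // (ltW T0).
have A : vis p v <= expR (eps * delta) * T.
  case: (eqVneq s1 [::]) Tmid h1 e => [->|s10] Tmid h1 e /=.
    exact: le_trans edT.
  apply: (vis_tri (y := last p s1)) => //.
  apply: le_trans (IH p s1 _ s10) _; last by lra.
  by move: sn; rewrite e size_cat /= addnS ltnS => h; apply: leq_ltn_trans h; exact: leq_addr.
have -> : last p s = last v s2 by rewrite e last_cat.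
case: (eqVneq s2 [::]) => [->|s20] /=.
  by apply: (le_trans A); apply: le_trans ed1; rewrite ler_peMl // mulr_ge0 ?expR_ge0 // ltW.
apply: le_trans ed1; apply: (vis_tri (y := v)) => //.
apply: le_trans (IH v s2 _ s20) _; last by lra.
by move: sn; rewrite e size_cat /= addnS ltnS => h; apply: leq_ltn_trans h; exact: leq_addl.
Qed.

(** The empty chain makes this vanish for v = p although [vis p p] is positive, so the comparison
    with [vis] has to exclude that case. *)
Definition chain_dist p v : R := inf [set chain_sum p s | s in [set s | last p s = v]].

Lemma chain_dist_has_inf p v : has_inf [set chain_sum p s | s in [set s | last p s = v]].
Proof.
split; first by exists (chain_sum p [:: v]), [:: v].
by exists 0 => _ [s _ <-]; exact: chain_sum_ge0.
Qed.

Lemma chain_dist_ub p s : chain_dist p (last p s) <= chain_sum p s.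
Proof. by apply: ge_inf; [have [] := chain_dist_has_inf p (last p s)|exists s]. Qed.

Lemma chain_dist_refl p : chain_dist p p <= 0.
Proof. exact: (chain_dist_ub p [::]). Qed.

Lemma vis_chain_dist p v : v != p -> vis p v / 2 <= chain_dist p v.
Proof.
move=> vp; apply: lb_le_inf; first by case: (chain_dist_has_inf p v).
move=> _ [s sv <-]; have s0 : s != [::] by apply: contra_neq vp => e; rewrite -sv e.
by have := @frink p s s0; rewrite sv; lra.
Qed.

Lemma chain_dist_step p u v : chain_dist p v <= chain_dist p u + vis u v.
Proof.
rewrite -lerBlDr; apply: lb_le_inf; first by case: (chain_dist_has_inf p u).
move=> _ [s su <-]; rewrite lerBlDr.
by have := chain_dist_ub p (rcons s v); rewrite last_rcons chain_sum_rcons su.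
Qed.

End Visual.

End Hyperbolic.
End WordMetric.

(** * Sums of nonnegative families *)

Section Sums.
Variable R : realType.

Definition fin_sums (T : eqType) (f : T -> R) (P : T -> Prop) : set R :=
  [set x | exists X : seq T, [/\ uniq X, {in X, forall t, P t} & x = \sum_(t <- X) f t]].

Definition has_sum (T : eqType) (f : T -> R) P := has_ubound (fin_sums f P).

(* Junk value [0] if [f] is not summable on [P]. *)
Definition tsum (T : eqType) (f : T -> R) P : R := sup (fin_sums f P).

Lemma le_sum_sub (T : eqType) (f : T -> R) (X Y : seq T) : (forall t, 0 <= f t) ->
  uniq X -> uniq Y -> {subset X <= Y} -> \sum_(t <- X) f t <= \sum_(t <- Y) f t.
Proof.
move=> f0 uX uY XY.
have e : perm_eq X [seq t <- Y | t \in X].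
  by apply: uniq_perm; rewrite ?filter_uniq // => t; rewrite mem_filter andb_idr // => /XY.
rewrite (perm_big _ e) big_filter [leRHS](bigID (mem X) xpredT) /=.
by rewrite lerDl sumr_ge0.
Qed.

Section Basic.
Variables (T : eqType) (f : T -> R).
Implicit Types (P Q : T -> Prop) (X : seq T).

Lemma fin_sums_neq0 P : fin_sums f P !=set0.
Proof. by exists 0, [::]; split; rewrite ?big_nil. Qed.

Lemma tsum_le P B : (forall X, uniq X -> {in X, forall t, P t} -> \sum_(t <- X) f t <= B) ->
  tsum f P <= B.
Proof.
by move=> h; apply: ge_sup; [exact: fin_sums_neq0|move=> _ [X [uX XP ->]]; exact: h].
Qed.

Lemma has_sum_le P B : (forall X, uniq X -> {in X, forall t, P t} -> \sum_(t <- X) f t <= B) ->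
  has_sum f P.
Proof. by move=> h; exists B => _ [X [uX XP ->]]; exact: h. Qed.

Lemma sum_le_tsum P X : has_sum f P -> uniq X -> {in X, forall t, P t} ->
  \sum_(t <- X) f t <= tsum f P.
Proof. by move=> bP uX XP; apply: ub_le_sup => //; exists X. Qed.

Lemma term_le_tsum P t : has_sum f P -> P t -> f t <= tsum f P.
Proof.
move=> bP Pt; have := @sum_le_tsum P [:: t] bP isT; rewrite big_seq1; apply.
by move=> s; rewrite inE => /eqP ->.
Qed.

Lemma tsum_ge0 P : 0 <= tsum f P.
Proof.
have [bP|nb] := pselect (has_sum f P).
  by have := @sum_le_tsum P [::] bP isT; rewrite big_nil; apply.
by rewrite /tsum sup_out // => -[].
Qed.

Lemma has_sumS P Q : (forall t, P t -> Q t) -> has_sum f Q -> has_sum f P.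
Proof.
by move=> PQ [B QB]; exists B => _ [X [uX XP ->]]; apply: QB; exists X; split=> // t /XP /PQ.
Qed.

Lemma tsumS P Q : (forall t, P t -> Q t) -> has_sum f Q -> tsum f P <= tsum f Q.
Proof.
by move=> PQ bQ; apply: tsum_le => X uX XP; apply: sum_le_tsum => // t /XP /PQ.
Qed.

Lemma tsum_adherent P e : has_sum f P -> 0 < e ->
  exists X, [/\ uniq X, {in X, forall t, P t} & tsum f P - e < \sum_(t <- X) f t].
Proof.
move=> bP e0; have [|_ [X [uX XP ->]] h] := @sup_adherent _ (fin_sums f P) _ e0.
  by split=> //; exact: fin_sums_neq0.
by exists X.
Qed.

Lemma sum_subadd X Q1 Q2 : uniq X -> {in X, forall t, Q1 t \/ Q2 t} ->
  has_sum f Q1 -> has_sum f Q2 -> \sum_(t <- X) f t <= tsum f Q1 + tsum f Q2.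
Proof.
move=> uX PQ b1 b2.
rewrite (bigID (fun t => `[< Q1 t >])) /= lerD //.
  rewrite -big_filter sum_le_tsum ?filter_uniq // => t.
  by rewrite mem_filter => /andP[/asboolP].
rewrite -big_filter sum_le_tsum ?filter_uniq // => t.
by rewrite mem_filter => /andP[/asboolP nQ /PQ []].
Qed.

Lemma tsum_subadd P Q1 Q2 : (forall t, P t -> Q1 t \/ Q2 t) ->
  has_sum f Q1 -> has_sum f Q2 -> tsum f P <= tsum f Q1 + tsum f Q2.
Proof. by move=> PQ b1 b2; apply: tsum_le => X uX XP; apply: sum_subadd => // t /XP /PQ. Qed.

Lemma tsum_cover P (Q : nat -> T -> Prop) n : (forall t, P t -> exists2 k, (k < n)%N & Q k t) ->
  (forall k, has_sum f (Q k)) -> tsum f P <= \sum_(k < n) tsum f (Q k).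
Proof.
move=> PQ b; elim: n P PQ => [|n IH] P PQ.
  rewrite big_ord0; apply: tsum_le => -[_ _|t X _ XP]; first by rewrite big_nil.
  by have [] := PQ t (XP t (mem_head _ _)).
have bP m : has_sum f (fun t => exists2 k, (k < m)%N & Q k t).
  elim: m => [|m IHm].
    apply: (@has_sum_le _ 0) => -[_ _|t X _ XP]; first by rewrite big_nil.
    by have [] := XP t (mem_head _ _).
  apply: has_sum_le => X uX XP; apply: (sum_subadd uX _ IHm (b m)) => t /XP[k].
  by rewrite ltnS leq_eqVlt => /predU1P[->|km] h; [right|left; exists k].
rewrite big_ord_recr /=.
apply: le_trans (_ : tsum f (fun t => exists2 k, (k < n)%N & Q k t) + tsum f (Q n) <= _).
  by apply: tsum_subadd => // t /PQ[k]; rewrite ltnS leq_eqVlt => /predU1P[->|kn] h; [right|left; exists k].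
by rewrite lerD2r; exact: IH.
Qed.

End Basic.

Lemma le_tsum (T : eqType) (f g : T -> R) (P : T -> Prop) :
  (forall t, P t -> f t <= g t) -> has_sum g P -> tsum f P <= tsum g P.
Proof.
move=> fg bg; apply: tsum_le => X uX XP; apply: le_trans (sum_le_tsum bg uX XP).
by rewrite big_seq [leRHS]big_seq; apply: ler_sum => t /XP /fg.
Qed.

Lemma le_has_sum (T : eqType) (f g : T -> R) (P : T -> Prop) :
  (forall t, P t -> f t <= g t) -> has_sum g P -> has_sum f P.
Proof.
move=> fg bg; apply: (@has_sum_le _ _ _ (tsum g P)) => X uX XP.
apply: le_trans (sum_le_tsum bg uX XP).
by rewrite big_seq [leRHS]big_seq; apply: ler_sum => t /XP /fg.
Qed.

(** * Comparison of sums along a finite family of injections *)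

Section Transfer.
Variables (T T' U : eqType) (f : T -> R) (f' : T' -> R) (C : seq U) (phi : U -> T -> T').
Variables (P : T -> Prop) (P' : T' -> Prop) (K : R).
Hypothesis K_ge0 : 0 <= K.
Hypothesis f_le : forall t, P t -> f t <= K * \sum_(c <- C) f' (phi c t).
Hypothesis phiP : forall c t, c \in C -> P t -> P' (phi c t).
Hypothesis phi_inj : forall c t s, c \in C -> P t -> P s -> phi c t = phi c s -> t = s.
Hypothesis bP' : has_sum f' P'.

(** After exchanging the sums, each fixed c contributes distinct terms of the sum over [P'], since
    [phi c] is injective; different c may overlap, whence the factor [size C]. *)
Lemma sum_inj_le X : uniq X -> {in X, forall t, P t} ->
  \sum_(t <- X) f t <= K * (size C)%:R * tsum f' P'.
Proof.
move=> uX XP; apply: le_trans (_ : \sum_(t <- X) K * \sum_(c <- C) f' (phi c t) <= _).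
  by rewrite big_seq [leRHS]big_seq; apply: ler_sum => t /XP /f_le.
rewrite -mulr_sumr -mulrA ler_wpM2l // exchange_big /=.
apply: le_trans (_ : \sum_(c <- C) tsum f' P' <= _); last first.
  by rewrite big_const_seq count_predT iter_addr_0 mulr_natl.
rewrite big_seq [leRHS]big_seq; apply: ler_sum => c cC.
rewrite -(big_map (phi c) xpredT f') sum_le_tsum //.
  by rewrite map_inj_in_uniq // => t s /XP Pt /XP Ps; exact: phi_inj.
by move=> _ /mapP[t /XP Pt ->]; exact: phiP.
Qed.

Lemma tsum_inj : tsum f P <= K * (size C)%:R * tsum f' P'.
Proof. by apply: tsum_le => X; exact: sum_inj_le. Qed.

Lemma has_sum_inj : has_sum f P.
Proof. by apply: has_sum_le => X; exact: sum_inj_le. Qed.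

End Transfer.

Section Product.
Variables (T1 T2 : eqType) (f1 : T1 -> R) (f2 : T2 -> R).
Hypotheses (f1_ge0 : forall t, 0 <= f1 t) (f2_ge0 : forall t, 0 <= f2 t).
Variables (P1 : T1 -> Prop) (P2 : T2 -> Prop).
Let f (t : T1 * T2) := f1 t.1 * f2 t.2.
Let P (t : T1 * T2) := P1 t.1 /\ P2 t.2.

Lemma prod_sum_le X : has_sum f1 P1 -> has_sum f2 P2 -> uniq X -> {in X, forall t, P t} ->
  \sum_(t <- X) f t <= tsum f1 P1 * tsum f2 P2.
Proof.
move=> b1 b2 uX XP.
pose X1 := undup [seq t.1 | t <- X]; pose X2 := undup [seq t.2 | t <- X].
apply: le_trans (_ : (\sum_(a <- X1) f1 a) * (\sum_(b <- X2) f2 b) <= _); last first.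
  apply: ler_pM; rewrite ?sumr_ge0 ?sum_le_tsum ?undup_uniq // => t;
  by rewrite mem_undup => /mapP[s /XP [? ?] ->].
rewrite big_distrlr /= -(big_allpairs (F := f)); apply: le_sum_sub => //.
- by move=> t; rewrite mulr_ge0.
- by rewrite allpairs_uniq ?undup_uniq // => -[? ?] [? ?].
- move=> [a b] tX; apply/allpairsP; exists (a, b); split=> //=;
  by rewrite mem_undup; apply/mapP; exists (a, b).
Qed.

Lemma tsum_prod_le : has_sum f1 P1 -> has_sum f2 P2 -> tsum f P <= tsum f1 P1 * tsum f2 P2.
Proof. by move=> b1 b2; apply: tsum_le => X; exact: prod_sum_le. Qed.

Lemma has_sum_prod : has_sum f1 P1 -> has_sum f2 P2 -> has_sum f P.
Proof. by move=> b1 b2; apply: has_sum_le => X; exact: prod_sum_le. Qed.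

Lemma le_tsum_prod : has_sum f P -> tsum f1 P1 * tsum f2 P2 <= tsum f P.
Proof.
move=> bP.
have main X1 X2 : uniq X1 -> {in X1, forall t, P1 t} -> uniq X2 -> {in X2, forall t, P2 t} ->
    (\sum_(a <- X1) f1 a) * (\sum_(b <- X2) f2 b) <= tsum f P.
  move=> u1 p1 u2 p2; rewrite big_distrlr /= -(big_allpairs (F := f)) sum_le_tsum //.
    by rewrite allpairs_uniq // => -[? ?] [? ?].
  by move=> _ /allpairsP[[a b] /= [aX bX ->]]; split; [exact: p1|exact: p2].
have P0 : 0 <= tsum f P by exact: tsum_ge0.
have step X1 : uniq X1 -> {in X1, forall t, P1 t} ->
    (\sum_(a <- X1) f1 a) * tsum f2 P2 <= tsum f P.
  move=> u1 p1; have : 0 <= \sum_(a <- X1) f1 a by rewrite sumr_ge0.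
  rewrite le_eqVlt => /predU1P[<-|s0]; first by rewrite mul0r.
  rewrite mulrC -ler_pdivlMr //; apply: tsum_le => X2 u2 p2.
  by rewrite ler_pdivlMr // mulrC main.
have := tsum_ge0 f2 P2; rewrite le_eqVlt => /predU1P[<-|s0]; first by rewrite mulr0.
rewrite -ler_pdivlMr //; apply: tsum_le => X1 u1 p1.
by rewrite ler_pdivlMr // step.
Qed.

End Product.

Section Indexed.
Variables (I T : eqType) (f : T -> R) (P : I -> T -> Prop) (s : seq I).
Hypothesis f_ge0 : forall t, 0 <= f t.
Let f' (t : I * T) := f t.2.
Let P' (t : I * T) := t.1 \in s /\ P t.1 t.2.

Lemma indexed_sum_le X : {in s, forall i, has_sum f (P i)} -> uniq X -> {in X, forall t, P' t} ->
  \sum_(t <- X) f' t <= \sum_(i <- s) tsum f (P i).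
Proof.
move=> bP uX XP.
pose X2 i := [seq t.2 | t <- X & t.1 == i].
apply: le_trans (_ : \sum_(i <- undup s) \sum_(t <- X2 i) f t <= _); last first.
  apply: le_trans (_ : \sum_(i <- undup s) tsum f (P i) <= _).
    rewrite big_seq [leRHS]big_seq; apply: ler_sum => i; rewrite mem_undup => is_.
    apply: sum_le_tsum; first exact: bP.
      rewrite map_inj_in_uniq ?filter_uniq // => -[a1 a2] [b1 b2].
      by rewrite !mem_filter /= => /andP[/eqP -> _] /andP[/eqP -> _] ->.
    by move=> u /mapP[[a b]]; rewrite mem_filter /= => /andP[/eqP -> /XP[_ ?]] ->.
  elim: (s) => [|i s' IH] /=; first by rewrite !big_nil.
  case: ifP => _; rewrite !big_cons ?lerD //.
  by apply: le_trans IH _; rewrite lerDr tsum_ge0.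
under [leRHS]eq_bigr do rewrite /X2 big_map big_filter.
rewrite [leRHS](exchange_big_dep xpredT) //= big_seq [leRHS]big_seq; apply: ler_sum => -[i t] tX /=.
have [is_ _] := XP _ tX; rewrite -big_filter.
rewrite (_ : [seq j <- _ | _] = [:: i]) ?big_seq1 //.
rewrite -(filter_pred1_uniq (undup_uniq s)) ?mem_undup //.
by apply: eq_filter => j /=; rewrite eq_sym.
Qed.

Lemma tsum_indexed_le : {in s, forall i, has_sum f (P i)} ->
  tsum f' P' <= \sum_(i <- s) tsum f (P i).
Proof. by move=> bP; apply: tsum_le => X; exact: indexed_sum_le. Qed.

Lemma has_sum_indexed : {in s, forall i, has_sum f (P i)} -> has_sum f' P'.
Proof. by move=> bP; apply: has_sum_le => X; exact: indexed_sum_le. Qed.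

Lemma le_tsum_indexed : uniq s -> has_sum f' P' -> \sum_(i <- s) tsum f (P i) <= tsum f' P'.
Proof.
move=> us bP; have bPi i : i \in s -> has_sum f (P i).
  move=> is_; apply: (@has_sum_inj _ _ unit f f' [:: tt] (fun _ t => (i, t)) (P i) P' 1) => //.
  - by move=> t _; rewrite big_seq1 mul1r.
  - by move=> _ t t' _ _ _ [].
have main e : 0 < e -> \sum_(i <- s) (tsum f (P i) - e) <= tsum f' P'.
  move=> e0.
  have /choice [X XP] : forall i, exists X, i \in s -> [/\ uniq X, {in X, forall t, P i t} &
      tsum f (P i) - e < \sum_(t <- X) f t].
    move=> i; have [is_|ns] := boolP (i \in s); last by exists [::].
    by have [X XP] := tsum_adherent (bPi i is_) e0; exists X.
  apply: le_trans (_ : \sum_(i <- s) \sum_(t <- X i) f' (i, t) <= _).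
    by rewrite big_seq [leRHS]big_seq; apply: ler_sum => i /XP[_ _ /ltW].
  rewrite -(@big_allpairs_dep _ _ _ _ (fun _ => T) _ (fun i t => (i, t)) s X f').
  apply: sum_le_tsum => //.
    apply: allpairs_uniq_dep => //; first by move=> i /XP[].
    by move=> [a1 a2] [b1 b2] _ _ /= [-> ->].
  by move=> _ /allpairsPdep[i [t [is_ tX ->]]]; split=> //=; have [_ h _] := XP i is_; exact: h.
apply/ler_addgt0Pr => e e0.
have e1 : 0 < e / (size s).+1%:R by rewrite divr_gt0.
have := main _ e1; rewrite big_split /= sumrN big_const_seq count_predT iter_addr_0.
rewrite lerBlDr => /le_trans; apply; rewrite lerD2l -[leLHS]mulr_natr -mulrA ger_pMr //.
by rewrite ler_pdivrMl // mulr1 ler_nat.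
Qed.

End Indexed.

(** * Joining and splitting words *)

Section Words.
Variables (alpha : eqType) (w : seq alpha -> R).
Hypothesis w_ge0 : forall u, 0 <= w u.
Variables (I : eqType) (s : seq I) (P : seq alpha -> Prop) (P1 P2 : I -> seq alpha -> Prop).

(** For a fixed connecting word the index and the pair of words are recovered from the joined word.
    Which connecting word works may depend on the pair, and summing over all of them costs
    [size C]. *)
Lemma tsum_join (C : seq (seq alpha)) (K : R) : 0 <= K -> uniq s ->
  (forall u v, w u * w v <= K * \sum_(c <- C) w (u ++ c ++ v)) ->
  (forall c i u v, c \in C -> i \in s -> P1 i u -> P2 i v -> P (u ++ c ++ v)) ->
  (forall c i j u u' v v', c \in C -> i \in s -> P1 i u -> P2 i v -> j \in s -> P1 j u' ->
     P2 j v' -> u ++ c ++ v = u' ++ c ++ v' -> i = j /\ u = u') ->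
  has_sum w P ->
  \sum_(i <- s) tsum w (P1 i) * tsum w (P2 i) <= K * (size C)%:R * tsum w P.
Proof.
move=> K0 us wK PC inj bP.
pose f (t : seq alpha * seq alpha) := w t.1 * w t.2.
pose Q i (t : seq alpha * seq alpha) := P1 i t.1 /\ P2 i t.2.
have f0 t : 0 <= f t by rewrite mulr_ge0.
pose phi c (t : I * (seq alpha * seq alpha)) := t.2.1 ++ c ++ t.2.2.
pose Q' (t : I * (seq alpha * seq alpha)) := t.1 \in s /\ Q t.1 t.2.
have h1 (t : I * (seq alpha * seq alpha)) : Q' t -> f t.2 <= K * \sum_(c <- C) w (phi c t).
  by move=> _; exact: wK.
have h2 c t : c \in C -> Q' t -> P (phi c t).
  by move=> cC [ts [t1 t2]]; exact: (PC c t.1).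
have h3 c t t' : c \in C -> Q' t -> Q' t' -> phi c t = phi c t' -> t = t'.
  move=> cC [ts [t1 t2]] [ts' [t1' t2']] e.
  have [e1 e2] := inj _ _ _ _ _ _ _ cC ts t1 t2 ts' t1' t2' e.
  case: t t' e e1 e2 {ts t1 t2 ts' t1' t2'} => [i [u v]] [j [u' v']] /= e e1 e2.
  move: e; rewrite /phi /= e1 e2 => /eqP; rewrite eqseq_cat // => /andP[_].
  by rewrite eqseq_cat // => /andP[_ /eqP ->].
have bQ' : has_sum (fun t : I * _ => f t.2) Q' := has_sum_inj K0 h1 h2 h3 bP.
apply: le_trans (tsum_inj K0 h1 h2 h3 bP).
refine (le_trans _ (le_tsum_indexed us bQ')).
rewrite big_seq [leRHS]big_seq; apply: ler_sum => i is_.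
apply: le_tsum_prod => //.
apply: (@has_sum_inj _ (I * (seq alpha * seq alpha))%type unit f (fun t => f t.2) [:: tt]
  (fun _ t => (i, t)) (Q i) Q' 1) => //.
- by move=> t _; rewrite big_seq1 mul1r.
- by move=> _ t t' _ _ _ [].
Qed.

(** Choosing one decomposition of each word is injective, because the word is the concatenation of
    its pieces. *)
Lemma tsum_split (K : R) : 0 <= K ->
  (forall u v, w (u ++ v) <= K * (w u * w v)) ->
  (forall t, P t -> exists i u v, [/\ i \in s, t = u ++ v, P1 i u & P2 i v]) ->
  {in s, forall i, has_sum w (P1 i)} -> {in s, forall i, has_sum w (P2 i)} ->
  has_sum w P /\ tsum w P <= K * \sum_(i <- s) tsum w (P1 i) * tsum w (P2 i).
Proof.
move=> K0 wK split b1 b2.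
pose f (t : seq alpha * seq alpha) := w t.1 * w t.2.
pose Q i (t : seq alpha * seq alpha) := P1 i t.1 /\ P2 i t.2.
have f0 t : 0 <= f t by rewrite mulr_ge0.
(* A word satisfying [P] supplies the default index for the choice function below. *)
have [[t0 Pt0]|nP] := pselect (exists t, P t); last first.
  have X0 X : {in X, forall t, P t} -> \sum_(t <- X) w t <= K * \sum_(i <- s) tsum w (P1 i) * tsum w (P2 i).
    case: X => [_|t X XP]; last by exfalso; apply: nP; exists t; apply: XP; rewrite mem_head.
    by rewrite big_nil mulr_ge0 // sumr_ge0 // => i _; rewrite mulr_ge0 ?tsum_ge0.
  by split; [apply: has_sum_le|apply: tsum_le] => X _; exact: X0.
have [i0 _] := split t0 Pt0.
have /choice [phi phiP] : forall t, exists x : I * (seq alpha * seq alpha),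
    P t -> [/\ x.1 \in s, t = x.2.1 ++ x.2.2 & Q x.1 x.2].
  move=> t; have [/split[i [u [v [is_ e p1 p2]]]]|nP] := pselect (P t); last by exists (i0, ([::], [::])).
  by exists (i, (u, v)).
pose Q' (x : I * (seq alpha * seq alpha)) := x.1 \in s /\ Q x.1 x.2.
have bQ : {in s, forall i, has_sum f (Q i)}.
  by move=> i is_; apply: has_sum_prod => //; [exact: b1|exact: b2].
have h1 t : P t -> w t <= K * \sum_(c <- [:: tt]) f (phi t).2.
  by move=> /phiP[_ e _]; rewrite big_seq1; apply: le_trans (wK _ _); rewrite -e.
have h2 (c : unit) t : c \in [:: tt] -> P t -> Q' (phi t).
  by move=> _ /phiP[].
have h3 (c : unit) t t' : c \in [:: tt] -> P t -> P t' -> phi t = phi t' -> t = t'.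
  by move=> _ /phiP[_ e _] /phiP[_ e' _] pe; rewrite e e' pe.
have bQ' : has_sum (fun x : I * (seq alpha * seq alpha) => f x.2) Q' := has_sum_indexed bQ.
split; first exact: (@has_sum_inj _ _ unit w (fun x => f x.2) [:: tt] (fun _ => phi) P Q' K K0 h1 h2 h3 bQ').
apply: le_trans (@tsum_inj _ _ unit w (fun x => f x.2) [:: tt] (fun _ => phi) P Q' K K0 h1 h2 h3 bQ') _.
rewrite mulr1 ler_wpM2l //.
apply: le_trans (tsum_indexed_le bQ) _.
rewrite big_seq [leRHS]big_seq; apply: ler_sum => i is_.
by apply: tsum_prod_le => //; [exact: b1|exact: b2].
Qed.

End Words.
End Sums.

(** * Quasi-multiplicative weights *)

Lemma cat_size_inj (T : eqType) (u u' v v' : seq T) : u ++ v = u' ++ v' ->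
  size u = size u' -> u = u'.
Proof. by move=> e s; have := congr1 (take (size u)) e; rewrite take_size_cat // s take_size_cat. Qed.

Lemma cat_injl (T : eqType) (u v v' : seq T) : u ++ v = u ++ v' -> v = v'.
Proof. by elim: u => [|a u IH] //= [/IH]. Qed.

Section Weights.
Variables (R : realType) (G : groupType) (S : seq G) (alpha : eqType) (kap : alpha -> G).
Implicit Types (g h b : G) (u v t : seq alpha) (w : seq alpha -> R).

Definition kword u : G := (\prod_(a <- u) kap a)%g.

Lemma kword_nil : kword [::] = 1%g.
Proof. by rewrite /kword big_nil. Qed.

Lemma kword_cat u v : kword (u ++ v) = (kword u * kword v)%g.
Proof. by rewrite /kword big_cat. Qed.

Definition loop g u := kword u = g.

Definition first_passage g u :=
  kword u = g /\ forall i, (i < size u)%N -> kword (take i u) <> g.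

Variables (K : R) (conn : G -> seq (seq alpha)) (Kc : G -> R).
Hypothesis connP : forall g c, c \in conn g -> kword c = g.
Hypothesis K_ge0 : 0 <= K.
Hypothesis Kc_ge0 : forall g, 0 <= Kc g.

(* Two words need not have an admissible concatenation: the second estimate
   only holds after inserting a connecting word, whose value is at our choice. *)
Definition quasi_mult w := [/\ forall u, 0 <= w u, w [::] = 1,
  forall u v, w (u ++ v) <= K * (w u * w v) &
  forall g u v, w u * w v <= Kc g * \sum_(c <- conn g) w (u ++ c ++ v)].

(** The cost of joining two words through a connecting word of value g. *)
Definition Jc g : R := Kc g * (size (conn g))%:R.

Lemma Jc_ge0 g : 0 <= Jc g.
Proof. by rewrite mulr_ge0. Qed.

Definition harnack_const : R := 1 + \sum_(s <- S) Jc s.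

Lemma harnack_const_ge1 : 1 <= harnack_const.
Proof. by rewrite lerDl sumr_ge0 // => s _; exact: Jc_ge0. Qed.

(** * First passages and Harnack inequalities *)

Section OneWeight.
Variable w : seq alpha -> R.
Hypothesis w_good : quasi_mult w.
Hypothesis w_fin : forall g, has_sum w (loop g).

Local Notation V g := (tsum w (loop g)).

Let w_ge0 : forall u, 0 <= w u. Proof. by case: w_good. Qed.
Let w_nil : w [::] = 1. Proof. by case: w_good. Qed.
Let w_cat : forall u v, w (u ++ v) <= K * (w u * w v). Proof. by case: w_good. Qed.
Let w_conn : forall g u v, w u * w v <= Kc g * \sum_(c <- conn g) w (u ++ c ++ v).
Proof. by case: w_good. Qed.

Lemma has_sum_loop g (P : seq alpha -> Prop) : (forall u, P u -> kword u = g) -> has_sum w P.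
Proof. by move=> h; apply: has_sumS (w_fin g). Qed.

Lemma V_ge0 g : 0 <= V g.
Proof. exact: tsum_ge0. Qed.

Lemma K_ge1 : 1 <= K.
Proof. by have := w_cat [::] [::]; rewrite /= w_nil !mulr1. Qed.

Lemma V1_ge1 : 1 <= V 1%g.
Proof. by rewrite -w_nil; apply: term_le_tsum; [exact: w_fin|exact: kword_nil]. Qed.

Lemma tsum_nil : tsum w (fun u => u = [::]) = 1.
Proof.
have b : has_sum w (fun u => u = [::]).
  by apply: (@has_sum_loop 1%g) => u ->; exact: kword_nil.
apply/eqP; rewrite eq_le; apply/andP; split; last first.
  by rewrite -w_nil; exact: term_le_tsum.
apply: tsum_le => X uX XP.
have XS : {subset X <= [:: [::]]} by move=> u /XP ->; rewrite inE.
by apply: le_trans (le_sum_sub w_ge0 uX _ XS) _; rewrite // big_seq1 w_nil.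
Qed.

Lemma tsum_join1 g b (P P1 P2 : seq alpha -> Prop) :
  (forall u, P u -> kword u = g) ->
  (forall c u v, kword c = b -> P1 u -> P2 v -> P (u ++ c ++ v)) ->
  (forall c u u' v v', kword c = b -> P1 u -> P2 v -> P1 u' -> P2 v' ->
    u ++ c ++ v = u' ++ c ++ v' -> u = u') ->
  tsum w P1 * tsum w P2 <= Jc b * tsum w P.
Proof.
move=> Pg PP inj.
have := @tsum_join R alpha w w_ge0 unit [:: tt] P (fun=> P1) (fun=> P2) (conn b) (Kc b).
rewrite big_seq1 -/(Jc b); apply => //.
- by move=> c _ u v /connP cb _; exact: PP.
- by move=> c [] [] u u' v v' /connP cb _ h1 h2 _ h3 h4 /(inj _ _ _ _ _ cb h1 h2 h3 h4).
- exact: has_sum_loop Pg.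
Qed.

Lemma tsum_split1 g1 g2 (P P1 P2 : seq alpha -> Prop) :
  (forall u, P1 u -> kword u = g1) -> (forall u, P2 u -> kword u = g2) ->
  (forall t, P t -> exists u v, [/\ t = u ++ v, P1 u & P2 v]) ->
  tsum w P <= K * (tsum w P1 * tsum w P2).
Proof.
move=> h1 h2 sp.
have := @tsum_split R alpha w w_ge0 unit [:: tt] P (fun=> P1) (fun=> P2) K K_ge0 w_cat.
rewrite big_seq1 => -[||| _ -> //].
- by move=> t /sp[u [v [? ? ?]]]; exists tt, u, v.
- by move=> _ _; exact: has_sum_loop h1.
- by move=> _ _; exact: has_sum_loop h2.
Qed.

Lemma V_mulr g b : V g <= Jc b * V (g * b)%g.
Proof.
rewrite -[V g]mulr1 -tsum_nil; apply: (@tsum_join1 (g * b)%g) => //.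
- by move=> c u v cb ug ->; rewrite /loop cats0 kword_cat cb ug.
- by move=> c u u' v v' _ _ -> _ -> e; apply: (cat_size_inj e); have := congr1 size e; rewrite !size_cat; lia.
Qed.

Lemma V_mull g b : V g <= Jc b * V (b * g)%g.
Proof.
rewrite -[V g]mul1r -tsum_nil; apply: (@tsum_join1 (b * g)%g) => //.
- by move=> c u v cb -> vg; rewrite /loop /= kword_cat cb vg.
- by move=> c u u' v v' _ -> _ ->.
Qed.

Lemma first_visit (Q : pred G) t : Q (kword t) ->
  exists u v, [/\ t = u ++ v, Q (kword u) & forall i, (i < size u)%N -> ~~ Q (kword (take i u))].
Proof.
move=> Qt; have ex : exists i, (i <= size t)%N && Q (kword (take i t)).
  by exists (size t); rewrite leqnn take_size.
case: (ex_minnP ex) => i /andP[it Qi] imin.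
exists (take i t), (drop i t); rewrite cat_take_drop; split=> // j.
rewrite size_takel // => ji; apply/negP => Qj; have := imin j.
by rewrite -(take_takel _ (ltnW ji)) Qj (leq_trans (ltnW ji) it) leqNgt ji => /(_ isT).
Qed.

Lemma fp_inj g u u' x x' : first_passage g u -> first_passage g u' ->
  u ++ x = u' ++ x' -> u = u'.
Proof.
move=> [ug um] [ug' um'] e; apply: (cat_size_inj e).
have lt (a b y z : seq alpha) : kword a = g -> (forall i, (i < size b)%N -> kword (take i b) <> g) ->
    a ++ y = b ++ z -> ~~ (size a < size b)%N.
  move=> ag bm ab; apply/negP => h; apply: (bm _ h).
  have -> : take (size a) b = take (size a) (b ++ z) by rewrite take_cat h.
  by rewrite -ab take_size_cat.
have h1 := lt _ _ _ _ ug um' e; have h2 := lt _ _ _ _ ug' um (esym e).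
by apply/eqP; rewrite eqn_leq; apply/andP; split; rewrite leqNgt; [exact: h2|exact: h1].
Qed.

Lemma fp_join g b g' : tsum w (first_passage g) * V g' <= Jc b * V (g * b * g')%g.
Proof.
apply: (@tsum_join1 (g * b * g')%g) => //.
- by move=> c u v cb [ug _] vg; rewrite /loop !kword_cat ug cb vg mulgA.
- by move=> c u u' v v' _ h1 _ h2 _; exact: (fp_inj h1 h2).
Qed.

Lemma V_fp g : V g <= K * (tsum w (first_passage g) * V 1%g).
Proof.
apply: (@tsum_split1 g 1%g) => //; first by move=> u [].
move=> t tg; have [u [v [e /eqP ug um]]] := @first_visit (pred1 g) t (introT eqP tg).
exists u, v; split=> //; first by split=> // i /um /eqP.
move: tg; rewrite e /loop kword_cat ug => h; apply: (mulgI g).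
by rewrite h mulg1.
Qed.

Lemma fp_le g : tsum w (first_passage g) * V 1%g <= Jc 1%g * V g.
Proof. by have := fp_join g 1%g 1%g; rewrite !mulg1. Qed.

(** The cut cannot be read off from a join of two arbitrary words, so the first word is shortened to
    its first passage through [g]; the loops removed in this way cost the factor V(1). *)
Lemma V_mul g b g' : V g * V g' <= K * Jc b * V 1%g * V (g * b * g')%g.
Proof.
have h := V_fp g; have := fp_join g b g'; have V0 := V_ge0 1%g; have V0' := V_ge0 g'.
move=> j; apply: le_trans (ler_wpM2r V0' h) _.
by have := ler_wpM2l (mulr_ge0 K_ge0 V0) j; lra.
Qed.

Lemma V_word (l : seq G) g : {subset l <= S} ->
  V g <= harnack_const ^+ size l * V (g * \prod_(s <- l) s)%g.
Proof.
elim: l g => [|s l IH] g ls; first by rewrite big_nil mulg1 expr0 mul1r.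
have sS : s \in S by apply: ls; rewrite mem_head.
have {}IH := IH (g * s)%g (fun x xl => ls x (mem_behead (s := s :: l) xl)).
apply: le_trans (V_mulr g s) _; rewrite big_cons mulgA exprS -mulrA.
apply: ler_pM => //; [exact: Jc_ge0|exact: V_ge0|].
rewrite /harnack_const (big_rem s) //= addrCA lerDl addr_ge0 //.
by rewrite sumr_ge0 // => x _; exact: Jc_ge0.
Qed.

Lemma V_word' (l : seq G) g : {subset l <= S} ->
  V g <= harnack_const ^+ size l * V ((\prod_(s <- l) s) * g)%g.
Proof.
have hc1 := harnack_const_ge1.
elim: l g => [|s l IH] g ls; first by rewrite big_nil mul1g expr0 mul1r.
have sS : s \in S by apply: ls; rewrite mem_head.
have {}IH := IH g (fun x xl => ls x (mem_behead (s := s :: l) xl)).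
apply: le_trans IH _; rewrite big_cons -mulgA exprSr -mulrA ler_wpM2l ?exprn_ge0 //; first by lra.
apply: le_trans (V_mull _ s) _; apply: ler_pM => //; [exact: Jc_ge0|exact: V_ge0|].
rewrite /harnack_const (big_rem s) //= addrCA lerDl addr_ge0 //.
by rewrite sumr_ge0 // => x _; exact: Jc_ge0.
Qed.

Hypothesis hS : symmetric_generating S.

Lemma V_harnack g h : V g <= harnack_const ^+ word_length S (g^-1 * h)%g * V h.
Proof.
have [l <- [lS lg]] := len_spells hS (g^-1 * h)%g.
by have := V_word g lS; rewrite lg mulVKg.
Qed.

Lemma V_harnackl g h : V g <= harnack_const ^+ word_length S (h * g^-1)%g * V h.
Proof.
have [l <- [lS lg]] := len_spells hS (h * g^-1)%g.
by have := V_word' g lS; rewrite lg mulgVK.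
Qed.

Lemma V_ge g : 1 <= harnack_const ^+ word_length S g * V g.
Proof. by apply: le_trans V1_ge1 _; have := V_harnack 1%g g; rewrite invg1 mul1g. Qed.

End OneWeight.

(** * Sums over spheres, with bounds that do not depend on the weight *)

Hypothesis hS : symmetric_generating S.
Variable delta : R.
Hypothesis delta_gt0 : 0 < delta.
Hypothesis hyp : forall x y z, Num.min (gp R S x y) (gp R S y z) - delta <= gp R S x z.
Hypothesis nonel : ~ elementary G.

Local Notation len := (word_length S).
Local Notation V w g := (tsum w (loop g)).

(** The bound [T] may depend on [w]. It serves to make the supremum of the sphere sums finite, so
    that this supremum can be cancelled; the bounds deduced from it no longer involve [T]. *)
Definition summable_weight w :=
  [/\ quasi_mult w, forall g, has_sum w (loop g) &
    exists T, forall X, uniq X -> \sum_(g <- X) V w g * V w g^-1%g <= T].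

Definition sphere_sum w k := \sum_(g <- sphere S k) V w g * V w g^-1%g.

Definition ball_const n := K * \sum_(a <- wball S n) Jc a.

Lemma ball_const_ge n a : (len a <= n)%N -> K * Jc a <= ball_const n.
Proof.
move=> an; rewrite /ball_const ler_wpM2l // (big_rem a) ?(mem_wball hS) //= lerDl.
by rewrite sumr_ge0 // => x _; exact: Jc_ge0.
Qed.

Lemma green_pair_mul w g h a n : quasi_mult w -> (forall g, has_sum w (loop g)) ->
  (len a <= n)%N ->
  (V w g * V w g^-1%g) * (V w h * V w h^-1%g) <=
  (ball_const n * V w 1%g) ^+ 2 * (V w (g * a * h)%g * V w (g * a * h)^-1%g).
Proof.
move=> wg wf an.
have b1 := ball_const_ge an.
have b2 : K * Jc a^-1%g <= ball_const n by apply: ball_const_ge; rewrite lenV.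
have V0 x := V_ge0 w x.
have h1 : V w g * V w h <= ball_const n * V w 1%g * V w (g * a * h)%g.
  apply: le_trans (V_mul wg wf g a h) _; rewrite -!(mulrA _ (V w 1%g)).
  by rewrite ler_wpM2r // mulr_ge0.
have h2 : V w h^-1%g * V w g^-1%g <= ball_const n * V w 1%g * V w (g * a * h)^-1%g.
  apply: le_trans (V_mul wg wf h^-1%g a^-1%g g^-1%g) _.
  rewrite !invgM mulgA -!(mulrA _ (V w 1%g)).
  by rewrite ler_wpM2r // mulr_ge0.
have h3 := ler_pM (mulr_ge0 (V0 _) (V0 _)) (mulr_ge0 (V0 _) (V0 _)) h1 h2.
rewrite [leLHS](_ : _ = V w g * V w h * (V w h^-1%g * V w g^-1%g)); last by ring.
by apply: le_trans h3 _; rewrite le_eqVlt; apply/orP; left; apply/eqP; ring.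
Qed.

(** Each pair (g, h) is sent to [g * a * h] with a bounded connector [a]. Its length differs from k
    + l by a bounded amount, and by [count_near] boundedly many pairs share an image, so the product
    of two sphere sums is controlled by boundedly many sphere sums. *)
Lemma sphere_sum_mul : exists B, 0 <= B /\ forall w s, summable_weight w ->
  (forall k, sphere_sum w k <= s) ->
  forall k l, sphere_sum w k * sphere_sum w l <= B * V w 1%g ^+ 2 * s.
Proof.
have [n [c connect]] := connector hS delta_gt0 hyp nonel.
(* The cancellation is at most c and [a * h] exceeds [h] by at most n, hence the defect c + n in
   [count_near]. The lengths of the products lie between k + l - c and k + l + n, a window of c + n
   + 1 values. *)
have [r rP] := nat_above ((c + n)%:R + 2 * delta : R).
pose B := ball_const n ^+ 2 * (size (wball S n))%:R * ((size (wball S r))%:R * (c + n).+1%:R).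
have bc0 : 0 <= ball_const n.
  by rewrite mulr_ge0 // sumr_ge0 // => x _; exact: Jc_ge0.
exists B; split; first by rewrite /B; apply: mulr_ge0; apply: mulr_ge0; rewrite ?exprn_ge0 ?ler0n.
move=> w s [wg wf _] ws k l.
pose H g := V w g * V w g^-1%g.
have H0 g : 0 <= H g by rewrite mulr_ge0 // V_ge0.
pose E a := [seq (p.1, (p.1 * a * p.2)%g) | p <-
  [seq p <- [seq (g, h) | g <- sphere S k, h <- sphere S l] | (k + l <= len (p.1 * a * p.2)%g + c)%N]].
have inE_ a e : e \in E a -> exists g h, [/\ len g = k, len h = l, e = (g, (g * a * h)%g) &
    (k + l <= len (g * a * h)%g + c)%N].
  move=> /mapP[[g h]]; rewrite mem_filter /= => /andP[kl /allpairsP[[g' h'] /= []]].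
  rewrite !(mem_sphere hS) => /eqP gk /eqP hl [eg eh] ->.
  by subst g' h'; exists g, h.
have EH a : (len a <= n)%N -> \sum_(e <- E a) H e.2 <= (size (wball S r))%:R * ((c + n).+1%:R * s).
  move=> an; apply: le_trans (@count_near R G S hS delta delta_gt0 hyp k (c + n) r (E a) H _ _ rP H0) _.
  - rewrite map_inj_in_uniq.
      by rewrite filter_uniq // allpairs_uniq ?sphere_uniq // => -[? ?] [? ?].
    by move=> [g h] [g' h'] _ _ /= [-> /mulgI ->].
  - move=> e /inE_[g [h [gk hl -> kl]]] /=; split=> //.
    have -> : (g^-1 * (g * a * h) = a * h)%g by rewrite -mulgA mulKg.
    by have := lenM hS a h; lia.
  rewrite ler_wpM2l //.
  apply: le_trans (_ : \sum_(j <- iota (k + l - c) (c + n).+1) sphere_sum w j <= _); last first.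
    apply: le_trans (ler_sum _ (fun j _ => ws j)) _.
    by rewrite big_const_seq count_predT size_iota iter_addr_0 mulr_natl.
  rewrite /sphere_sum -(@big_allpairs_dep _ _ _ _ (fun _ => G) _ (fun (_ : nat) g => g) _ (fun j => sphere S j) H).
  apply: le_sum_sub => //; first exact: undup_uniq.
    apply: allpairs_uniq_dep => //; first exact: iota_uniq.
      by move=> j _; exact: sphere_uniq.
    move=> [j g] [j' g'] /allpairsPdep[a1 [b1 [_ bj e1]]] /allpairsPdep[a2 [b2 [_ bj' e2]]] /= gg.
    move: bj bj'; rewrite !(mem_sphere hS); case: e1 e2 => ? e1 [? e2]; subst.
    by move=> /eqP <- /eqP <-.
  move=> x; rewrite mem_undup => /mapP[e /inE_[g [h [gk hl -> kl]]] ->].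
  apply/allpairsPdep; exists (len (g * a * h)%g), (g * a * h)%g; split=> //.
    by rewrite mem_iota; have := lenM hS (g * a)%g h; have := lenM hS g a; lia.
  by rewrite (mem_sphere hS).
rewrite /sphere_sum big_distrlr /=.
apply: le_trans (_ : \sum_(a <- wball S n) \sum_(e <- E a)
   (ball_const n * V w 1%g) ^+ 2 * H e.2 <= _); last first.
  under eq_bigr do rewrite -mulr_sumr.
  rewrite -mulr_sumr big_seq.
  apply: le_trans (_ : (ball_const n * V w 1%g) ^+ 2 *
     \sum_(a <- wball S n | a \in wball S n) ((size (wball S r))%:R * ((c + n).+1%:R * s)) <= _).
    apply: ler_wpM2l; first by apply: exprn_ge0; apply: mulr_ge0 => //; exact: V_ge0.
    by apply: ler_sum => a; rewrite (mem_wball hS) => /EH.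
  rewrite -big_seq big_const_seq count_predT iter_addr_0 -[_ *+ size _]mulr_natl /B.
  by rewrite le_eqVlt; apply/orP; left; apply/eqP; ring.
rewrite -(@big_allpairs _ _ _ _ _ _ _ (fun p => H p.1 * H p.2)) /=.
under [leRHS]eq_bigr do rewrite big_map big_filter.
rewrite (exchange_big_dep xpredT) //=.
rewrite big_seq [leRHS]big_seq; apply: ler_sum => -[g h] /allpairsP[[g' h'] /= []].
rewrite !(mem_sphere hS) => /eqP gk /eqP hl [eg eh]; subst g' h'.
have [a an ga] := connect g h.
rewrite (big_rem a) ?(mem_wball hS) //= -gk -hl ga.
apply: le_trans (green_pair_mul g h wg wf an) _; rewrite lerDl sumr_ge0 // => x _.
by apply: mulr_ge0 => //; apply: exprn_ge0; apply: mulr_ge0 => //; exact: V_ge0.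
Qed.

Lemma sphere_sum_ge0 w k : 0 <= sphere_sum w k.
Proof. by rewrite sumr_ge0 // => g _; rewrite mulr_ge0 // V_ge0. Qed.

(** With s the supremum of the sphere sums S_l, taking the supremum over l in the product bound
    gives S_k s <= B V(1)^2 s, and the finite s cancels. *)
Lemma sphere_sum_le : exists B, 0 <= B /\ forall w, summable_weight w ->
  forall k, sphere_sum w k <= B * V w 1%g ^+ 2.
Proof.
have [B [B0 BP]] := sphere_sum_mul; exists B; split=> // w ws k.
have [_ _ [T TP]] := ws.
pose A := [set sphere_sum w j | j in [set: nat]].
have Aub : has_ubound A by exists T => _ [j _ <-]; exact/TP/sphere_uniq.
have As j : sphere_sum w j <= sup A by apply: ub_le_sup => //; exists j.
have := sphere_sum_ge0 w k; rewrite le_eqVlt => /predU1P[<-|k0].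
  by rewrite mulr_ge0 // exprn_ge0 // V_ge0.
have s0 : 0 < sup A by exact: lt_le_trans k0 (As k).
rewrite -(ler_pM2r s0) mulrC -ler_pdivlMr //; apply: ge_sup; first by exists (sphere_sum w k), k.
by move=> _ [j _ <-]; rewrite ler_pdivlMr // mulrC; exact: BP.
Qed.

(** * Loops at the identity and their visits *)

Section Recurrence.
Variable w : seq alpha -> R.
Hypothesis w_good : quasi_mult w.
Hypothesis w_fin : forall g, has_sum w (loop g).

Let w_ge0 : forall u, 0 <= w u. Proof. by case: w_good. Qed.
Let w_nil : w [::] = 1. Proof. by case: w_good. Qed.
Let w_cat : forall u v, w (u ++ v) <= K * (w u * w v). Proof. by case: w_good. Qed.
Let w_conn : forall g u v, w u * w v <= Kc g * \sum_(c <- conn g) w (u ++ c ++ v).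
Proof. by case: w_good. Qed.

Definition first_return u := [/\ u != [::], kword u = 1%g &
  forall i, (0 < i)%N -> (i < size u)%N -> kword (take i u) <> 1%g].

(** Time 0 and the final time are both counted, so a loop at the identity has exactly one visit if
    and only if it is empty. *)
Definition visits t := count (fun i => kword (take i t) == 1%g) (iota 0 (size t).+1).

(** A first return followed by any loop is again a loop whose cut can be recovered, so the factor
    V(1), finite and positive, cancels on both sides. *)
Lemma first_return_le : tsum w first_return <= Jc 1%g.
Proof.
have V0 : 0 < V w 1%g by apply: lt_le_trans (V1_ge1 w_good w_fin).
rewrite -(ler_pM2r V0); apply: (@tsum_join1 w w_good w_fin 1%g) => //.
- by move=> c u v c1 [_ u1 _] v1; rewrite /loop !kword_cat u1 c1 v1 !mulg1.
- move=> c u u' v v' _ hu _ hu' _ e; apply: (cat_size_inj e).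
  have lt (a b y z : seq alpha) : first_return a -> first_return b -> a ++ y = b ++ z -> ~~ (size a < size b)%N.
    move=> [a0 a1 _] [_ _ bm] ab; apply/negP => h.
    apply: (bm (size a)) => //; first by rewrite lt0n size_eq0.
    have -> : take (size a) b = take (size a) (b ++ z) by rewrite take_cat h.
    by rewrite -ab take_size_cat.
  apply/eqP; rewrite eqn_leq; apply/andP; split; rewrite leqNgt.
    exact: lt hu' hu (esym e).
  exact: lt hu hu' e.
Qed.

Lemma visits_first_return u v : first_return u -> visits (u ++ v) = (visits v).+1.
Proof.
move=> [u0 u1 um]; rewrite /visits size_cat -addnS iotaD count_cat add0n -[RHS]add1n; congr addn.
  rewrite -(prednK (n := size u)) ?lt0n ?size_eq0 //= take0 kword_nil eqxx.
  rewrite -[RHS]addn0; congr addn; apply/eqP; rewrite -leqn0 leqNgt -has_count.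
  apply/hasPn => i; rewrite mem_iota => /andP[i0 iu].
  have {}iu : (i < size u)%N by move: iu; rewrite add1n prednK // lt0n size_eq0.
  by rewrite take_cat iu; apply/eqP; exact: um.
rewrite -[X in iota X _]addn0 iotaDl count_map; apply: eq_count => i /=.
by rewrite take_cat ltnNge leq_addr /= addKn kword_cat u1 mul1g.
Qed.

Lemma visits_tsum n : tsum w (fun t => loop 1%g t /\ visits t = n.+1) <= (K * Jc 1%g) ^+ n.
Proof.
elim: n => [|n IH].
  rewrite expr0 -(tsum_nil w_good w_fin); apply: tsumS.
    move=> t [t1 tv]; apply/eqP; rewrite -size_eq0; apply/negPn/negP => t0.
    suff: (2 <= visits t)%N by rewrite tv.
    rewrite /visits -size_filter; apply: (@uniq_leq_size _ [:: 0; size t]%N).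
      by rewrite /= inE eq_sym t0.
    move=> i; rewrite !inE mem_filter mem_iota => /orP[] /eqP ->.
      by rewrite take0 kword_nil eqxx.
    by rewrite take_size t1 eqxx /= add0n ltnS.
  by apply: (@has_sum_loop w w_fin 1%g) => t ->; exact: kword_nil.
apply: le_trans (@tsum_split1 w w_good w_fin 1%g 1%g _ first_return
  (fun t => loop 1%g t /\ visits t = n.+1) _ _ _) _.
- by move=> u [].
- by move=> u [].
- move=> t [t1 tv].
  have t0 : t != [::].
    by apply/eqP => e; move: tv; rewrite e /visits /= kword_nil eqxx.
  have ex : exists i, [&& (0 < i)%N, (i <= size t)%N & kword (take i t) == 1%g].
    by exists (size t); rewrite lt0n size_eq0 t0 leqnn take_size t1 eqxx.
  case: (ex_minnP ex) => i /and3P[i0 it /eqP ti] imin.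
  have fr : first_return (take i t).
    split => //; first by rewrite -size_eq0 size_takel // -lt0n.
    move=> j j0; rewrite size_takel // => ji; rewrite (take_takel _ (ltnW ji)) => tj.
    by have := imin j; rewrite j0 (leq_trans (ltnW ji) it) tj eqxx leqNgt ji => /(_ isT).
  exists (take i t), (drop i t); rewrite cat_take_drop; split=> //; split.
    by move: t1; rewrite /loop -{1}(cat_take_drop i t) kword_cat ti mul1g.
  by apply: succn_inj; rewrite -(visits_first_return (drop i t) fr) cat_take_drop.
rewrite exprS -mulrA ler_wpM2l //; apply: ler_pM => //; try exact: tsum_ge0.
exact: first_return_le.
Qed.

Lemma few_visits_tsum n :
  tsum w (fun t => loop 1%g t /\ (visits t <= n)%N) <= \sum_(i < n) (K * Jc 1%g) ^+ i.
Proof.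
elim: n => [|n IH].
  rewrite big_ord0; apply: tsum_le => -[_ _|t X _ XP]; first by rewrite big_nil.
  have [t1] := XP t (mem_head _ _); rewrite leqn0 /visits /= take0 kword_nil eqxx //.
rewrite big_ord_recr /=; apply: le_trans (lerD IH (visits_tsum n)).
have b Q : has_sum w (fun t => loop 1%g t /\ Q t) by apply: (@has_sum_loop w w_fin 1%g) => t [].
by apply: tsum_subadd => // t [t1]; rewrite leq_eqVlt => /predU1P[->|]; [right|left].
Qed.

Definition avoids g t := forall i, (i <= size t)%N -> kword (take i t) <> g.

Definition excursions g := [seq (c1, c2) | c1 <- conn g, c2 <- conn g^-1%g].

Definition excursion_const g := K * Kc g * Kc g^-1%g * (size (excursions g))%:R.

(** At each visit to the identity an excursion to [g] and back can be inserted. As the original loop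
    avoids [g], the new loop betrays where the insertion took place, so a loop with M visits yields
    M different ones for each pair of connecting words. *)
Lemma many_visits_tsum g M : g <> 1%g ->
  M%:R * tsum w (fun t => [/\ loop 1%g t, avoids g t & (M <= visits t)%N]) <=
  excursion_const g * V w 1%g.
Proof.
move=> g1.
pose P (p : seq alpha * nat) := [/\ loop 1%g p.1, avoids g p.1, (p.2 <= size p.1)%N &
  kword (take p.2 p.1) = 1%g].
pose f (p : seq alpha * nat) := w p.1.
pose phi (c : seq alpha * seq alpha) (p : seq alpha * nat) :=
  take p.2 p.1 ++ c.1 ++ c.2 ++ drop p.2 p.1.
have K1 : 0 <= K * Kc g * Kc g^-1%g by rewrite !mulr_ge0.
have h1 p : P p -> f p <= K * Kc g * Kc g^-1%g * \sum_(c <- excursions g) w (phi c p).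
  case: p => t i _; rewrite /f /phi /= -{1}(cat_take_drop i t).
  apply: le_trans (w_cat _ _) _; rewrite -!mulrA ler_wpM2l //.
  rewrite big_allpairs_dep /=.
  have := w_conn g (take i t) [::]; rewrite w_nil mulr1 => h.
  apply: le_trans (ler_wpM2r (w_ge0 _) h) _; rewrite -mulrA ler_wpM2l //.
  rewrite mulr_suml mulr_sumr; apply: ler_sum => c _.
  rewrite cats0; apply: le_trans (w_conn g^-1%g (take i t ++ c) (drop i t)) _.
  by rewrite ler_wpM2l //; apply: ler_sum => c' _; rewrite -catA.
have h2 c p : c \in excursions g -> P p -> loop 1%g (phi c p).
  move=> /allpairsP[[c1 c2] /= [/connP k1 /connP k2 ->]] [p1 _ _ pi].
  move: p1; rewrite /loop /phi /= -{1}(cat_take_drop p.2 p.1) !kword_cat pi mul1g k1 k2.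
  by rewrite mul1g mulVKg.
have h3 c p q : c \in excursions g -> P p -> P q -> phi c p = phi c q -> p = q.
  move=> /allpairsP[[c1 c2] /= [/connP k1 /connP k2 ->]].
  (* The connecting word may reach [g] before its end. With j0 the first such time, the modified
     loop first visits [g] at time i + j0, which determines i. *)
  have ex : exists j, (j <= size c1)%N && (kword (take j c1) == g).
    by exists (size c1); rewrite leqnn take_size k1 eqxx.
  case: (ex_minnP ex) => j0 /andP[jc /eqP j0g] jmin.
  have lt (t t' : seq alpha) i i' : P (t, i) -> P (t', i') ->
      phi (c1, c2) (t, i) = phi (c1, c2) (t', i') -> ~~ (i < i')%N.
    move=> [_ av ti k] [_ av' ti' k'] e; apply/negP => ii; rewrite /= in av av' ti ti' k k'.
    have e1 : kword (take (i + j0) (phi (c1, c2) (t, i))) = g.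
      rewrite /phi /= take_cat size_takel // ltnNge leq_addr /= addKn.
      rewrite kword_cat k mul1g take_cat; case: ltngtP jc => // e' _.
      by rewrite e' subnn take0 cats0 -[c1]take_size -e'.
    move: e1; rewrite e /phi /= take_cat size_takel //.
    case: ltnP => [h|h].
      by rewrite take_takel ?(ltnW h) // => /av'; apply; apply: leq_trans ti'; exact: ltnW.
    rewrite kword_cat k' mul1g take_cat.
    have jj : (i + j0 - i' < j0)%N by have : (0 < j0)%N; [case: (posnP j0) j0g => [->|//]; rewrite take0 kword_nil => /esym|lia].
    have -> : (i + j0 - i' < size c1)%N by apply: leq_trans jj jc.
    move=> z; have := jmin (i + j0 - i')%N; rewrite z eqxx andbT.
    by move=> /(_ (leq_trans (ltnW jj) jc)); rewrite leqNgt jj.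
  case: p q => [t i] [t' i'] Pp Pq e.
  have ii : i = i'.
    apply/eqP; rewrite eqn_leq; apply/andP; split; rewrite leqNgt.
      exact: lt Pq Pp (esym e).
    exact: lt Pp Pq e.
  case: Pp Pq => [_ _ ti _] [_ _ ti' _]; rewrite /= in ti ti'; subst i'.
  move: e; rewrite /phi /= => e.
  have e1 := cat_size_inj e; rewrite !size_takel // in e1; have {}e1 := e1 erefl.
  by move: e; rewrite e1 => /cat_injl /cat_injl /cat_injl e2; rewrite -(cat_take_drop i t) e1 e2 cat_take_drop.
have bP := has_sum_inj K1 h1 h2 h3 (w_fin 1%g).
apply: le_trans (tsum_inj K1 h1 h2 h3 (w_fin 1%g)).
case: M => [|M]; first by rewrite mul0r tsum_ge0.
rewrite mulrC -ler_pdivlMr //; apply: tsum_le => X uX XP.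
rewrite ler_pdivlMr // mulrC.
pose idx t := [seq i <- iota 0 (size t).+1 | kword (take i t) == 1%g].
have := @sum_le_tsum _ _ f P [seq (t, i) | t <- X, i <- idx t] bP.
rewrite big_allpairs_dep /= => h; apply: le_trans (h _ _).
- rewrite mulr_sumr big_seq [leRHS]big_seq; apply: ler_sum => t /XP [_ _ tM].
  rewrite /f /= big_const_seq iter_addr_0 count_predT size_filter -[leRHS]mulr_natl.
  by rewrite ler_wpM2r // ler_nat.
- apply: allpairs_uniq_dep => //; first by move=> t _; rewrite filter_uniq ?iota_uniq.
  by move=> [a b] [a' b'] _ _ /= [-> ->].
- move=> _ /allpairsPdep[t [i [tX + ->]]]; rewrite mem_filter mem_iota /= => /andP[/eqP ti it].
  by have [? ? _] := XP t tX.
Qed.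

Lemma hitting_tsum g :
  tsum w (fun t => loop 1%g t /\ ~ avoids g t) <= K * (tsum w (first_passage g) * V w g^-1%g).
Proof.
apply: (@tsum_split1 w w_good w_fin g g^-1%g) => //; first by move=> u [].
move=> t [t1 nav].
have [i [it ig]] : exists i, (i <= size t)%N /\ kword (take i t) = g.
  by apply: contrapT => no; apply: nav => i it ig; apply: no; exists i.
have [u [v [e ug um]]] := @first_visit (pred1 g) (take i t) (introT eqP ig).
exists u, (v ++ drop i t); split.
- by rewrite catA -e cat_take_drop.
- by split; [exact/eqP|move=> j /um /eqP].
- move: t1; rewrite /loop -{1}(cat_take_drop i t) e -catA kword_cat => h.
  by rewrite -(eqP ug) -[RHS]mulg1 -h mulKg.
Qed.

(** Loops have few visits, or avoid [g] with many visits, or hit [g]. By the choice of M the second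
    class is at most half of V(1) and is absorbed. Multiplying by V(1) turns the first passage
    weight in the third class into a multiple of V(g). *)
Lemma recurrent_bound g M : g <> 1%g -> 0 < (M%:R : R) -> 2 * excursion_const g <= M%:R ->
  V w 1%g ^+ 2 <= 2 * (\sum_(i < M) (K * Jc 1%g) ^+ i) * V w 1%g +
     2 * K * Jc 1%g * (V w g * V w g^-1%g).
Proof.
move=> g1 M0 gM; set LM := \sum_(i < M) _.
have V0 := V_ge0 w 1%g; have Vi0 := V_ge0 w g^-1%g.
have b Q : has_sum w (fun t => loop 1%g t /\ Q t) by apply: (@has_sum_loop w w_fin 1%g) => t [].
have b3 : has_sum w (fun t => [/\ loop 1%g t, avoids g t & (M <= visits t)%N]).
  by apply: (@has_sum_loop w w_fin 1%g) => t [].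
have few := few_visits_tsum M; rewrite -/LM in few; have many := many_visits_tsum M g1; have hit := hitting_tsum g.
have fp := fp_le w_good w_fin g.
set A := tsum _ _ in few; set Bm := tsum _ _ in many; set Ch := tsum _ _ in hit.
have cov : V w 1%g <= A + (Bm + Ch).
  apply: le_trans (_ : A + tsum w (fun t => loop 1%g t /\ ((avoids g t /\ (M <= visits t)%N) \/ ~ avoids g t)) <= _).
    apply: tsum_subadd; [|exact: b|exact: b].
    move=> t t1; have [tM|tM] := leqP (visits t) M; first by left.
    right; split=> //; have [av|nav] := pselect (avoids g t); last by right.
    by left; split=> //; exact: ltnW.
  rewrite lerD2l; apply: tsum_subadd; [|exact: b3|exact: b].
  by move=> t [t1 [[av tM]|nav]]; [left|right].
have Bm2 : 2 * Bm <= V w 1%g.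
  have h : 2 * excursion_const g * V w 1%g <= M%:R * V w 1%g by rewrite ler_wpM2r.
  rewrite -(ler_pM2l M0); lra.
have c1 : V w 1%g <= 2 * LM + 2 * K * (tsum w (first_passage g) * V w g^-1%g) by lra.
rewrite expr2; apply: le_trans (ler_wpM2r V0 c1) _.
rewrite mulrDl lerD2l; have := ler_wpM2r Vi0 fp => /(ler_wpM2l K_ge0); lra.
Qed.

End Recurrence.

(** Summing [recurrent_bound] over a sphere with N elements puts N V(1)^2 on the left, while the
    sphere sum contributes only q B V(1)^2 on the right. For N > q B + 1 a full V(1)^2 remains
    against a term linear in V(1). *)
Lemma green_bound : exists C, forall w, summable_weight w -> V w 1%g <= C.
Proof.
have [B [B0 BP]] := sphere_sum_le.
pose q := 2 * K * Jc 1%g.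
have q0 : 0 <= q by rewrite !mulr_ge0 // Jc_ge0.
have [N NP] := nat_above (q * B + 1).
(* At least two elements are requested so that k > 0: then the identity, for which the excursion
   argument makes no sense, is not on the sphere. *)
have [k kN] := sphere_unbounded hS delta_gt0 hyp nonel N.+2.
have k0 : (0 < k)%N.
  rewrite lt0n; apply/eqP => k0; move: kN; rewrite k0 /sphere /= len1 //=.
have /choice [M MP] : forall g, exists M, 0 < (M%:R : R) /\ 2 * excursion_const g <= M%:R.
  move=> g; have [M MP] := nat_above (2 * excursion_const g).
  by exists M.+1; rewrite ltr0n; split=> //; apply: le_trans MP _; rewrite ler_nat.
pose Lg g := 2 * (\sum_(i < M g) (K * Jc 1%g) ^+ i).
exists (\sum_(g <- sphere S k) Lg g) => w ws; have [wg wf _] := ws.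
have V1 := V1_ge1 wg wf.
have : \sum_(g <- sphere S k) V w 1%g ^+ 2 <=
   \sum_(g <- sphere S k) (Lg g * V w 1%g + q * (V w g * V w g^-1%g)).
  rewrite big_seq [leRHS]big_seq; apply: ler_sum => g; rewrite (mem_sphere hS) => /eqP gk.
  have [M1 M2] := MP g; apply: (recurrent_bound wg wf) => // g1.
  by move: k0; rewrite -gk g1 len1.
rewrite big_split /= -[X in _ <= X + _]mulr_suml -[X in _ <= _ + X]mulr_sumr -/(sphere_sum w k).
rewrite big_const_seq count_predT iter_addr_0 -[leLHS]mulr_natl => h.
have h2 := ler_wpM2l q0 (BP w ws k).
have h3 : (q * B + 1) * V w 1%g ^+ 2 <= (size (sphere S k))%:R * V w 1%g ^+ 2.
  by rewrite ler_wpM2r ?exprn_ge0 ?V_ge0 // (le_trans NP) // ler_nat; lia.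
have h4 : V w 1%g * V w 1%g <= (\sum_(g <- sphere S k) Lg g) * V w 1%g.
  by move: h h2 h3; rewrite !expr2; lra.
by rewrite ler_pM2r in h4; [|lra].
Qed.

(** Gluing words of values g and g^-1 produces a word of prescribed value with a marked cut, and a
    word t has |t| + 1 positions for the mark. The final letter [a0] stands for the first letter of
    the base point at which the transfer operator is evaluated. *)
Lemma summable_weight_criterion w g0 (a0 : alpha) : quasi_mult w -> 0 < w [:: a0] ->
  has_sum (fun t => (size t).+1%:R * w t) (fun t => exists2 v, t = v ++ [:: a0] & kword v = g0) ->
  summable_weight w.
Proof.
move=> wg wa sQ; have [w_ge0 w_nil w_cat w_conn] := wg.
pose Q t := exists2 v, t = v ++ [:: a0] & kword v = g0.
have one_last g u : w u <= Kc g / w [:: a0] * \sum_(c <- conn g) w (u ++ c ++ [:: a0]).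
  by rewrite mulrAC ler_pdivlMr //; exact: w_conn.
have Kb g : 0 <= Kc g / w [:: a0] by rewrite divr_ge0.
have wQ : has_sum w Q.
  by apply: le_has_sum sQ => t _; rewrite ler_peMl // ler1n.
have fin g : has_sum w (loop g).
  pose phi c u := u ++ c ++ [:: a0].
  apply: (@has_sum_inj _ _ _ _ w w (conn (g^-1 * g0)%g) phi (loop g) Q _ (Kb _)) => //.
  - move=> c u /connP cg ug; exists (u ++ c); first by rewrite /phi catA.
    by rewrite kword_cat ug cg mulVKg.
  - move=> c u u' _ _ _ e; apply: (cat_size_inj e).
    by have := congr1 size e; rewrite /phi !size_cat; lia.
split=> //.
pose P' (p : seq alpha * nat) := Q p.1 /\ (p.2 <= size p.1)%N.
pose f' (p : seq alpha * nat) := w p.1.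
have bP' : has_sum f' P'.
  apply: (@has_sum_le _ _ _ _ (tsum (fun t => (size t).+1%:R * w t) Q)) => X uX XP.
  pose X1 := undup [seq p.1 | p <- X].
  apply: le_trans (_ : \sum_(p <- [seq (t, i) | t <- X1, i <- iota 0 (size t).+1]) f' p <= _).
    apply: le_sum_sub => //.
    - by move=> p; exact: w_ge0.
    - apply: allpairs_uniq_dep; first exact: undup_uniq.
        by move=> t _; exact: iota_uniq.
      by move=> [? ?] [? ?] _ _ /= [-> ->].
    - move=> [t i] tX; apply/allpairsPdep; exists t, i; split=> //.
        by rewrite mem_undup; apply/mapP; exists (t, i).
      by rewrite mem_iota /=; have [_] := XP _ tX.
  rewrite big_allpairs_dep; apply: le_trans (sum_le_tsum sQ (undup_uniq _) _).
    apply: ler_sum => t _; rewrite (eq_bigr (fun=> w t)) // big_const_seq count_predT.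
    by rewrite iter_addr_0 size_iota mulr_natl.
  by move=> t; rewrite mem_undup => /mapP[p /XP [? _] ->].
pose f (x : G * (seq alpha * seq alpha)) := w x.2.1 * w x.2.2.
pose P (x : G * (seq alpha * seq alpha)) := loop x.1 x.2.1 /\ loop x.1^-1%g x.2.2.
pose C := [seq (c, c') | c <- conn 1%g, c' <- conn g0].
pose phi (c : seq alpha * seq alpha) (x : G * (seq alpha * seq alpha)) :=
  (x.2.1 ++ c.1 ++ x.2.2 ++ c.2 ++ [:: a0], size x.2.1).
have K1 : 0 <= Kc 1%g * (Kc g0 / w [:: a0]) by rewrite mulr_ge0.
have h1 x : P x -> f x <= Kc 1%g * (Kc g0 / w [:: a0]) * \sum_(c <- C) f' (phi c x).
  move=> _; rewrite /f big_allpairs_dep /= -mulrA.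
  apply: le_trans (w_conn 1%g _ _) _; rewrite ler_wpM2l // mulr_sumr.
  apply: ler_sum => c _; apply: le_trans (one_last g0 _) _.
  by apply: ler_wpM2l => //; apply: ler_sum => c' _; rewrite /f' /phi /= -!catA.
have h2 c x : c \in C -> P x -> P' (phi c x).
  move=> /allpairsP[[c1 c2] /= [/connP k1 /connP k2 ->]] [p1 p2]; split; last by rewrite /= size_cat leq_addr.
  exists (x.2.1 ++ c1 ++ x.2.2 ++ c2); first by rewrite /= -!catA.
  by rewrite !kword_cat p1 p2 k1 k2 mul1g mulVKg.
have h3 c x y : c \in C -> P x -> P y -> phi c x = phi c y -> x = y.
  move=> _; case: x y => [g [u v]] [g' [u' v']] [/= p1 p2] [/= p1' p2'] [e su].
  have uu := cat_size_inj e su; move: e; rewrite uu => /cat_injl /cat_injl e.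
  have vv : v = v'.
    by apply: (cat_size_inj e); have := congr1 size e; rewrite !size_cat; lia.
  by rewrite -p1 -p1' uu vv.
have bP : has_sum f P := has_sum_inj K1 h1 h2 h3 bP'.
exists (tsum f P) => X uX.
pose fw (t : seq alpha * seq alpha) := w t.1 * w t.2.
pose Pg g (t : seq alpha * seq alpha) := loop g t.1 /\ loop g^-1%g t.2.
have bfw g : has_sum fw (Pg g) by apply: has_sum_prod.
apply: le_trans (_ : \sum_(g <- X) tsum fw (Pg g) <= _).
  by apply: ler_sum => g _; apply: (@le_tsum_prod _ _ _ w w) => //; exact: bfw.
have bX : has_sum (fun x : G * _ => fw x.2) (fun x => x.1 \in X /\ Pg x.1 x.2).
  by apply: has_sum_indexed => // g _; exact: bfw.
apply: le_trans (le_tsum_indexed uX bX) _.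
by apply: tsumS => // -[g t] [].
Qed.

(** The uniform bounds hold for finite sums of the approximating weights and pass to the limit. Then
    V converges at every g by monotonicity, and so does each sphere sum, being a finite sum of
    products. *)
Lemma weight_limit (wn : nat -> seq alpha -> R) w : (forall n, summable_weight (wn n)) ->
  quasi_mult w -> (forall n u, wn n u <= w u) ->
  (forall u e, 0 < e -> exists N, forall n, (N <= n)%N -> w u - e <= wn n u) ->
  (forall g, has_sum w (loop g)) /\ exists B, forall k, sphere_sum w k <= B.
Proof.
move=> wns wg wnw wn_lim; have [C CP] := green_bound; have [B [B0 BP]] := sphere_sum_le.
have [w_ge0 w_nil _ _] := wg.
have lim_sum X e : 0 < e -> exists N, forall n, (N <= n)%N ->
    \sum_(u <- X) w u - e <= \sum_(u <- X) wn n u.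
  elim: X e => [|u X IH] e e0; first by exists 0%N => n _; rewrite !big_nil; lra.
  have e2 : 0 < e / 2 by lra.
  have [N1 h1] := IH _ e2; have [N2 h2] := wn_lim u _ e2.
  exists (maxn N1 N2) => n; rewrite geq_max => /andP[n1 n2]; rewrite !big_cons.
  by have := h1 n n1; have := h2 n n2; lra.
have Vn n g : V (wn n) g <= harnack_const ^+ len g * C.
  have [g1 g2 _] := wns n; have := V_harnack g1 g2 hS g 1%g; rewrite mulg1 (lenV hS) => h.
  apply: le_trans h _; rewrite ler_wpM2l ?CP // exprn_ge0 //.
  by have := harnack_const_ge1; lra.
have wf g : has_sum w (loop g).
  apply: (@has_sum_le _ _ _ _ (harnack_const ^+ len g * C)) => X uX XP.
  apply/ler_addgt0Pr => e e0; have [N NP] := lim_sum X _ e0.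
  have := NP N (leqnn _); have [_ g2 _] := wns N.
  have := sum_le_tsum (g2 g) uX XP; have := Vn N g; lra.
split=> //; exists (B * C ^+ 2) => k.
have cv g : V (wn n) g @[n --> \oo] --> V w g.
  apply/cvgrPdist_le => e e0.
  have e2 : 0 < e / 2 by lra.
  have [X [uX XP Xs]] := tsum_adherent (wf g) e2; have [N NP] := lim_sum X _ e2.
  near=> n; have [_ g2 _] := wns n.
  have nN : (N <= n)%N by near: n; exists N.
  have h1 : V (wn n) g <= V w g by apply: le_tsum.
  have := NP n nN; have := sum_le_tsum (g2 g) uX XP.
  by rewrite ger0_norm ?subr_ge0 //; lra.
have cvs : sphere_sum (wn n) k @[n --> \oo] --> sphere_sum w k.
  rewrite /sphere_sum; elim: (sphere S k) => [|g X IH].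
    by under eq_fun do rewrite big_nil; rewrite big_nil; exact: cvg_cst.
  under eq_fun do rewrite big_cons; rewrite big_cons; apply: cvgD => //.
  by apply: cvgM.
apply: (cvgr_to_le cvs); near=> n.
have [g1 g2 _] := wns n; apply: le_trans (BP _ (wns n) k) _.
rewrite ler_wpM2l // !expr2; apply: ler_pM; rewrite ?V_ge0 ?CP //; exact: wns.
Unshelve. all: by end_near.
Qed.

End Weights.

(** * Barriers *)

Section RealLemmas.
Variable R : realType.

Lemma cauchy_schwarz_seq (T : Type) (X : seq T) (f g : T -> R) :
  (\sum_(x <- X) f x * g x) ^+ 2 <= (\sum_(x <- X) f x ^+ 2) * (\sum_(x <- X) g x ^+ 2).
Proof.
elim: X => [|x X IH]; first by rewrite !big_nil expr0n mulr0.
rewrite !big_cons; set s := \sum_(_ <- _) _ in IH *; set A := \sum_(_ <- _) _ in IH *.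
set B := \sum_(_ <- _) _ in IH *; move: (f x) (g x) => a b.
have A0 : 0 <= A by rewrite sumr_ge0 // => ? _; exact: sqr_ge0.
have B0 : 0 <= B by rewrite sumr_ge0 // => ? _; exact: sqr_ge0.
have e : 2 * s * (a * b) <= A * b ^+ 2 + B * a ^+ 2.
  have r0 : 0 <= A * b ^+ 2 + B * a ^+ 2 by rewrite addr_ge0 // mulr_ge0 // sqr_ge0.
  apply: le_trans (ler_norm _) _; rewrite -ler_sqr ?nnegrE // real_normK ?num_real //.
  apply: le_trans (_ : 4 * (A * B) * (a * b) ^+ 2 <= _).
    have := ler_wpM2r (sqr_ge0 (a * b)) IH; lra.
  by rewrite -subr_ge0 (_ : _ - _ = (A * b ^+ 2 - B * a ^+ 2) ^+ 2) ?sqr_ge0 //; ring.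
by move: IH e; rewrite !expr2; lra.
Qed.

Lemma ceil_nat (x : R) : 0 <= x -> exists D : nat, x <= D%:R /\ D%:R <= x + 1.
Proof.
move=> x0; have ex : exists n : nat, x <= n%:R by exact: nat_above.
case: (ex_minnP ex) => D xD Dmin; exists D; split=> //.
case: D xD Dmin => [|D] xD Dmin; first by lra.
rewrite -natr1 lerD2r leNgt; apply/negP => /ltW /Dmin; by rewrite ltnn.
Qed.

Lemma grid_count (s l h : R) N : 0 < h -> 0 <= l ->
  (count (fun j : nat => s < j%:R * h <= s + l) (iota 0 N))%:R <= l / h + 1.
Proof.
move=> h0 l0; have [D [D1 D2]] := ceil_nat (divr_ge0 l0 (ltW h0)).
apply: le_trans D2; rewrite ler_nat.
set P := fun j : nat => _; rewrite -size_filter.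
have [|nh] := boolP (has P (iota 0 N)); last first.
  by rewrite size_filter; move: nh; rewrite has_count -leqNgt leqn0 => /eqP ->.
move=> hP; have ex : exists j, P j by have /hasP[j _ Pj] := hP; exists j.
case: (ex_minnP ex) => j0 /andP[j01 j02] jmin.
rewrite -[leqRHS](size_iota j0); apply: uniq_leq_size; first by rewrite filter_uniq ?iota_uniq.
move=> j; rewrite mem_filter => /andP[Pj _]; have jj := jmin j Pj.
case/andP: Pj => j1 j2; rewrite mem_iota jj /= -ltn_subLR // -(ltr_nat R) natrB //.
apply: lt_le_trans D1; rewrite ltr_pdivlMr // mulrBl; lra.
Qed.

(** Averaging over a grid of N equidistant levels of mesh h takes the place of an integral over t. A
    window of length l contains at most l / h + 1 grid points; the summand 1 accounts for the error
    e once N is large. *)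
Lemma pick_level (T : Type) (J : seq T) (c s l : T -> R) (tau e : R) :
  (forall x, 0 <= c x) -> (forall x, 0 <= l x) -> 0 < tau -> 0 < e ->
  exists t, [/\ 0 <= t, t < tau &
    \sum_(x <- J | s x < t <= s x + l x) c x <= (\sum_(x <- J) c x * l x) / tau + e].
Proof.
move=> c0 l0 tau0 e0; set Av := _ / tau; pose Sc := \sum_(x <- J) c x.
have [N0 NP] := nat_above (Sc / e); pose N := N0.+1.
have Ne : Sc < N%:R * e.
  rewrite -ltr_pdivrMr //; apply: le_lt_trans NP _; by rewrite ltr_nat.
pose h := tau / N%:R; have h0 : 0 < h by rewrite divr_gt0.
apply: contrapT => no.
have big (j : nat) : (j < N)%N -> Av + e <= \sum_(x <- J | s x < j%:R * h <= s x + l x) c x.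
  move=> jN; rewrite leNgt; apply/negP => lt; apply: no; exists (j%:R * h); split.
  - by rewrite mulr_ge0 // ltW.
  - by rewrite /h mulrA ltr_pdivrMr // mulrC ltr_pM2l // ltr_nat.
  - exact: ltW.
have h1 : N%:R * (Av + e) <= \sum_(j <- iota 0 N) \sum_(x <- J | s x < j%:R * h <= s x + l x) c x.
  apply: le_trans (_ : \sum_(j <- iota 0 N) (Av + e) <= _).
    by rewrite big_const_seq count_predT size_iota iter_addr_0 mulr_natl.
  by rewrite big_seq [leRHS]big_seq; apply: ler_sum => j; rewrite mem_iota => /big.
have h2 : \sum_(j <- iota 0 N) \sum_(x <- J | s x < j%:R * h <= s x + l x) c x <=
    \sum_(x <- J) c x * (l x / h + 1).
  rewrite (exchange_big_dep xpredT) //=; apply: ler_sum => x _.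
  rewrite big_const_seq iter_addr_0 -[leLHS]mulr_natr ler_wpM2l //.
  by have := @grid_count (s x) (l x) h N h0 (l0 x).
have h3 : \sum_(x <- J) c x * (l x / h + 1) = N%:R * Av + Sc.
  rewrite /Av mulrCA mulr_suml -big_split /=; apply: eq_bigr => x _.
  rewrite /h; field; by rewrite !gt_eqF.
by move: h1; rewrite leNgt => /negP; apply; apply: le_lt_trans h2 _; rewrite h3 mulrDr ltrD2l.
Qed.

Lemma sum_by_key (T U : eqType) (E : seq T) (key : T -> U) (Ks : seq U) (F : T -> R) : uniq Ks ->
  (forall e, e \in E -> key e \in Ks) ->
  \sum_(e <- E) F e = \sum_(k <- Ks) \sum_(e <- E | key e == k) F e.
Proof.
move=> uK EK; rewrite (exchange_big_dep xpredT) //= big_seq [RHS]big_seq.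
apply: eq_bigr => e eE; rewrite -big_filter (_ : [seq i <- _ | _] = [:: key e]) ?big_seq1 //.
rewrite -(filter_pred1_uniq uK (EK e eE)).
by apply: eq_filter => i /=; rewrite eq_sym.
Qed.

Lemma poly_exp (a C : R) : 0 < a ->
  exists n0 : nat, forall n, (n0 <= n)%N -> C * n.+1%:R ^+ 3 <= expR (a * n%:R).
Proof.
move=> a0; pose b := a / 4; have b0 : 0 < b by rewrite /b; lra.
have b4 : 0 < b ^+ 4 by exact: exprn_gt0.
have q0 : 0 <= `|C| * 8 / b ^+ 4.
  by apply: divr_ge0; [apply: mulr_ge0|exact: ltW].
have [n0 nP] := nat_above (`|C| * 8 / b ^+ 4 + 1).
exists n0 => n n0n.
have n1 : `|C| * 8 / b ^+ 4 + 1 <= n%:R by apply: le_trans nP _; rewrite ler_nat.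
move: n1; set x := n%:R => n1; have x1 : 1 <= x by lra.
have h1 : (b * x) ^+ 4 <= expR (a * x).
  have -> : expR (a * x) = expR (b * x) ^+ 4.
    by rewrite -expRM_natl; congr expR; rewrite /b; lra.
  have bx : 0 <= b * x by rewrite mulr_ge0 ?(ltW b0) //; lra.
  rewrite lerXn2r ?nnegrE ?expR_ge0 //.
  by apply: le_trans (expR_ge1Dx _); lra.
apply: le_trans h1; rewrite -natr1 -/x.
have x3 : 0 <= x ^+ 3 by exact: exprn_ge0.
apply: le_trans (_ : `|C| * (2 * x) ^+ 3 <= _).
  apply: le_trans (_ : `|C| * (x + 1) ^+ 3 <= _).
    by rewrite ler_wpM2r ?ler_norm // exprn_ge0 //; lra.
  by rewrite ler_wpM2l // lerXn2r ?nnegrE; lra.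
have h2 : `|C| * 8 <= b ^+ 4 * x by rewrite [leRHS]mulrC -ler_pdivrMr //; lra.
have := ler_wpM2r x3 h2; rewrite !exprMn [x ^+ 4]exprS.
have -> : (2 : R) ^+ 3 = 8 by rewrite !exprS expr0; lra.
lra.
Qed.

Lemma geo_tail (y : R) n N : 0 <= y < 1 -> \sum_(n <= k < N) y ^+ k <= y ^+ n / (1 - y).
Proof.
move=> /andP[y0 y1]; rewrite ler_pdivlMr ?subr_gt0 //.
have [nN|Nn] := leqP n N; last by rewrite big_geq ?(ltnW Nn) // mul0r exprn_ge0.
suff -> : (\sum_(n <= k < N) y ^+ k) * (1 - y) = y ^+ n - y ^+ N.
  by rewrite lerBlDr lerDl exprn_ge0.
rewrite mulr_suml -[RHS]opprB -(telescope_sumr _ nN) -sumrN; apply: eq_bigr => k _.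
by rewrite exprS; ring.
Qed.

End RealLemmas.

Section Barriers.
Variables (R : realType) (G : groupType) (S : seq G).
Hypothesis hS : symmetric_generating S.
Variable delta : R.
Hypothesis delta_gt0 : 0 < delta.
Hypothesis hyp : forall x y z, Num.min (gp R S x y) (gp R S y z) - delta <= gp R S x z.
Local Notation len := (word_length S).
Local Notation gp := (gp R S).
Implicit Types (g h b : G).

(** * Square sums of Green functions over pairs of points *)

Section PairSums.
Variables (V : G -> R) (B : R).
Hypothesis sphere_sq : forall k, \sum_(g <- sphere S k) V g ^+ 2 <= B.

(** A small Gromov product means that a geodesic from a to b passes near the identity. Hence |a^-1
    b| is between k + l - 2 c and k + l, and [count_near], applied to (a^-1, a^-1 b), shows that
    boundedly many pairs share the same a^-1 b. *)
Lemma pair_sum k l c r (E : seq (G * G)) : uniq E ->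
  (forall e, e \in E -> [/\ len e.1 = k, len e.2 = l & gp e.1 e.2 <= c%:R]) ->
  (2 * c)%:R + 2 * delta <= r%:R ->
  \sum_(e <- E) V (e.1^-1 * e.2)%g ^+ 2 <= (size (wball S r))%:R * ((2 * c).+1%:R * B).
Proof.
move=> uE EP cr; pose f (e : G * G) := (e.1^-1, e.1^-1 * e.2)%g.
have -> : \sum_(e <- E) V (e.1^-1 * e.2)%g ^+ 2 = \sum_(e <- [seq f e | e <- E]) V e.2 ^+ 2.
  by rewrite big_map.
have len2 e : e \in E -> (k + l <= len (e.1^-1 * e.2)%g + 2 * c)%N /\ (len (e.1^-1 * e.2)%g <= k + l)%N.
  move=> /EP[e1 e2 ec]; split; last by rewrite -e1 -e2 -(lenV hS e.1); exact: lenM.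
  by rewrite -(ler_nat R) (natrD _ k l) (natrD _ _ (2 * c)) natrM -e1 -e2 len_gp; lra.
apply: le_trans (@count_near R G S hS delta delta_gt0 hyp k (2 * c) r _ (fun g => V g ^+ 2) _ _ cr _) _.
- rewrite map_inj_uniq // => -[a b] [a' b'] [/invg_inj -> /mulgI -> //].
- move=> _ /mapP[e eE ->] /=; have [e1 e2 _] := EP e eE; have [h1 _] := len2 e eE.
  by rewrite (lenV hS) invgK mulVKg e1 e2; split=> //; exact: h1.
- by move=> g; exact: sqr_ge0.
rewrite ler_wpM2l //.
apply: le_trans (_ : \sum_(j <- iota (k + l - 2 * c) (2 * c).+1) \sum_(g <- sphere S j) V g ^+ 2 <= _); last first.
  apply: le_trans (ler_sum _ (fun j _ => sphere_sq j)) _.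
  by rewrite big_const_seq count_predT size_iota iter_addr_0 mulr_natl.
rewrite -(@big_allpairs_dep _ _ _ _ (fun _ => G) _ (fun (_ : nat) g => g) _ (fun j => sphere S j) (fun g => V g ^+ 2)).
apply: le_sum_sub => //; first by move=> g; exact: sqr_ge0.
- exact: undup_uniq.
- apply: allpairs_uniq_dep; first exact: iota_uniq.
    by move=> j _; exact: sphere_uniq.
  move=> [j g] [j' g'] /allpairsPdep[a1 [b1 [_ bj e1]]] /allpairsPdep[a2 [b2 [_ bj' e2]]] /= gg.
  move: bj bj'; rewrite !(mem_sphere hS); case: e1 e2 => ? e1 [? e2]; subst.
  by move=> /eqP <- /eqP <-.
- move=> x; rewrite mem_undup => /mapP[_ /mapP[e eE ->] ->]; have [h1 h2] := len2 e eE.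
  apply/allpairsPdep; exists (len (e.1^-1 * e.2)%g), (e.1^-1 * e.2)%g; split=> //.
    by rewrite mem_iota; lia.
  by rewrite (mem_sphere hS).
Qed.

Lemma pair_sum_weighted c r y1 y2 (K1 K2 : seq nat) (E : seq (G * G)) :
  0 <= y1 -> 0 <= y2 -> uniq E -> 0 <= B -> uniq K1 -> uniq K2 ->
  (forall e, e \in E -> [/\ len e.1 \in K1, len e.2 \in K2 & gp e.1 e.2 <= c%:R]) ->
  (2 * c)%:R + 2 * delta <= r%:R ->
  \sum_(e <- E) V (e.1^-1 * e.2)%g ^+ 2 * (y1 ^+ len e.1 * y2 ^+ len e.2) <=
  (size (wball S r))%:R * ((2 * c).+1%:R * B) *
  ((\sum_(k <- K1) y1 ^+ k) * (\sum_(l <- K2) y2 ^+ l)).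
Proof.
move=> y10 y20 uE B0 uK1 uK2 EP cr.
set D := _ * (_ * B).
have D0 : 0 <= D by rewrite /D; apply: mulr_ge0 => //; apply: mulr_ge0.
pose KL := [seq (k, l) | k <- K1, l <- K2].
have uKL : uniq KL by rewrite allpairs_uniq // => -[? ?] [? ?].
rewrite (@sum_by_key _ _ _ E (fun e => (len e.1, len e.2)) KL) //; last first.
  move=> e eE; have [h3 h4 _] := EP e eE.
  by apply/allpairsP; exists (len e.1, len e.2).
apply: le_trans (_ : \sum_(kl <- KL) D * (y1 ^+ kl.1 * y2 ^+ kl.2) <= _).
  apply: ler_sum => -[k l] _ /=.
  rewrite (eq_bigr (fun e => V (e.1^-1 * e.2)%g ^+ 2 * (y1 ^+ k * y2 ^+ l))); last first.
    by move=> e /eqP[-> ->].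
  rewrite -mulr_suml ler_wpM2r ?mulr_ge0 ?exprn_ge0 // -big_filter.
  apply: (@pair_sum k l) => //; first exact: filter_uniq.
  by move=> e; rewrite mem_filter => /andP[/eqP[-> ->] /EP[_ _ ?]].
by rewrite -mulr_sumr ler_wpM2l // big_allpairs_dep /= -big_distrlr.
Qed.

End PairSums.

(** * Barriers and the choice of their levels *)

Section Levels.
Variables (eps T0 : R) (L : nat).
Hypothesis eps_gt0 : 0 < eps.

(* A step of a path that ends at distance [k] from the origin has visual length at
   most [thick k], so that it cannot jump over a barrier. *)
Definition thick k : R := expR (- (eps * (k%:R - L%:R))).

Lemma thick_split k : thick k = expR (eps * L%:R) * (expR (- (eps / 2)) ^+ k * expR (- (eps / 2)) ^+ k).
Proof. by rewrite -!expRM_natl -!expRD /thick; congr expR; lra. Qed.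

Lemma thick_le k n : (n <= k)%N -> thick k <= thick n.
Proof.
move=> nk; rewrite ler_expR lerN2 ler_wpM2l ?(ltW eps_gt0) // lerB // ler_nat //.
Qed.

(** The minimum is at most the geometric mean, which factors into geometric weights in k and in
    l. *)
Lemma thick_min k l : Num.min (thick k) (thick l) <=
  expR (eps * L%:R) * (expR (- (eps / 2)) ^+ k * expR (- (eps / 2)) ^+ l).
Proof.
have y1 : expR (- (eps / 2)) <= 1 by rewrite expR_le1; have := eps_gt0; lra.
rewrite ge_min !thick_split; apply/orP; have [kl|lk] := leqP k l.
  by right; rewrite ler_wpM2l // ler_wpM2r ?exprn_ge0 // ler_wiXn2l.
by left; rewrite ler_wpM2l // ler_wpM2l ?exprn_ge0 // ler_wiXn2l // ltnW.
Qed.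

Variables (V : G -> R) (B : R).
Hypothesis sphere_sq : forall k, \sum_(g <- sphere S k) V g ^+ 2 <= B.
Variables (F : G -> R) (X : seq G) (m n c r : nat) (tau : R).
Hypothesis uX : uniq X.
Hypothesis tau_gt0 : 0 < tau.

Definition barrier t i v := (n < len v)%N && (t + i%:R * tau <= F v < t + i%:R * tau + thick (len v)).

Variables p q : G.
(** The end points of the paths act as the levels 0 and m + 1, so that consecutive levels account
    for the whole path. *)
Definition level_set t i : seq G :=
  if i == 0%N then [:: p] else if i == m.+1 then [:: q] else [seq v <- X | barrier t i v].

(** The squared Hilbert-Schmidt norm of the matrix V(a^-1 b) between consecutive levels. *)
Definition hs_sum t i := \sum_(a <- level_set t i) \sum_(b <- level_set t i.+1) V (a^-1 * b)%g ^+ 2.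

Definition vis_bound := (size (wball S r))%:R * ((2 * c).+1%:R * B).

Let y := expR (- (eps / 2)).

Definition barrier_const := vis_bound * expR (eps * L%:R) / (1 - y) ^+ 2.

(** The member of a pair whose place on a barrier is tested when averaging over t: never [p] or [q],
    which belong to their level for every t, and otherwise the one with the thinner window. *)
Let sel (j : nat * (G * G)) : G * nat :=
  if j.1 == 0%N then (j.2.2, 1%N) else if j.1 == m then (j.2.1, m)
  else if thick (len j.2.1) <= thick (len j.2.2) then (j.2.1, j.1) else (j.2.2, j.1.+1).

Let X' := [seq v <- X | (n < len v)%N].
Let E i := [seq e <- [seq (a, b) | a <- if i == 0%N then [:: p] else X',
   b <- if i == m then [:: q] else X'] | gp e.1 e.2 <= c%:R].

Let y01 : 0 <= y < 1.
Proof. by rewrite expR_ge0 expR_lt1; have := eps_gt0; lra. Qed.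

Hypothesis m_gt0 : (0 < m)%N.
Hypothesis cr : (2 * c)%:R + 2 * delta <= r%:R.
Hypothesis B_ge0 : 0 <= B.

Lemma vis_bound_ge0 : 0 <= vis_bound.
Proof. by rewrite /vis_bound; apply: mulr_ge0 => //; apply: mulr_ge0. Qed.

Let sum_le (K1 K2 : seq nat) y1 y2 (E0 : seq (G * G)) t :
  0 <= y1 -> 0 <= y2 -> uniq E0 -> uniq K1 -> uniq K2 ->
  (forall e, e \in E0 -> [/\ len e.1 \in K1, len e.2 \in K2 & gp e.1 e.2 <= c%:R]) ->
  (forall e, e \in E0 -> t e <= expR (eps * L%:R) * (y1 ^+ len e.1 * y2 ^+ len e.2)) ->
  (\sum_(k <- K1) y1 ^+ k) * (\sum_(l <- K2) y2 ^+ l) <= y ^+ n / (1 - y) ^+ 2 ->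
  \sum_(e <- E0) V (e.1^-1 * e.2)%g ^+ 2 * t e <= barrier_const * y ^+ n.
Proof.
move=> y10 y20 uE uK1 uK2 EP Et Ksum.
have E0' : 0 <= expR (eps * L%:R) by exact: expR_ge0.
have h := pair_sum_weighted sphere_sq y10 y20 uE B_ge0 uK1 uK2 EP cr.
apply: le_trans (_ : expR (eps * L%:R) * \sum_(e <- E0) V (e.1^-1 * e.2)%g ^+ 2 *
   (y1 ^+ len e.1 * y2 ^+ len e.2) <= _).
  rewrite mulr_sumr big_seq [leRHS]big_seq; apply: ler_sum => e eE.
  rewrite [leRHS]mulrCA; apply: ler_wpM2l; [exact: sqr_ge0|exact: Et].
apply: le_trans (ler_wpM2l E0' h) _.
apply: le_trans (ler_wpM2l E0' (ler_wpM2l vis_bound_ge0 Ksum)) _.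
by rewrite /barrier_const le_eqVlt; apply/orP; left; apply/eqP; ring.
Qed.

Let geo1 K : uniq K -> (forall k, k \in K -> (n < k)%N) ->
  \sum_(k <- K) y ^+ k <= y ^+ n / (1 - y).
Proof.
move=> uK Kn; have /andP[y0 y1] := y01.
apply: le_trans (geo_tail n (\max_(k <- K) k).+1 y01).
apply: le_sum_sub => //; [by move=> k; exact: exprn_ge0|exact: iota_uniq|].
move=> k kK; rewrite mem_index_iota ltnS (ltnW (Kn k kK)) /=.
exact: (@leq_bigmax_seq _ K xpredT id).
Qed.

Let lens (E0 : seq G) := undup [seq len v | v <- E0].

(** The windows are exponentially thin outside the ball of radius n, which yields y^n. At the first
    and last step one member of the pair is fixed, so its geometric weight is replaced by 1 on a
    single length. *)
Let E_sum i : (i <= m)%N ->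
  \sum_(e <- E i) V (e.1^-1 * e.2)%g ^+ 2 * thick (len (sel (i, e)).1) <= barrier_const * y ^+ n.
Proof.
move=> im; have /andP[y0 y1] := y01.
have y1' : 0 < 1 - y by rewrite subr_gt0.
have uX' : uniq X' by exact: filter_uniq.
have yn1 : y ^+ n <= 1 by rewrite exprn_ile1 // ltW.
have yn0 : 0 <= y ^+ n by exact: exprn_ge0.
have uEi : uniq (E i).
  apply: filter_uniq; apply: allpairs_uniq; [by case: ifP|by case: ifP|].
  by move=> [? ?] [? ?].
have inE_ x : x \in E i -> exists a b, [/\ x = (a, b), a \in (if i == 0%N then [:: p] else X'),
    b \in (if i == m then [:: q] else X') & gp a b <= c%:R].
  rewrite mem_filter => /andP[gab /allpairsP[[a b] /= [aP bP ex]]].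
  by exists a, b; split=> //; rewrite ex in gab.
have E1 : 0 <= expR (eps * L%:R) by exact: expR_ge0.
have q1 : y ^+ n / (1 - y) <= y ^+ n / (1 - y) ^+ 2.
  rewrite ler_wpM2l // lef_pV2 ?posrE ?exprn_gt0 // expr2 ler_piMl ?(ltW y1') //; lra.
have lX k : k \in lens X' -> (n < k)%N.
  by rewrite mem_undup => /mapP[v]; rewrite mem_filter => /andP[? _] ->.
have inl v : v \in X' -> len v \in lens X' by move=> vX; rewrite mem_undup map_f.
have t1 k : thick k <= expR (eps * L%:R) * y ^+ k.
  rewrite thick_split ler_wpM2l // ler_piMl ?exprn_ge0 // exprn_ile1 // ltW //.
have [i0|i0] := eqVneq i 0%N.
  apply: (@sum_le [:: len p] (lens X') 1 y) => //; first exact: undup_uniq.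
  - move=> _ /inE_[a [b [-> aP bX gpab]]] /=; move: aP bX.
    rewrite i0 eqxx (ltn_eqF m_gt0) inE => /eqP ap bX.
    by rewrite ap mem_head -ap; split=> //; exact: inl.
  - by move=> e _; rewrite /sel i0 /= expr1n mul1r.
  - by rewrite big_seq1 expr1n mul1r; apply: le_trans q1; apply: geo1 => //; exact: undup_uniq.
have [im'|im'] := eqVneq i m.
  apply: (@sum_le (lens X') [:: len q] y 1) => //; first exact: undup_uniq.
  - move=> _ /inE_[a [b [-> aX bq gpab]]] /=; move: aX bq.
    rewrite (negbTE i0) im' eqxx inE => aX /eqP bq.
    by rewrite bq mem_head -bq; split=> //; exact: inl.
  - by move=> e _; rewrite /sel /= (negbTE i0) im' eqxx /= expr1n mulr1.
  - by rewrite big_seq1 expr1n mulr1; apply: le_trans q1; apply: geo1 => //; exact: undup_uniq.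
apply: (@sum_le (lens X') (lens X') y y) => //; try exact: undup_uniq.
- move=> _ /inE_[a [b [-> aX bX gpab]]] /=; move: aX bX.
  rewrite (negbTE i0) (negbTE im') => aX bX.
  by split; [exact: inl|exact: inl|].
- move=> e _; apply: le_trans (thick_min _ _); rewrite /sel /= (negbTE i0) (negbTE im').
  by rewrite le_min; case: (lerP (thick (len e.1)) (thick (len e.2))) => h /=; rewrite ?lexx ?h ?(ltW h).
- rewrite -expr2; apply: le_trans (_ : (y ^+ n / (1 - y)) ^+ 2 <= _).
    rewrite lerXn2r ?nnegrE ?sumr_ge0 //; [by move=> k _; exact: exprn_ge0| |].
      by rewrite divr_ge0 // ltW.
    by apply: geo1 => //; exact: undup_uniq.
  rewrite expr_div_n ler_wpM2r ?invr_ge0 ?exprn_ge0 ?(ltW y1') //.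
  by rewrite expr2 ler_piMl.
Qed.

Hypothesis Hgp : forall t i a b, 0 <= t < tau -> (i <= m)%N -> a \in level_set t i ->
  b \in level_set t i.+1 -> gp a b <= c%:R.

(** For t uniform in [0, tau), a given pair lies on the barriers with probability at most the
    thinner window divided by tau. One t is good for the sum over all i, hence for each i. *)
Lemma choose_levels e : 0 < e -> exists2 t, 0 <= t < tau &
  forall i, (i <= m)%N -> hs_sum t i <= m.+1%:R * (barrier_const * y ^+ n) / tau + e.
Proof.
move=> e0.
pose J := [seq (i, x) | i <- iota 0 m.+1, x <- E i].
pose cc (j : nat * (G * G)) := V (j.2.1^-1 * j.2.2)%g ^+ 2.
pose ll (j : nat * (G * G)) := thick (len (sel j).1).
(* The barrier condition for the selected point, solved for t: a half-open window of length [ll j]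
   that starts at [ss j]. *)
pose ss (j : nat * (G * G)) := F (sel j).1 - (sel j).2%:R * tau - ll j.
have cc0 j : 0 <= cc j by exact: sqr_ge0.
have ll0 j : 0 <= ll j by exact: expR_ge0.
have [t [t0 tt tJ]] := @pick_level R _ J cc ss ll tau e cc0 ll0 tau_gt0 e0.
exists t => [|i im]; first by rewrite t0.
apply: le_trans (le_trans tJ _); last first.
  rewrite lerD2r ler_wpM2r ?invr_ge0 ?(ltW tau_gt0) // /J big_allpairs_dep.
  apply: le_trans (_ : \sum_(i <- iota 0 m.+1) barrier_const * y ^+ n <= _); last first.
    by rewrite big_const_seq count_predT size_iota iter_addr_0 mulr_natl.
  rewrite big_seq [leRHS]big_seq; apply: ler_sum => j; rewrite mem_iota add0n ltnS => /andP[_ jm].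
  exact: E_sum.
rewrite /hs_sum -(big_allpairs (F := fun e => V (e.1^-1 * e.2)%g ^+ 2)) -[leRHS]big_filter.
have -> : \sum_(e <- [seq (a, b) | a <- level_set t i, b <- level_set t i.+1]) V (e.1^-1 * e.2)%g ^+ 2 =
  \sum_(j <- [seq (i, e) | e <- [seq (a, b) | a <- level_set t i, b <- level_set t i.+1]]) cc j.
  by rewrite big_map.
have ul k : uniq (level_set t k) by rewrite /level_set; do ?case: ifP => // _; exact: filter_uniq.
apply: le_sum_sub => //.
- by rewrite map_inj_uniq; [rewrite allpairs_uniq // => -[? ?] [? ?]|move=> ? ? []].
- apply: filter_uniq; apply: allpairs_uniq_dep; first exact: iota_uniq.
    move=> j _; apply: filter_uniq; apply: allpairs_uniq; last by move=> [? ?] [? ?].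
      by case: ifP => // _; exact: filter_uniq.
    by case: ifP => // _; exact: filter_uniq.
  by move=> [? ?] [? ?] _ _ /= [-> ->].
move=> _ /mapP[_ /allpairsP[[a b] /= [al bl ->]] ->].
have gab : gp a b <= c%:R by apply: (Hgp _ im al bl); rewrite t0.
have lev k v : (0 < k <= m)%N -> v \in level_set t k -> v \in X' /\ F v - k%:R * tau - thick (len v) < t <= F v - k%:R * tau.
  move=> /andP[k0 km]; rewrite /level_set gtn_eqF // ltn_eqF //.
  rewrite mem_filter => /andP[/andP[nv /andP[h1 h2]] vX]; split; first by rewrite mem_filter nv.
  by apply/andP; split; lra.
rewrite mem_filter; apply/andP; split.
  rewrite /ss /ll subrK /sel /=; have [i0|i0] := eqVneq i 0%N.
    by have [] := lev 1%N b; rewrite ?m_gt0 // -[1%N]/(0.+1) -i0.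
  have [im'|im'] := eqVneq i m.
    by have [] := lev m a; rewrite ?m_gt0 ?leqnn // -im'.
  case: ifP => _ /=.
    by have [] := lev i a; rewrite // lt0n i0 im.
  have [] // := lev i.+1 b; by rewrite /= ltn_neqAle im' im.
apply/allpairsPdep; exists i, (a, b); split=> //; first by rewrite mem_iota.
rewrite mem_filter gab /=; apply/allpairsP; exists (a, b); split=> //=.
  case: eqP => [i0|/eqP i0]; first by move: al; rewrite /level_set i0.
  by have [] := lev i a; rewrite // lt0n i0 im.
case: eqP => [im'|/eqP im']; first by move: bl; rewrite /level_set im' eqxx.
by have [] // := lev i.+1 b; rewrite /= ltn_neqAle im' im.
Qed.

(* The vector [z] of restricted Green functions to the end point is transported
   from one barrier to the next by a matrix of small Hilbert-Schmidt norm. *)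
Lemma barrier_product (Lv : nat -> seq G) (z : G -> R) K M :
  0 <= K -> (forall a, 0 <= z a) -> (forall a, 0 <= V a) ->
  (forall i, (i < M)%N -> forall a, a \in Lv i ->
     z a <= K * \sum_(b <- Lv i.+1) V (a^-1 * b)%g * z b) ->
  (forall i, (i < M)%N ->
     K ^+ 2 * (\sum_(a <- Lv i) \sum_(b <- Lv i.+1) V (a^-1 * b)%g ^+ 2) <= 4^-1) ->
  \sum_(a <- Lv 0%N) z a ^+ 2 <= 4^-1 ^+ M * \sum_(a <- Lv M) z a ^+ 2.
Proof.
move=> K0 z0 V0; elim: M => [|M IH] zM hs; first by rewrite expr0 mul1r.
apply: le_trans (IH _ _) _; [by move=> i iM; exact/zM/ltnW|by move=> i iM; exact/hs/ltnW|].
rewrite exprSr -mulrA ler_wpM2l ?exprn_ge0 ?invr_ge0 //.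
have s0 : 0 <= \sum_(b <- Lv M.+1) z b ^+ 2 by rewrite sumr_ge0 // => b _; exact: sqr_ge0.
apply: le_trans (ler_wpM2r s0 (hs M (ltnSn M))).
rewrite -mulrA mulr_suml mulr_sumr big_seq [leRHS]big_seq; apply: ler_sum => a aL.
set s := \sum_(b <- Lv M.+1) V (a^-1 * b)%g * z b.
have r0 : 0 <= K * s.
  by apply: mulr_ge0 => //; apply: sumr_ge0 => b _; exact: mulr_ge0.
have := zM M (ltnSn M) a aL; rewrite -/s -(ler_sqr (z0 a) r0) => h.
apply: le_trans h _; rewrite exprMn ler_wpM2l ?sqr_ge0 //.
exact: cauchy_schwarz_seq.
Qed.

End Levels.
End Barriers.

(** The spacing tau is of order 1 / n, and c = n / J is more than enough for exp(- eps c) <= tau /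
    2. With J large, the ball of radius 2 c + r0 has size at most exp(eps n / 4) up to a constant,
    while thinness of the barriers gives exp(- eps n / 2); powers of n do not matter. *)
Lemma level_asymptotics (R : realType) (eps T0 Bv Th : R) (L M s0 r0 : nat) : 0 < eps -> 0 < T0 ->
  0 <= Bv -> 0 < Th -> (0 < s0)%N ->
  exists n0 : nat, forall n, (n0 <= n)%N -> exists c tau,
   [/\ 0 < tau /\ tau * ((M * n)%:R + 3) = T0, expR (- (eps * c%:R)) <= tau / 2,
      expR (- (eps * (n%:R - L%:R))) <= tau / 2 &
      (M * n).+1%:R * (s0%:R ^+ (2 * c + r0) * ((2 * c).+1%:R * Bv) * expR (- (eps / 2)) ^+ n) / tau <= Th].
Proof.
move=> e0 T00 Bv0 Th0 s00.
have [J1 J1P] := nat_above ((s0%:R : R) ^+ 2 * 4 / eps).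
pose J := J1.+1; have J0 : 0 < (J%:R : R) by rewrite ltr0n.
have JP : (s0%:R : R) ^+ 2 <= expR (eps * J%:R / 4).
  have h : (s0%:R : R) ^+ 2 * 4 / eps <= J%:R by apply: le_trans J1P _; rewrite ler_nat.
  rewrite ler_pdivrMr // in h; apply: le_trans (expR_ge1Dx _); lra.
pose M3 : R := M%:R + 3; have M30 : 0 < M3 by rewrite /M3 ltr_wpDl.
have e4 : 0 < eps / 4 by lra. have eJ : 0 < eps / J%:R by rewrite divr_gt0.
have [n1 n1P] := poly_exp (2 * M3 ^+ 2 * Bv * s0%:R ^+ r0 / (T0 * Th)) e4.
have [n2 n2P] := poly_exp (2 * M3 / T0 * expR eps) eJ.
have [n3 n3P] := poly_exp (2 * M3 / T0 * expR (eps * L%:R)) e0.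
exists (maxn n1 (maxn n2 n3)) => n; rewrite !geq_max => /and3P[/n1P h1 /n2P h2 /n3P h3].
pose D : R := (M * n)%:R + 3; have D0 : 0 < D by rewrite /D ltr_wpDl.
pose x : R := n.+1%:R; have x1 : 1 <= x by rewrite ler1n.
have nx : n%:R <= x :> R by rewrite ler_nat.
have Dx : D <= M3 * x.
  rewrite /D natrM /M3 mulrDl lerD //; last by lra.
  by rewrite ler_wpM2l.
have x3 : x <= x ^+ 3 by rewrite -[leLHS]expr1 ler_weXn2l.
exists (n %/ J)%N, (T0 / D); set c := (n %/ J)%N.
have cJ : c%:R * J%:R <= n%:R :> R by rewrite -natrM ler_nat leq_divM.
have cJ' : n%:R <= (c%:R + 1) * J%:R :> R.
  by rewrite natr1 -natrM ler_nat ltnW // ltn_ceil.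
have tau0 : 0 < T0 / D by rewrite divr_gt0.
have expN (z : R) : 2 * M3 / T0 * x <= expR z -> expR (- z) <= T0 / D / 2.
  move=> h; rewrite expRN -[leRHS]invrK lef_pV2 ?posrE ?expR_gt0 //; last first.
    by rewrite invr_gt0 divr_gt0.
  apply: le_trans h; rewrite !invf_div [leLHS](_ : _ = 2 / T0 * D); last by field; rewrite gt_eqF.
  rewrite [leRHS](_ : _ = 2 / T0 * (M3 * x)); last by ring.
  by rewrite ler_wpM2l // divr_ge0 // ltW.
have q0 : 0 <= 2 * M3 / T0 by rewrite divr_ge0 ?mulr_ge0 ?(ltW M30) ?(ltW T00).
split.
- by split=> //; rewrite divfK // gt_eqF.
- apply: expN; have -> : eps * c%:R = (eps * (c%:R + 1)) - eps by ring.
  rewrite expRD expRN -ler_pdivrMr ?invr_gt0 ?expR_gt0 // invrK.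
  have h : expR (eps / J%:R * n%:R) <= expR (eps * (c%:R + 1)).
    rewrite ler_expR -mulrA ler_wpM2l ?(ltW e0) // mulrC ler_pdivrMr //.
  apply: le_trans h; apply: le_trans h2; rewrite -/x mulrAC ler_wpM2l //.
  by apply: mulr_ge0 => //; exact: expR_ge0.
- apply: expN; rewrite mulrBr expRD expRN -ler_pdivrMr ?invr_gt0 ?expR_gt0 // invrK.
  apply: le_trans h3; rewrite -/x mulrAC ler_wpM2l //.
  by apply: mulr_ge0 => //; exact: expR_ge0.
have Sc : (s0%:R : R) ^+ (2 * c + r0) <= expR (eps / 4 * n%:R) * s0%:R ^+ r0.
  rewrite exprD ler_wpM2r ?exprn_ge0 // exprM.
  apply: le_trans (_ : expR (eps * J%:R / 4) ^+ c <= _).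
    by rewrite lerXn2r ?nnegrE ?expR_ge0 // exprn_ge0.
  rewrite -expRM_natl ler_expR [leLHS](_ : _ = eps / 4 * (c%:R * J%:R)); last by ring.
  by rewrite ler_wpM2l // ltW.
have yn : expR (- (eps / 2)) ^+ n = expR (- (eps / 4 * n%:R)) * expR (- (eps / 4 * n%:R)).
  by rewrite -expRM_natl -expRD; congr expR; lra.
set Ex := expR (eps / 4 * n%:R) in h1 Sc.
have Ex0 : 0 < Ex by exact: expR_gt0.
have ExN : expR (- (eps / 4 * n%:R)) = Ex^-1 by rewrite expRN.
have c2 : (2 * c).+1%:R <= 2 * x :> R.
  have cn : (c <= n)%N by exact: leq_div.
  by rewrite /x -natrM ler_nat ltn_pmul2l // ltnS.
have m1 : (M * n).+1%:R <= M3 * x :> R by apply: le_trans Dx; rewrite /D -natr1; lra.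
rewrite yn ExN invf_div.
apply: le_trans (_ : M3 * x * (Ex * s0%:R ^+ r0 * (2 * x * Bv) * (Ex^-1 * Ex^-1)) * (M3 * x / T0) <= _).
  have Ei : 0 <= Ex^-1 by rewrite invr_ge0 ltW.
  apply: ler_pM.
  - by apply: mulr_ge0 => //; apply: mulr_ge0; apply: mulr_ge0 => //; apply: mulr_ge0.
  - by apply: divr_ge0; exact: ltW.
  - apply: ler_pM => //.
      by apply: mulr_ge0; apply: mulr_ge0 => //; apply: mulr_ge0.
    rewrite ler_wpM2r //; first by apply: mulr_ge0.
    by apply: ler_pM => //; [apply: mulr_ge0|rewrite ler_wpM2r].
  - by rewrite ler_wpM2r // invr_ge0 ltW.
rewrite -/x in h1.
rewrite [leLHS](_ : _ = (2 * M3 ^+ 2 * Bv * s0%:R ^+ r0 / T0 * x ^+ 3) * Ex^-1); last first.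
  by field; rewrite !gt_eqF.
rewrite ler_pdivrMr // [leRHS]mulrC -ler_pdivrMr // -/Ex.
by apply: le_trans h1; rewrite le_eqVlt; apply/orP; left; apply/eqP; field; rewrite !gt_eqF.
Qed.

(** * Paths avoiding a ball *)

Section Avoidance.
Variables (R : realType) (G : groupType) (S : seq G) (alpha : eqType) (kap : alpha -> G).
Variables (K : R) (conn : G -> seq (seq alpha)) (Kc : G -> R).
Hypothesis connP : forall g c, c \in conn g -> kword kap c = g.
Hypothesis K_ge0 : 0 <= K.
Hypothesis Kc_ge0 : forall g, 0 <= Kc g.
Hypothesis hS : symmetric_generating S.
Variable delta : R.
Hypothesis delta_gt0 : 0 < delta.
Hypothesis hyp : forall x y z, Num.min (gp R S x y) (gp R S y z) - delta <= gp R S x z.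
Variable w : seq alpha -> R.
Hypothesis w_good : quasi_mult K conn Kc w.
Hypothesis w_fin : forall g, has_sum w (loop kap g).
Variable L : nat.
Hypothesis kap_len : forall a, (word_length S (kap a) <= L)%N.

Local Notation len := (word_length S).
Local Notation gp := (gp R S).
Local Notation kw := (kword kap).
Local Notation V g := (tsum w (loop kap g)).

Let w_ge0 : forall u, 0 <= w u. Proof. by case: w_good. Qed.
Let w_cat : forall u v, w (u ++ v) <= K * (w u * w v). Proof. by case: w_good. Qed.

Definition avoid n p q u := (p * kw u)%g = q /\
  forall i, (i <= size u)%N -> (n < len (p * kw (take i u))%g)%N.

Lemma avoid_loop n p q u : avoid n p q u -> kw u = (p^-1 * q)%g.
Proof. by move=> [<- _]; rewrite mulKg. Qed.

Lemma kw_take_succ u j a0 : (j < size u)%N ->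
  kw (take j.+1 u) = (kw (take j u) * kap (nth a0 u j))%g.
Proof. by move=> ju; rewrite (take_nth a0 ju) -cats1 kword_cat /kword big_seq1. Qed.

Section Crossing.
Variables (F : G -> R) (eps : R) (n : nat) (q : G) (level : R) (Sf : seq (seq alpha)).
Hypothesis eps_gt0 : 0 < eps.
Hypothesis F_step : forall u v, F v <= F u + vis S eps u v.
Hypothesis Sf_drop : forall i t, t \in Sf -> drop i t \in Sf.

(** Words are confined to a finite set closed under suffixes. Then finitely many points are visited,
    the barriers are finite lists, and the recursion from one barrier to the next stays within the
    set. *)
Let z a := tsum w (fun u => u \in Sf /\ avoid n a q u).

Lemma vis_step b a : vis S eps b (b * kap a)%g <= thick eps L (len (b * kap a)%g).
Proof.
rewrite /vis /thick ler_expR lerN2 ler_wpM2l ?(ltW eps_gt0) // gpC //.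
apply: le_trans (gp_ge_len R hS _ _); rewrite lerB // ler_nat.
by rewrite invgM -mulgA -[X in (_ * X)%g](mulKg b) !mulgA mulgVK mulVg mulg1 || rewrite invgM -mulgA mulVg mulg1 (lenV hS).
Qed.

(** The path is cut when [F] first reaches the level. The last step raises [F] by at most its visual
    length, which the thickness of the barrier at the point reached dominates, so that point lies on
    the barrier. *)
Lemma crossing a (Lv : seq G) : F a < level -> level <= F q ->
  (forall t j, t \in Sf -> let b := (q * (kw (drop j t))^-1)%g in
     (n < len b)%N -> level <= F b < level + thick eps L (len b) -> b \in Lv) ->
  z a <= K * \sum_(b <- Lv) V (a^-1 * b)%g * z b.
Proof.
move=> Fa Fq LvP.
have := @tsum_split R alpha w w_ge0 G Lv (fun u => u \in Sf /\ avoid n a q u)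
  (fun b => loop kap (a^-1 * b)%g) (fun b u => u \in Sf /\ avoid n b q u) K K_ge0 w_cat.
case=> [t [tS [tq tn]]|b _|b _|//]; last 2 first.
- exact: w_fin.
- by apply: (@has_sum_loop R G alpha kap w w_fin (b^-1 * q)%g) => u [_ /avoid_loop].
pose Q j := level <= F (a * kw (take j t))%g.
have ex : exists j, (j <= size t)%N && Q j by exists (size t); rewrite leqnn /Q take_size tq.
case: (ex_minnP ex) => j /andP[jt Qj] jmin.
have j0 : (0 < j)%N.
  by rewrite lt0n; apply/eqP => j0; move: Qj; rewrite /Q j0 take0 kword_nil mulg1 leNgt Fa.
case: j j0 jt Qj jmin => [//|j] _ jt Qj jmin.
have nQ : F (a * kw (take j t))%g < level.
  rewrite ltNge; apply/negP => Qj'; have := jmin j; rewrite (ltnW jt) /Q Qj' => /(_ isT).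
  by rewrite ltnn.
pose b := (a * kw (take j.+1 t))%g.
have [a0 _] : exists a0 : alpha, True by move: (jt); case: (t) => [//|a0 l _]; exists a0.
have bE : b = (a * kw (take j t) * kap (nth a0 t j))%g.
  by rewrite /b (kw_take_succ a0 jt) mulgA.
have bq : (b * kw (drop j.+1 t))%g = q by rewrite /b -mulgA -kword_cat cat_take_drop.
exists b, (take j.+1 t), (drop j.+1 t); rewrite cat_take_drop; split=> //.
- have -> : b = (q * (kw (drop j.+1 t))^-1)%g by rewrite -bq mulgK.
  apply: LvP => //; rewrite /= -bq mulgK; first exact: tn.
  apply/andP; split; first exact: Qj.
  apply: le_lt_trans (F_step (a * kw (take j t))%g b) _.
  by rewrite bE; apply: ltr_leD => //; exact: vis_step.
- by rewrite /loop mulKg.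
- split; [exact: Sf_drop|split=> // i]; rewrite size_drop => ij.
  rewrite -mulgA -kword_cat; have -> : take j.+1 t ++ take i (drop j.+1 t) = take (j.+1 + i) t.
    by rewrite takeD.
  by apply: tn; rewrite -leq_subRL.
Qed.

End Crossing.

Lemma avoid_small B c1 Lam : (forall k, \sum_(g <- sphere S k) V g ^+ 2 <= B) -> 0 < Lam ->
  exists n0 : nat, forall n p q, (n0 <= n)%N -> gp p q <= c1 ->
    tsum w (avoid n p q) <= Lam ^+ n.
Proof.
move=> sphere_sq Lam0; have d0 := delta_gt0.
have B0 : 0 <= B.
  by apply: le_trans (sphere_sq 0%N); rewrite sumr_ge0 // => g _; exact: sqr_ge0.
have K1 : 1 <= K by have := w_cat [::] [::]; case: w_good => _ -> _ _; rewrite !mulr1.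
(* The largest exponent allowed by [frink]: exp(2 eps delta) = 2. *)
pose eps := ln (2 : R) / (2 * delta).
have eps0 : 0 < eps by rewrite divr_gt0 ?ln_gt0 ?ltr1n //; lra.
have epsd : expR (2 * eps * delta) <= 2.
  rewrite (_ : 2 * eps * delta = ln 2) ?lnK ?posrE // /eps; field.
  by rewrite gt_eqF.
pose y := expR (- (eps / 2)).
have y1 : 0 < 1 - y by rewrite subr_gt0 /y expR_lt1; lra.
(* A lower bound for the chain distance from [p] to [q], half of the visual one; the barriers are
   placed below this value. *)
pose T0 := expR (- (eps * c1)) / 2.
have T00 : 0 < T0 by rewrite divr_gt0 ?expR_gt0.
have [M M0 MP] : exists2 M : nat, (0 < M)%N & (2^-1 : R) ^+ M <= Lam.
  have [M0 M0P] := nat_above Lam^-1; pose M := M0.+1; exists M => //.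
  have MP : Lam^-1 <= M%:R by apply: le_trans M0P _; rewrite ler_nat.
  rewrite -[leRHS]invrK exprVn lef_pV2 ?posrE ?invr_gt0 ?exprn_gt0 //.
  by apply: le_trans MP _; rewrite -natrX ler_nat ltnW // ltn_expl.
have [r0 r0P] := nat_above (2 * delta).
pose Bv := B * (expR (eps * L%:R) / (1 - y) ^+ 2).
have Bv0 : 0 <= Bv.
  by apply: mulr_ge0 => //; rewrite divr_ge0 ?expR_ge0 // exprn_ge0 // ltW.
have K20 : 0 < K ^+ 2 by rewrite exprn_gt0 //; lra.
(* Half of the bound 1 / (4 K^2) required by [barrier_product]; the other half is the error term of
   [choose_levels]. *)
pose Th : R := 8^-1 / K ^+ 2.
have Th0 : 0 < Th by rewrite divr_gt0 // invr_gt0.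
have [n0 n0P] := @level_asymptotics R eps T0 Bv Th L M (size S).+1 r0 eps0 T00 Bv0 Th0 isT.
have [n1 n1P] := nat_above c1.
exists (maxn n0 (maxn n1 1)) => n p q; rewrite !geq_max => /and3P[/n0P nP n1n n0n] pq.
have c1n : c1 <= n%:R by apply: le_trans n1P _; rewrite ler_nat.
have [c [tau [[tau0 tauT] tc tn HS]]] := nP.
apply: tsum_le => Wd uWd WdP.
case: (eqVneq Wd [::]) => [->|Wd0]; first by rewrite big_nil exprn_ge0 // ltW.
have [u0 u0W] : exists u0, u0 \in Wd by case: (Wd) Wd0 => [//|u0 l _]; exists u0; rewrite mem_head.
have [pu0 pn] := WdP u0 u0W.
have np : (n < len p)%N by have := pn 0%N isT; rewrite take0 kword_nil mulg1.
have qp : q != p.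
  apply/eqP => e; move: pq (gp_ge_len R hS p q); rewrite e mulVg (len1 S) => h1 h2.
  have : (n%:R : R) < (len p)%:R by rewrite ltr_nat.
  lra.
pose m := (M * n)%N.
apply: le_trans (_ : (2^-1 : R) ^+ m <= _); last first.
  by rewrite /m exprM lerXn2r ?nnegrE ?exprn_ge0 ?invr_ge0 // ltW.
pose F := chain_dist S eps p.
have Fp : F p <= 0 by exact: chain_dist_refl.
have Fq : T0 <= F q.
  apply: le_trans (vis_chain_dist delta_gt0 hyp eps0 epsd qp).
  by rewrite /T0 ler_wpM2r // ler_expR lerN2 ler_wpM2l // ltW.
have F_step u v : F v <= F u + vis S eps u v by exact: chain_dist_step.
pose Sf := flatten [seq [seq drop i u | i <- iota 0 (size u).+1] | u <- Wd].
have inSf t : reflect (exists u i, u \in Wd /\ t = drop i u) (t \in Sf).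
  apply: (iffP idP) => [/flattenP[_ /mapP[u uW ->] /mapP[i _ ->]]|[u [i [uW ->]]]].
    by exists u, i.
  apply/flattenP; exists [seq drop i u | i <- iota 0 (size u).+1]; first exact: map_f.
  apply/mapP; have [iu|ui] := leqP i (size u); first by exists i; rewrite // mem_iota.
  by exists (size u); [rewrite mem_iota /= add0n|rewrite drop_size drop_oversize // ltnW].
have Sf_drop i t : t \in Sf -> drop i t \in Sf.
  by move=> /inSf[u [j [uW ->]]]; apply/inSf; exists u, (i + j)%N; rewrite drop_drop.
pose X := undup [seq (q * (kw t)^-1)%g | t <- Sf].
have uX : uniq X by exact: undup_uniq.
pose z a := tsum w (fun u => u \in Sf /\ avoid n a q u).
have z_sum a : has_sum w (fun u => u \in Sf /\ avoid n a q u).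
  by apply: (@has_sum_loop R G alpha kap w w_fin (a^-1 * q)%g) => u [_ /avoid_loop].
apply: le_trans (_ : z p <= _).
  apply: sum_le_tsum => // u uW; split; last exact: WdP.
  by apply/inSf; exists u, 0%N; rewrite drop0.
have m_gt0 : (0 < m)%N by rewrite /m muln_gt0 M0 n0n.
pose r := (2 * c + r0)%N.
have cr : (2 * c)%:R + 2 * delta <= r%:R by rewrite /r natrD lerD2l.
have th_n k : (n < k)%N -> thick eps L k <= tau / 2.
  by move=> nk; apply: le_trans tn; exact: (@thick_le R eps L eps0 k n (ltnW nk)).
have lev_ub t i a : 0 <= t < tau -> (i <= m)%N -> a \in level_set S eps L F X m n tau p q t i ->
    F a <= t + i%:R * tau + tau / 2.
  move=> /andP[t0 tt] im; rewrite /level_set; case: eqP => [-> | _].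
    by rewrite inE => /eqP ->; lra.
  rewrite ltn_eqF // mem_filter => /andP[/andP[na /andP[_ h]] _].
  by have := th_n _ na; lra.
have lev_lb t i b : 0 <= t < tau -> (i <= m)%N -> b \in level_set S eps L F X m n tau p q t i.+1 ->
    t + i%:R * tau + tau <= F b.
  move=> /andP[t0 tt] im; rewrite /level_set /= eqSS; case: (i =P m) => [-> | /eqP im'].
    rewrite inE => /eqP ->; apply: le_trans Fq; rewrite -tauT -/m; lra.
  rewrite mem_filter => /andP[/andP[_ /andP[h _]] _].
  by move: h; rewrite -natr1; lra.
(* Between successive levels [F] grows by at least tau minus the thickness tau / 2, so the visual
   size of the pair is at least tau / 2 >= exp(- eps c). *)
have Hgp t i a b : 0 <= t < tau -> (i <= m)%N -> a \in level_set S eps L F X m n tau p q t i ->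
    b \in level_set S eps L F X m n tau p q t i.+1 -> gp a b <= c%:R.
  move=> tt im aL bL; have ha := lev_ub t i a tt im aL; have hb := lev_lb t i b tt im bL.
  have hab := F_step a b.
  have : expR (- (eps * c%:R)) <= vis S eps a b by lra.
  by rewrite ler_expR lerN2 ler_pM2l.
have th8 : 0 < Th by [].
have [t tt hs] := choose_levels hS delta_gt0 hyp eps0 sphere_sq uX tau0 m_gt0 cr B0 Hgp th8.
pose Lv i := level_set S eps L F X m n tau p q t i.
have hsT i : (i <= m)%N -> \sum_(a <- Lv i) \sum_(b <- Lv i.+1) V (a^-1 * b)%g ^+ 2 <= 4^-1 / K ^+ 2.
  move=> im; apply: le_trans (hs i im) _.
  have hS2 : (size (wball S r))%:R <= ((size S).+1%:R : R) ^+ (2 * c + r0).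
    by rewrite -natrX ler_nat size_wball.
  have -> : 4^-1 / K ^+ 2 = Th + Th by rewrite /Th; field; rewrite gt_eqF //; lra.
  rewrite lerD2r; apply: le_trans HS; rewrite ler_wpM2r ?invr_ge0 ?(ltW tau0) //.
  rewrite ler_wpM2l // ler_wpM2r ?exprn_ge0 ?expR_ge0 //.
  have -> : barrier_const S eps L B c r = (size (wball S r))%:R * ((2 * c).+1%:R * Bv).
    by rewrite /barrier_const /vis_bound /Bv /y; ring.
  by apply: ler_wpM2r => //; exact: mulr_ge0.
have V0 g : 0 <= V g by exact: tsum_ge0.
have z0 a : 0 <= z a by exact: tsum_ge0.
have bp := @barrier_product R G (fun g => V g) Lv z K m K_ge0 z0 V0.
have hp : \sum_(a <- Lv 0%N) z a ^+ 2 = z p ^+ 2 by rewrite /Lv /level_set eqxx big_seq1.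
(* On the last barrier z(a) is at most V(a^-1 q), so the sum is one more Hilbert-Schmidt sum, the
   level m + 1 being [q] alone. *)
have last : \sum_(a <- Lv m) z a ^+ 2 <= 1.
  apply: le_trans (_ : \sum_(a <- Lv m) \sum_(b <- Lv m.+1) V (a^-1 * b)%g ^+ 2 <= _); last first.
    apply: le_trans (hsT m (leqnn m)) _; rewrite ler_pdivrMr // mul1r.
    have : 1 <= K ^+ 2 by rewrite exprn_ege1.
    lra.
  apply: ler_sum => a _; rewrite /Lv /level_set /= eqxx big_seq1.
  by rewrite lerXn2r ?nnegrE //; apply: tsumS => // u [_ /avoid_loop].
have zp2 : z p ^+ 2 <= (4^-1 : R) ^+ m.
  rewrite -hp; apply: le_trans (bp _ _) _.
  - move=> i im a aL; have ha := lev_ub t i a tt (ltnW im) aL.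
    apply: (@crossing F eps n q (t + i.+1%:R * tau) Sf eps0 F_step Sf_drop a (Lv i.+1)).
    + by rewrite -natr1; lra.
    + apply: le_trans Fq; rewrite -tauT -/m -natr1.
      have : (i%:R : R) * tau <= m%:R * tau by rewrite ler_wpM2r ?(ltW tau0) // ler_nat ltnW.
      by case/andP: tt; lra.
    + move=> t' j t'S b nb lb; rewrite /Lv /level_set /= eqSS ltn_eqF //.
      rewrite mem_filter /barrier nb lb /= mem_undup; apply/mapP; exists (drop j t') => //.
      exact: Sf_drop.
  - move=> i im; have := hsT i (ltnW im); rewrite ler_pdivlMr // mulrC //.
  - by rewrite ler_piMr // exprn_ge0 // invr_ge0.
rewrite -ler_sqr ?nnegrE // ?exprn_ge0 ?invr_ge0 //.
apply: le_trans zp2 _; rewrite -exprM mulnC exprM.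
by rewrite le_eqVlt; apply/orP; left; apply/eqP; congr (_ ^+ _); rewrite expr2; lra.
Qed.

End Avoidance.

(** * Gates *)

Section Gates.
Variables (R : realType) (G : groupType) (alpha : eqType) (kap : alpha -> G).
Variables (K : R) (conn : G -> seq (seq alpha)) (Kc : G -> R).
Hypothesis connP : forall g c, c \in conn g -> kword kap c = g.
Hypothesis K_ge0 : 0 <= K.
Hypothesis Kc_ge0 : forall g, 0 <= Kc g.
Variable w : seq alpha -> R.
Hypothesis w_good : quasi_mult K conn Kc w.
Hypothesis w_fin : forall g, has_sum w (loop kap g).

Local Notation kw := (kword kap).
Local Notation V g := (tsum w (loop kap g)).
Local Notation J1 := (Jc conn Kc 1%g).
Implicit Types (p q : G) (u t : seq alpha) (X Y : seq G).

Let w_ge0 : forall u, 0 <= w u. Proof. by case: w_good. Qed.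
Let w_cat : forall u v, w (u ++ v) <= K * (w u * w v). Proof. by case: w_good. Qed.
Let w_conn : forall g u v, w u * w v <= Kc g * \sum_(c <- conn g) w (u ++ c ++ v).
Proof. by case: w_good. Qed.

Definition passes X Y p u := exists i j, [/\ (i <= j <= size u)%N,
  (p * kw (take i u))%g \in X & (p * kw (take j u))%g \in Y].

Definition first_entry X p v u := [/\ (p * kw u)%g = v, v \in X &
  forall i, (i < size u)%N -> (p * kw (take i u))%g \notin X].

Definition last_exit Y v q u := [/\ (v * kw u)%g = q, v \in Y &
  forall i, (0 < i <= size u)%N -> (v * kw (take i u))%g \notin Y].

Lemma first_entry_loop X p v u : first_entry X p v u -> kw u = (p^-1 * v)%g.
Proof. by move=> [<- _ _]; rewrite mulKg. Qed.

Lemma last_exit_loop Y v q u : last_exit Y v q u -> kw u = (v^-1 * q)%g.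
Proof. by move=> [<- _ _]; rewrite mulKg. Qed.

(** The first entry into [X] marks the cut, so joining first entry words with words leading on to
    [y] is injective. *)
Lemma first_entry_sum X p y : uniq X ->
  \sum_(v <- X) tsum w (first_entry X p v) * V (v^-1 * y)%g <= J1 * V (p^-1 * y)%g.
Proof.
move=> uX; apply: (@tsum_join R alpha w w_ge0 G X (loop kap (p^-1 * y)%g)
  (fun v => first_entry X p v) (fun v => loop kap (v^-1 * y)%g) (conn 1%g) (Kc 1%g)) => //.
- move=> c v u t /connP c1 vX [uv _ _] tv.
  by rewrite /loop !kword_cat c1 tv mul1g -uv invgM -mulgA mulVKg.
- move=> c v v' u u' t t' cC vX [uv _ um] tv v'X [uv' _ um'] tv' e.
  have lt (a b x z : seq alpha) : (p * kw a)%g \in X ->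
      (forall i, (i < size b)%N -> (p * kw (take i b))%g \notin X) ->
      a ++ x = b ++ z -> ~~ (size a < size b)%N.
    move=> aX bm ab; apply/negP => h; have := bm _ h.
    have -> : take (size a) b = take (size a) (b ++ z) by rewrite take_cat h.
    by rewrite -ab take_size_cat // aX.
  have uu : u = u'.
    apply: (cat_size_inj e); apply/eqP; rewrite eqn_leq; apply/andP; split; rewrite leqNgt.
      by apply: lt um (esym e); rewrite uv'.
    by apply: lt um' e; rewrite uv.
  by split=> //; rewrite -uv -uv' uu.
Qed.

(** The connecting word has value 1, so the path is in [Y] again right after it. Two different cuts
    of one word would place the later of these visits after the last exit belonging to the earlier
    cut. *)
Lemma last_exit_sum Y y q : uniq Y ->
  \sum_(v <- Y) V (y^-1 * v)%g * tsum w (last_exit Y v q) <= J1 * V (y^-1 * q)%g.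
Proof.
move=> uY; apply: (@tsum_join R alpha w w_ge0 G Y (loop kap (y^-1 * q)%g)
  (fun v => loop kap (y^-1 * v)%g) (fun v => last_exit Y v q) (conn 1%g) (Kc 1%g)) => //.
- move=> c v u t /connP c1 vY uv [tv _ _].
  by rewrite /loop !kword_cat c1 uv mul1g -tv !mulgA.
- move=> c v v' u u' t t' /connP c1 vY uv [tq _ tm] v'Y uv' [tq' _ tm'] e.
  have lt (a b x z : seq alpha) (va vb : G) : loop kap (y^-1 * va)%g a -> loop kap (y^-1 * vb)%g b ->
      vb \in Y -> (forall i, (0 < i <= size x)%N -> (va * kw (take i x))%g \notin Y) ->
      a ++ c ++ x = b ++ c ++ z -> ~~ (size a < size b)%N.
    move=> la lb bY xm ab; apply/negP => h.
    have sz := congr1 size ab; rewrite !size_cat in sz.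
    have := xm (size b - size a)%N; rewrite subn_gt0 h /=.
    have -> : (size b - size a <= size x)%N by clear -sz h; lia.
    move=> /(_ isT); suff -> : (va * kw (take (size b - size a) x))%g = vb by rewrite bY.
    have e1 : take (size b + size c) (a ++ c ++ x) = a ++ c ++ take (size b - size a) x.
      rewrite !catA take_cat size_cat ltnNge leq_add2r (ltnW h) /=.
      by congr (_ ++ take _ _); clear; lia.
    have e2 : take (size b + size c) (b ++ c ++ z) = b ++ c.
      by rewrite catA take_size_cat // size_cat.
    have := congr1 kw e1; rewrite ab e2 !kword_cat c1 mul1g mulg1 la lb -mulgA => /mulgI ->.
    by [].
  have uu : u = u'.
    apply: (cat_size_inj e); apply/eqP; rewrite eqn_leq; apply/andP; split; rewrite leqNgt.
      exact: lt uv' uv vY tm' (esym e).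
    exact: lt uv uv' v'Y tm e.
  by split=> //; move: uv uv'; rewrite uu /loop => -> /mulgI.
Qed.

(** A word is cut at its first visit to [X] and at its last visit to [Y]. The middle piece inherits
    [bad] and is bounded by [small], whose right side splits at [y]; the outer pieces are
    reassembled by [first_entry_sum] and [last_exit_sum]. *)
Lemma gate_bound X Y (bad : G -> seq alpha -> Prop) p q y e : uniq X -> uniq Y -> 0 <= e ->
  (forall a b c v, bad v (a ++ b ++ c) -> bad (v * kw a)%g b) ->
  (forall v v', v \in X -> v' \in Y ->
    tsum w (fun u => (v * kw u)%g = v' /\ bad v u) <= e * (V (v^-1 * y)%g * V (y^-1 * v')%g)) ->
  tsum w (fun u => [/\ (p * kw u)%g = q, passes X Y p u & bad p u]) <=
  K ^+ 2 * J1 ^+ 2 * e * (V (p^-1 * y)%g * V (y^-1 * q)%g).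
Proof.
move=> uX uY e0 bad_sub small.
have V0 g : 0 <= V g by exact: tsum_ge0.
pose Z v v' u := (v * kw u)%g = v' /\ bad v u.
pose Rest v u := [/\ (v * kw u)%g = q, bad v u & exists2 j, (j <= size u)%N & (v * kw (take j u))%g \in Y].
have hsZ v v' : has_sum w (Z v v').
  by apply: (@has_sum_loop R G alpha kap w w_fin (v^-1 * v')%g) => u [<- _]; rewrite mulKg.
have hsR v : has_sum w (Rest v).
  by apply: (@has_sum_loop R G alpha kap w w_fin (v^-1 * q)%g) => u [<- _]; rewrite mulKg.
have hsF v : has_sum w (first_entry X p v).
  by apply: (@has_sum_loop R G alpha kap w w_fin (p^-1 * v)%g) => u /first_entry_loop.
have hsL v : has_sum w (last_exit Y v q).
  by apply: (@has_sum_loop R G alpha kap w w_fin (v^-1 * q)%g) => u /last_exit_loop.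
pose Q0 u := [/\ (p * kw u)%g = q, passes X Y p u & bad p u].
have step1 : tsum w Q0 <=
    K * \sum_(v <- X) tsum w (first_entry X p v) * tsum w (Rest v).
  have := @tsum_split R alpha w w_ge0 G X Q0 (fun v => first_entry X p v) Rest K K_ge0 w_cat.
  case=> [u [uq [i [j [/andP[ij ju] iX jY]]] ub]|v _|v _|_]; last 3 first.
  - exact: hsF.
  - exact: hsR.
  - exact.
  have ex : exists i, (i <= size u)%N && ((p * kw (take i u))%g \in X).
    by exists i; rewrite (leq_trans ij ju).
  case: (ex_minnP ex) => i0 /andP[i0u i0X] imin.
  have i0j : (i0 <= j)%N by apply: leq_trans (ij); apply: imin; rewrite iX (leq_trans ij ju).
  exists (p * kw (take i0 u))%g, (take i0 u), (drop i0 u); rewrite cat_take_drop; split=> //.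
    split=> // i'; rewrite size_takel // => i'0; rewrite (take_takel _ (ltnW i'0)).
    apply/negP => h; have := imin i'; rewrite h (leq_trans (ltnW i'0) i0u) leqNgt i'0.
    by move=> /(_ isT).
  split.
  - by rewrite -mulgA -kword_cat cat_take_drop.
  - by apply: (bad_sub _ _ [::]); rewrite cats0 cat_take_drop.
  - exists (j - i0)%N; first by rewrite size_drop leq_sub2r.
    by rewrite -mulgA -kword_cat -takeD subnKC.
have step2 v : tsum w (Rest v) <= K * \sum_(v' <- Y) tsum w (Z v v') * tsum w (last_exit Y v' q).
  have := @tsum_split R alpha w w_ge0 G Y (Rest v) (Z v) (fun v' => last_exit Y v' q) K K_ge0 w_cat.
  case=> [u [uq ub [j ju jY]]|v' _|v' _|_]; last 3 first.
  - exact: hsZ.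
  - exact: hsL.
  - exact.
  pose P j := (j <= size u)%N && ((v * kw (take j u))%g \in Y).
  have ex : exists j, P j by exists j; rewrite /P ju.
  have ub' j' : P j' -> (j' <= size u)%N by case/andP.
  case: (ex_maxnP ex ub') => j0 /andP[j0u j0Y] jmax.
  exists (v * kw (take j0 u))%g, (take j0 u), (drop j0 u); rewrite cat_take_drop; split=> //.
    by split=> //; rewrite -[v]mulg1 -(kword_nil kap); apply: (bad_sub [::] _ (drop j0 u)); rewrite /= cat_take_drop.
  split=> //; first by rewrite -mulgA -kword_cat cat_take_drop.
  move=> i /andP[i0]; rewrite size_drop => iu; apply/negP.
  rewrite -mulgA -kword_cat -takeD => h.
  have := jmax (j0 + i)%N; rewrite /P h andbT -leq_subRL // iu => /(_ isT).
  by rewrite -{2}[j0]addn0 leq_add2l leqNgt i0.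
apply: le_trans step1 _.
apply: le_trans (_ : K * \sum_(v <- X) tsum w (first_entry X p v) *
   (K * (e * V (v^-1 * y)%g * (J1 * V (y^-1 * q)%g))) <= _).
  rewrite ler_wpM2l // big_seq [leRHS]big_seq; apply: ler_sum => v vX.
  rewrite ler_wpM2l ?tsum_ge0 //; apply: le_trans (step2 v) _; rewrite ler_wpM2l //.
  apply: le_trans (_ : \sum_(v' <- Y) e * V (v^-1 * y)%g * (V (y^-1 * v')%g * tsum w (last_exit Y v' q)) <= _).
    rewrite big_seq [leRHS]big_seq; apply: ler_sum => v' v'Y.
    by rewrite !mulrA ler_wpM2r ?tsum_ge0 // -mulrA small.
  by rewrite -mulr_sumr ler_wpM2l ?mulr_ge0 // last_exit_sum.
have -> : \sum_(v <- X) tsum w (first_entry X p v) * (K * (e * V (v^-1 * y)%g * (J1 * V (y^-1 * q)%g))) =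
    (K * e * J1 * V (y^-1 * q)%g) * \sum_(v <- X) tsum w (first_entry X p v) * V (v^-1 * y)%g.
  by rewrite mulr_sumr; apply: eq_bigr => v _; ring.
have C0 : 0 <= K * (K * e * J1 * V (y^-1 * q)%g) by do ?apply: mulr_ge0.
rewrite mulrA; apply: le_trans (ler_wpM2l C0 (first_entry_sum p y uX)) _.
by rewrite le_eqVlt; apply/orP; left; apply/eqP; ring.
Qed.

(** Words are sorted by the least k for which they pass the gates of index k. For k > 0 they fail to
    pass the gates of index k - 1, a property that subwords inherit. *)
Lemma gates_bound (Xs Ys : nat -> seq G) (e : nat -> R) p q y N :
  (forall k, uniq (Xs k)) -> (forall k, uniq (Ys k)) -> (forall k, 0 <= e k) ->
  p \in Xs N -> q \in Ys N ->
  (forall v v', v \in Xs 0%N -> v' \in Ys 0%N ->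
    V (v^-1 * v')%g <= e 0%N * (V (v^-1 * y)%g * V (y^-1 * v')%g)) ->
  (forall k v v', v \in Xs k.+1 -> v' \in Ys k.+1 ->
    tsum w (fun u => (v * kw u)%g = v' /\ ~ passes (Xs k) (Ys k) v u) <=
    e k.+1 * (V (v^-1 * y)%g * V (y^-1 * v')%g)) ->
  V (p^-1 * q)%g <= K ^+ 2 * J1 ^+ 2 * (\sum_(k < N.+1) e k) * (V (p^-1 * y)%g * V (y^-1 * q)%g).
Proof.
move=> uX uY e0 pX qY small0 smallS.
pose bad k v u := if k is k'.+1 then ~ passes (Xs k') (Ys k') v u else True.
pose A k u := [/\ (p * kw u)%g = q, passes (Xs k) (Ys k) p u & bad k p u].
have hsA k : has_sum w (A k).
  by apply: (@has_sum_loop R G alpha kap w w_fin (p^-1 * q)%g) => u [<- _]; rewrite mulKg.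
have cover u : loop kap (p^-1 * q)%g u -> exists2 k, (k < N.+1)%N & A k u.
  move=> uq; have uq' : (p * kw u)%g = q by rewrite uq mulVKg.
  have ex : exists k, `[< passes (Xs k) (Ys k) p u >].
    exists N; apply/asboolP; exists 0%N, (size u); rewrite leqnn take0 kword_nil mulg1.
    by rewrite take_size uq'.
  case: (ex_minnP ex) => k /asboolP kp kmin; exists k.
    rewrite ltnS; apply: kmin; apply/asboolP; exists 0%N, (size u).
    by rewrite leqnn take0 kword_nil mulg1 take_size uq'.
  split=> //; case: k kmin {kp} => [//|k] kmin /= h.
  by have := kmin k (asboolT h); rewrite ltnn.
apply: le_trans (tsum_cover cover hsA) _.
rewrite mulr_sumr mulr_suml; apply: ler_sum => -[k kN] _ /=.
apply: gate_bound => //.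
- move=> a b c v; case: k {kN} => [//|k] /= h [i [j [/andP[ij jb] iX jY]]]; apply: h.
  exists (size a + i)%N, (size a + j)%N; split.
  + by rewrite leq_add2l ij !size_cat leq_add2l (leq_trans jb) // leq_addr.
  + have -> : take (size a + i) (a ++ b ++ c) = a ++ take i b.
      by rewrite takeD take_size_cat // drop_size_cat // takel_cat // (leq_trans ij jb).
    by rewrite kword_cat mulgA.
  + have -> : take (size a + j) (a ++ b ++ c) = a ++ take j b.
      by rewrite takeD take_size_cat // drop_size_cat // takel_cat.
    by rewrite kword_cat mulgA.
- case: k {kN} => [|k] v v' vX vY /=; last exact: smallS.
  apply: le_trans (small0 v v' vX vY); apply: tsumS => // u [<- _].
  by rewrite /loop mulKg.
Qed.

End Gates.

(** * The upper bound for weights *)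

Section Geodesics.
Variables (G : groupType) (S : seq G).
Hypothesis hS : symmetric_generating S.
Local Notation len := (word_length S).

Lemma wall_mem (c v : G) n : (v \in [seq (c * g)%g | g <- wball S n]) = (len (c^-1 * v)%g <= n)%N.
Proof.
apply/mapP/idP => [[g gb ->]|h]; first by rewrite mulKg -mem_wball.
by exists (c^-1 * v)%g; rewrite ?mem_wball // mulVKg.
Qed.

Variables (pt : nat -> G) (N s : nat).
Hypothesis pt_dist : forall i j, (i <= j <= N)%N -> len ((pt i)^-1 * pt j)%g = (j - i)%N.
Hypothesis sN : (s <= N)%N.

(** Where the geodesic is too short the gate shrinks to its end point. Otherwise the gates of radii
    r and 2 r have centres 8 r apart, which leaves the margin needed in [gate_gp]. *)
Definition left_gate r := if (s <= 8 * r)%N then [:: pt 0] else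
  [seq (pt (s - 8 * r)%N * g)%g | g <- wball S r].
Definition right_gate r := if (N - s <= 8 * r)%N then [:: pt N] else
  [seq (pt (s + 8 * r)%N * g)%g | g <- wball S r].

Lemma left_gate_uniq r : uniq (left_gate r).
Proof.
rewrite /left_gate; case: ifP => // _.
by rewrite map_inj_uniq ?wball_uniq //; exact: mulgI.
Qed.

Lemma right_gate_uniq r : uniq (right_gate r).
Proof.
rewrite /right_gate; case: ifP => // _.
by rewrite map_inj_uniq ?wball_uniq //; exact: mulgI.
Qed.

Lemma left_gate_dist r v : v \in left_gate r -> (len (v^-1 * pt s)%g <= 9 * r)%N.
Proof.
rewrite /left_gate; case: leqP => h.
  by rewrite inE => /eqP ->; rewrite pt_dist ?leq0n // subn0; lia.
rewrite wall_mem => hv; have := len_tri hS v (pt s) (pt (s - 8 * r)%N).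
rewrite (lenC hS v (pt (s - 8 * r)%N)) (pt_dist (i := (s - 8 * r)%N)) ?leq_subr // => ht.
by apply: leq_trans ht _; rewrite subKn ?(ltnW h) //; move: hv; clear; lia.
Qed.

Lemma right_gate_dist r v : v \in right_gate r -> (len ((pt s)^-1 * v)%g <= 9 * r)%N.
Proof.
rewrite /right_gate; case: leqP => h.
  by rewrite inE => /eqP ->; rewrite pt_dist ?sN ?leqnn //; lia.
rewrite wall_mem => hv; have := len_tri hS (pt s) v (pt (s + 8 * r)%N).
by rewrite (pt_dist (i := s)); lia.
Qed.

Lemma left_gate_near r v : v \in left_gate r ->
  (len ((pt (s - 8 * r))^-1 * v)%g <= if s <= 8 * r then 0 else r)%N.
Proof.
rewrite /left_gate; case: leqP => h; last by rewrite wall_mem.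
have -> : (s - 8 * r = 0)%N by apply/eqP; rewrite subn_eq0.
by rewrite inE => /eqP ->; rewrite mulVg (len1 S).
Qed.

Lemma right_gate_near r v : v \in right_gate r ->
  (len ((pt (minn N (s + 8 * r)))^-1 * v)%g <= if N - s <= 8 * r then 0 else r)%N.
Proof.
rewrite /right_gate; case: leqP => h.
  rewrite (minn_idPl _); last by rewrite -leq_subLR.
  by rewrite inE => /eqP ->; rewrite mulVg (len1 S).
rewrite (minn_idPr _); first by rewrite wall_mem.
by rewrite -leq_subRL // ltnW.
Qed.

Lemma left_gate_far r v : (8 * r < s)%N -> v \notin left_gate r ->
  (r < len ((pt (s - 8 * r))^-1 * v)%g)%N.
Proof. by rewrite /left_gate ltnNge => /negbTE ->; rewrite wall_mem -ltnNge. Qed.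

Lemma right_gate_far r v : (8 * r < N - s)%N -> v \notin right_gate r ->
  (r < len ((pt (s + 8 * r))^-1 * v)%g)%N.
Proof. by rewrite /right_gate ltnNge => /negbTE ->; rewrite wall_mem -ltnNge. Qed.

Variables (R : realType) (delta : R).
Hypothesis delta_gt0 : 0 < delta.
Hypothesis hyp : forall x y z, Num.min (gp R S x y) (gp R S y z) - delta <= gp R S x z.

(** Seen from [pt c], the points [pt a] and [pt b] have Gromov product 0. Being close to them with
    margin T, [v] and [v'] lie in the same opposite directions; two uses of hyperbolicity compare
    the products. *)
Lemma gate_gp a c b v v' T : (a <= c <= b)%N -> (b <= N)%N -> 2 * delta < T%:R ->
  (T + len ((pt a)^-1 * v)%g <= c - a)%N -> (T + len ((pt b)^-1 * v')%g <= b - c)%N ->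
  gp R S ((pt c)^-1 * v)%g ((pt c)^-1 * v')%g <= 2 * delta.
Proof.
move=> /andP[ac cb] bN dT va vb; have d0 := delta_gt0.
have aN := leq_trans ac (leq_trans cb bN); have cN := leq_trans cb bN.
have cancel (x y z : G) : ((x^-1 * y)^-1 * (x^-1 * z) = y^-1 * z)%g.
  by rewrite invgM invgK -mulgA mulVKg.
pose xa := ((pt c)^-1 * pt a)%g; pose zb := ((pt c)^-1 * pt b)%g.
have dxa : len xa = (c - a)%N by rewrite /xa lenC // pt_dist // ac.
have dzb : len zb = (b - c)%N by rewrite /zb pt_dist // cb.
have ab0 : gp R S xa zb = 0.
  rewrite /gp cancel dxa dzb pt_dist ?(leq_trans ac cb) // !natrB //; last exact: leq_trans ac cb.
  by rewrite (_ : _ - _ = 0) ?mul0r //; lra.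
have hv : 2 * delta < gp R S xa ((pt c)^-1 * v)%g.
  apply: lt_le_trans (gp_ge_len R hS _ _); rewrite cancel dxa.
  apply: lt_le_trans dT _; rewrite lerBrDr -natrD ler_nat //.
have hv' : 2 * delta < gp R S ((pt c)^-1 * v')%g zb.
  rewrite gpC //; apply: lt_le_trans (gp_ge_len R hS _ _); rewrite cancel dzb.
  by apply: lt_le_trans dT _; rewrite lerBrDr -natrD ler_nat.
rewrite leNgt; apply/negP => h.
have h1 : 2 * delta - delta < gp R S xa ((pt c)^-1 * v')%g.
  apply: lt_le_trans (hyp xa ((pt c)^-1 * v)%g ((pt c)^-1 * v')%g).
  by rewrite ltrD2r lt_min hv h.
have : delta - delta < gp R S xa zb.
  apply: lt_le_trans (hyp xa ((pt c)^-1 * v')%g zb).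
  by rewrite ltrD2r lt_min; apply/andP; split; lra.
by rewrite ab0; lra.
Qed.

End Geodesics.

(** * Dyadic scales and the upper bound *)

Section UpperBound.
Variables (R : realType) (G : groupType) (S : seq G) (alpha : eqType) (kap : alpha -> G).
Variables (K : R) (conn : G -> seq (seq alpha)) (Kc : G -> R).
Hypothesis connP : forall g c, c \in conn g -> kword kap c = g.
Hypothesis K_ge0 : 0 <= K.
Hypothesis Kc_ge0 : forall g, 0 <= Kc g.
Hypothesis hS : symmetric_generating S.
Variable delta : R.
Hypothesis delta_gt0 : 0 < delta.
Hypothesis hyp : forall x y z, Num.min (gp R S x y) (gp R S y z) - delta <= gp R S x z.
Variable w : seq alpha -> R.
Hypothesis w_good : quasi_mult K conn Kc w.
Hypothesis w_fin : forall g, has_sum w (loop kap g).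
Variables (L : nat) (B : R).
Hypothesis kap_len : forall a, (word_length S (kap a) <= L)%N.
Hypothesis sphere_sq : forall k, \sum_(g <- sphere S k) tsum w (loop kap g) ^+ 2 <= B.

Local Notation len := (word_length S).
Local Notation kw := (kword kap).
Local Notation V w g := (tsum w (loop kap g)).
Local Notation H := (harnack_const S conn Kc).

Lemma tsum_void (T : eqType) (f : T -> R) (P : T -> Prop) e : 0 <= e ->
  (forall t, ~ P t) -> tsum f P <= e.
Proof.
move=> e0 nP; apply: tsum_le => -[_ _|t X _ XP]; first by rewrite big_nil.
by have := nP t (XP t (mem_head _ _)).
Qed.

(** The constant is fixed before the smaller weight [w']; with w' = r^|u| mu([u]) this gives
    uniformity in r. *)
Lemma ancona_upper : exists2 C, 0 <= C & forall w', quasi_mult K conn Kc w' ->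
  (forall u, w' u <= w u) ->
  forall (pt : nat -> G) N s, (forall i j, (i <= j <= N)%N -> len ((pt i)^-1 * pt j)%g = (j - i)%N) ->
  (s <= N)%N ->
  V w' ((pt 0%N)^-1 * pt N)%g <= C * (V w' ((pt 0%N)^-1 * pt s)%g * V w' ((pt s)^-1 * pt N)%g).
Proof.
have d0 := delta_gt0.
have H1 : 1 <= H by exact: harnack_const_ge1.
have H0 : 0 < H by lra.
have H36 : 0 < H ^+ 36 by rewrite exprn_gt0.
(* At scale rad J the gates are within 18 rad J of [y], so by Harnack the product of the two Green
   functions is at least H^(- 36 rad J). The remaining 4^(- rad J) makes the series over the scales
   converge. *)
pose Lam := 4^-1 / H ^+ 36.
have Lam0 : 0 < Lam by rewrite divr_gt0 // invr_gt0.
have [n0 avoidP] := avoid_small K_ge0 hS delta_gt0 hyp w_good w_fin kap_len (2 * delta) sphere_sq Lam0.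
have [n1 n1P] := nat_above (2 * delta).
pose rho0 := (maxn n0 n1).+1.
pose rad J := (rho0 * 2 ^ J)%N.
have rad_ge J : (rho0 <= rad J)%N by rewrite leq_pmulr // expn_gt0.
have radS J : rad J.+1 = (2 * rad J)%N by rewrite /rad expnS mulnCA.
have rad_n0 J : (n0 <= rad J)%N.
  by apply: leq_trans (rad_ge J); rewrite /rho0 leqW // leq_maxl.
have rad_J J : (J < rad J)%N.
  by apply: leq_trans (ltn_expl J (ltnSn 1)) _; rewrite leq_pmull.
have rad_delta J : 2 * delta < (rad J)%:R.
  apply: le_lt_trans n1P _; rewrite ltr_nat; apply: leq_trans (rad_ge J).
  by rewrite /rho0 ltnS leq_maxr.
pose C1 := V w 1%g; have C10 : 0 <= C1 by exact: tsum_ge0.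
(* At the smallest scale nothing has to decay: Harnack bounds V between the gates above by C1 H^(18
   rho0) and each of the two factors below by H^(- 9 rho0). *)
pose E0 := C1 * (H ^+ (18 * rho0) * (H ^+ (9 * rho0) * H ^+ (9 * rho0))).
have E00 : 0 <= E0 by rewrite /E0; do ?apply: mulr_ge0 => //; apply: exprn_ge0; exact: ltW.
pose e (k : nat) : R := if k is 0%N then E0 else 2^-1 ^+ k.
have half0 : 0 <= 2^-1 :> R by rewrite invr_ge0.
have e0 k : 0 <= e k by case: k => [|k] //=; exact: exprn_ge0.
have J10 : 0 <= Jc conn Kc 1%g by exact: Jc_ge0.
exists (K ^+ 2 * Jc conn Kc 1%g ^+ 2 * (E0 + 2)).
  by apply: mulr_ge0; [apply: mulr_ge0; exact: sqr_ge0|lra].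
move=> w' w'g w'w pt N s pt_dist sN.
have w'f g : has_sum w' (loop kap g) by apply: le_has_sum (w_fin g) => t _.
have V0 g : 0 <= V w' g by exact: tsum_ge0.
pose y := pt s.
have Vle n g : (len g <= n)%N -> 1 <= H ^+ n * V w' g.
  move=> gn; apply: le_trans (V_ge connP K_ge0 Kc_ge0 w'g w'f hS g) _.
  by rewrite ler_wpM2r // ler_weXn2l.
(* The two gates are enlarged alternately. From k to k + 1 one of them is unchanged, so a word
   between the gates of index k + 1 that does not pass those of index k avoids the smaller version
   of the other gate, which is a ball. *)
pose Xs k := left_gate S pt s (rad (uphalf k)); pose Ys k := right_gate S pt N s (rad k./2).
have esum : \sum_(k < N.*2.+1) e k <= E0 + 2.
  rewrite big_ord_recl /= lerD2l.
  apply: le_trans (_ : \sum_(0 <= i < N.*2) (2^-1 : R) ^+ i <= _).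
    by rewrite big_mkord; apply: ler_sum => i _; rewrite /bump /= add1n exprS ler_piMl ?exprn_ge0 //; lra.
  apply: le_trans (geo_tail _ _ _) _; first by apply/andP; split=> //; lra.
  by rewrite expr0 ler_pdivrMr; lra.
(* The decay is taken from the larger weight [w], the lower bounds for the two factors from [w']
   itself. *)
have small J v v' (P : seq alpha -> Prop) c :
    (len (v^-1 * y)%g <= 18 * rad J)%N -> (len (y^-1 * v')%g <= 18 * rad J)%N ->
    (forall u, P u -> (v * kw u)%g = v' /\ forall i, (i <= size u)%N -> (rad J < len (c^-1 * (v * kw (take i u)))%g)%N) ->
    gp R S (c^-1 * v)%g (c^-1 * v')%g <= 2 * delta ->
    tsum w' P <= 2^-1 ^+ (2 * rad J) * (V w' (v^-1 * y)%g * V w' (y^-1 * v')%g).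
  move=> dv dv' PP gpv.
  have hw : has_sum w (avoid S kap (rad J) (c^-1 * v)%g (c^-1 * v')%g).
    by apply: (@has_sum_loop R G alpha kap w w_fin ((c^-1 * v)^-1 * (c^-1 * v'))%g) => u /avoid_loop.
  apply: le_trans (_ : tsum w (avoid S kap (rad J) (c^-1 * v)%g (c^-1 * v')%g) <= _).
    apply: le_trans (_ : tsum w' (avoid S kap (rad J) (c^-1 * v)%g (c^-1 * v')%g) <= _).
      apply: tsumS; last by apply: le_has_sum hw.
      move=> u /PP[uv out]; split; first by rewrite -mulgA uv.
      by move=> i iu; rewrite -mulgA; exact: out.
    by apply: le_tsum.
  apply: le_trans (avoidP _ _ _ (rad_n0 J) gpv) _.
  have := ler_pM ler01 ler01 (Vle _ _ dv) (Vle _ _ dv'); rewrite mul1r => hh.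
  have hh2 : 1 <= (H ^+ 36) ^+ rad J * (V w' (v^-1 * y)%g * V w' (y^-1 * v')%g).
    apply: le_trans hh _; rewrite -exprM (_ : (36 * rad J = 18 * rad J + 18 * rad J)%N); last by clear; lia.
    by rewrite exprD le_eqVlt; apply/orP; left; apply/eqP; ring.
  rewrite /Lam expr_div_n ler_pdivrMr ?exprn_gt0 // -mulrA [X in _ * X]mulrC.
  rewrite exprM (_ : (2^-1 : R) ^+ 2 = 4^-1); last by rewrite expr2; lra.
  by rewrite -[leLHS]mulr1 ler_wpM2l // exprn_ge0 // invr_ge0.
have pE (k : nat) : 2^-1 ^+ (2 * rad k./2) <= e k.+1.
  rewrite /e ler_wiXn2l //; first by lra.
  have := rad_J k./2; have := odd_double_half k; clear; case: (odd k); lia.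
have dX k v : v \in Xs k.+1 -> (len (v^-1 * y)%g <= 18 * rad k./2)%N.
  move=> /(left_gate_dist hS pt_dist sN) => h; apply: leq_trans h _.
  have : (rad (uphalf k.+1) <= 2 * rad k./2)%N.
    by rewrite -radS.
  by clear; lia.
have dY k v : v \in Ys k.+1 -> (len (y^-1 * v)%g <= 18 * rad k./2)%N.
  move=> /(right_gate_dist hS pt_dist sN) => h; apply: leq_trans h _.
  have : (rad (k.+1)./2 <= 2 * rad k./2)%N.
    rewrite -radS /rad leq_mul2l leq_exp2l //; apply/orP; right.
    by rewrite -/(uphalf k) /= uphalf_half; case: (odd k).
  by clear; lia.
apply: le_trans (_ : K ^+ 2 * Jc conn Kc 1%g ^+ 2 * (\sum_(k < N.*2.+1) e k) *
   (V w' ((pt 0%N)^-1 * y)%g * V w' (y^-1 * pt N)%g) <= _); last first.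
  rewrite ler_wpM2r ?mulr_ge0 // ler_wpM2l //; apply: mulr_ge0; exact: sqr_ge0.
have radN : (N <= 8 * rad N)%N by have := rad_J N; clear; lia.
apply: (@gates_bound R G alpha kap K conn Kc connP K_ge0 Kc_ge0 w' w'g w'f Xs Ys e (pt 0%N) (pt N) y N.*2) => //.
- by move=> k; exact: left_gate_uniq.
- by move=> k; exact: right_gate_uniq.
- by rewrite /Xs uphalf_double /left_gate (leq_trans sN radN) mem_head.
- by rewrite /Ys doubleK /right_gate (leq_trans (leq_subr _ _) radN) mem_head.
- move=> v v' vX vY.
  have := left_gate_dist hS pt_dist sN vX; have := right_gate_dist hS pt_dist sN vY.
  rewrite /rad expn0 muln1 -/y => dv' dv.
  have dvv : (len (v^-1 * v')%g <= 18 * rho0)%N.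
    apply: leq_trans (len_tri hS v v' y) _; move: dv dv'; clear; lia.
  have h1 := V_harnack connP K_ge0 Kc_ge0 w'g w'f hS (v^-1 * v')%g 1%g; rewrite mulg1 lenV // in h1.
  have h2 : V w' 1%g <= C1 by apply: le_tsum.
  have h3 : V w' (v^-1 * v')%g <= H ^+ (18 * rho0) * C1.
    apply: le_trans h1 _; apply: ler_pM => //; first by rewrite exprn_ge0 // ltW.
    by rewrite ler_weXn2l.
  apply: le_trans h3 _; have := ler_pM ler01 ler01 (Vle _ _ dv) (Vle _ _ dv'); rewrite mul1r => hh.
  have Q0 : 0 <= H ^+ (18 * rho0) * C1 by rewrite mulr_ge0 // exprn_ge0 // ltW.
  have := ler_wpM2l Q0 hh; rewrite mulr1 => /le_trans; apply.
  by rewrite /e /E0 le_eqVlt; apply/orP; left; apply/eqP; ring.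
- move=> k v v' vX vY.
  apply: le_trans (_ : 2^-1 ^+ (2 * rad k./2) * (V w' (v^-1 * y)%g * V w' (y^-1 * v')%g) <= _); last first.
    by rewrite ler_wpM2r // mulr_ge0.
  have P0 : 0 <= 2^-1 ^+ (2 * rad k./2) * (V w' (v^-1 * y)%g * V w' (y^-1 * v')%g).
    by apply: mulr_ge0; [exact: exprn_ge0|exact: mulr_ge0].
  (* If there is a word in the class, the gate it avoids cannot have shrunk to an end point of the
     geodesic, so that the avoided ball exists. *)
  have [[u0 [u0v u0n]]|nP] := pselect (exists u, (v * kw u)%g = v' /\ ~ passes kap (Xs k) (Ys k) v u); last first.
    by apply: tsum_void => // u uP; apply: nP; exists u.
  set J := k./2; set T := rad J.
  have T2 : rad J.+1 = (2 * T)%N by exact: radS.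
  have xs1 : Xs k.+1 = left_gate S pt s (2 * T) by rewrite /Xs /= -T2.
  have [ko|ke] := boolP (odd k).
    have uk : uphalf k = J.+1 by rewrite uphalf_half ko.
    have xs0 : Xs k = left_gate S pt s (2 * T) by rewrite /Xs uk T2.
    have ys1 : Ys k.+1 = right_gate S pt N s (2 * T) by rewrite /Ys /= uk T2.
    have ys0 : Ys k = right_gate S pt N s T by [].
    have out u : (v * kw u)%g = v' -> ~ passes kap (Xs k) (Ys k) v u ->
        forall i, (i <= size u)%N -> (v * kw (take i u))%g \notin right_gate S pt N s T.
      move=> uv np i iu; apply/negP => h; apply: np; exists 0%N, i.
      by rewrite iu take0 kword_nil mulg1 xs0 -xs1 ys0.
    have NsT : (8 * T < N - s)%N.
      rewrite ltnNge; apply/negP => h; have := out u0 u0v u0n _ (leqnn _).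
      rewrite take_size u0v; move: vY; rewrite ys1 /right_gate h.
      by rewrite (leq_trans h) ?leq_mul2l ?leq_pmull // => ->.
    have far u i := fun uv np iu => right_gate_far hS NsT (out u uv np i iu).
    apply: (@small J v v' _ (pt (s + 8 * T)%N)); [exact: dX|exact: dY| |].
      by move=> u [uv np]; split=> // i iu; exact: far.
    move: (vX); rewrite xs1 => /(left_gate_near hS) hv.
    move: (vY); rewrite ys1 => /(right_gate_near hS sN) hv'.
    (* When the larger gate has shrunk to the end point of the geodesic, its distance from the
       centre exceeds T because the word ends there and avoids the ball. *)
    have end_far := far u0 _ u0v u0n (leqnn _); rewrite take_size u0v in end_far.
    have v'N : (N - s <= 8 * (2 * T))%N -> v' = pt N.
      by move=> h; move: vY; rewrite ys1 /right_gate h inE => /eqP.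
    apply: (@gate_gp G S hS pt N pt_dist R delta delta_gt0 hyp (s - 8 * (2 * T))
      (s + 8 * T) (minn N (s + 8 * (2 * T))) v v' T).
    - by move: NsT sN; clear; lia.
    - exact: geq_minl.
    - exact: rad_delta.
    - by apply: leq_trans (leq_add (leqnn T) hv) _; move: NsT; clear; case: ifP; lia.
    - move: hv'; case: (leqP (N - s) (8 * (2 * T))) => h hv'.
        have := end_far; rewrite (v'N h) pt_dist; last by move: NsT sN; clear; lia.
        by move: hv' (h); rewrite (v'N h); clear; lia.
      by apply: leq_trans (leq_add (leqnn T) hv') _; move: NsT h; clear; lia.
  have uk : uphalf k = J by rewrite uphalf_half (negbTE ke).
  have xs0 : Xs k = left_gate S pt s T by rewrite /Xs uk.
  have ys1 : Ys k.+1 = right_gate S pt N s T by rewrite /Ys /= uk.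
  have ys0 : Ys k = right_gate S pt N s T by [].
  have out u : (v * kw u)%g = v' -> ~ passes kap (Xs k) (Ys k) v u ->
      forall i, (i <= size u)%N -> (v * kw (take i u))%g \notin left_gate S pt s T.
    move=> uv np i iu; apply/negP => h; apply: np; exists i, (size u).
    by rewrite iu leqnn take_size uv xs0 ys0 -ys1.
  have sT : (8 * T < s)%N.
    rewrite ltnNge; apply/negP => h; have := out u0 u0v u0n _ (leq0n _).
    rewrite take0 kword_nil mulg1; move: vX; rewrite xs1 /left_gate h.
    by rewrite (leq_trans h) ?leq_mul2l ?leq_pmull // => ->.
  have far u i := fun uv np iu => left_gate_far hS sT (out u uv np i iu).
  apply: (@small J v v' _ (pt (s - 8 * T)%N)); [exact: dX|exact: dY| |].
    by move=> u [uv np]; split=> // i iu; exact: far.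
  move: (vX); rewrite xs1 => /(left_gate_near hS) hv.
  move: (vY); rewrite ys1 => /(right_gate_near hS sN) hv'.
  have start_far := far u0 _ u0v u0n (leq0n _); rewrite take0 kword_nil mulg1 in start_far.
  have v0 : (s <= 8 * (2 * T))%N -> v = pt 0%N.
    by move=> h; move: vX; rewrite xs1 /left_gate h inE => /eqP.
  apply: (@gate_gp G S hS pt N pt_dist R delta delta_gt0 hyp (s - 8 * (2 * T))
    (s - 8 * T) (minn N (s + 8 * T)) v v' T).
  - by move: sT sN; clear; lia.
  - exact: geq_minl.
  - exact: rad_delta.
  - move: hv; case: (leqP s (8 * (2 * T))) => h hv.
      have := start_far; rewrite (v0 h) (lenC hS) pt_dist; last by move: sT sN; clear; lia.
      by move: hv (h); rewrite (v0 h); clear; lia.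
    by apply: leq_trans (leq_add (leqnn T) hv) _; move: sT h; clear; lia.
  - by apply: leq_trans (leq_add (leqnn T) hv') _; move: sT sN; clear; case: ifP; lia.
Qed.

End UpperBound.

(** * Markov chains and cylinders *)

(** For nonnegative functions the integral is a supremum over simple functions below, so it is
    monotone without measurability of the integrands. *)
Lemma ge0_le_integral_nomeas d (T : measurableType d) (R : realType)
    (mu : {measure set T -> \bar R}) (D : set T) (f g : T -> \bar R) :
  (forall x, D x -> 0 <= f x)%E -> (forall x, D x -> f x <= g x)%E ->
  (\int[mu]_(x in D) f x <= \int[mu]_(x in D) g x)%E.
Proof.
move=> f0 fg; have g0 x : D x -> (0 <= g x)%E by move=> Dx; apply: le_trans (fg x Dx); exact: f0.
rewrite !ge0_integralE //; apply: ereal_sup_le => _ [h /= hf <-]; exists h => //= x.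
apply: le_trans (hf x) _; rewrite /patch; case: ifPn => // xD.
by apply: fg; apply/set_mem.
Qed.

Section Chain.
Variables (alpha : finType) (A : rel alpha).
Implicit Types (x y : tmc A) (u v w : seq alpha).

Lemma letterP x i : A (letter x i) (letter x i.+1).
Proof. exact: (set_mem (valP x)). Qed.

Lemma letter_inj x y : letter x =1 letter y -> x = y.
Proof. by move=> e; apply: val_inj; apply/funext. Qed.

Lemma letter_iter n x i : letter (iter n theta x) i = letter x (n + i).
Proof. by elim: n i => [|n IH] i //=; rewrite addSn -addnS -IH. Qed.

Lemma letter_ext (f : nat -> alpha) : (forall i, A (f i) (f i.+1)) ->
  exists x : tmc A, letter x = f.
Proof. by move=> h; exists (exist _ f (mem_set h)). Qed.

Lemma cylinderP w x : cylinder A w x <-> (forall a i, (i < size w)%N -> nth a w i = letter x i).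
Proof.
split=> [/= e a i iw|h]; first by rewrite -{1}e nth_mkseq.
case: w h => [|a w] h //; apply: (@eq_from_nth _ a); rewrite ?size_mkseq // => i iw.
by rewrite nth_mkseq // h.
Qed.

Lemma cylinder_cat u v x : cylinder A (u ++ v) x <->
  cylinder A u x /\ cylinder A v (iter (size u) theta x).
Proof.
rewrite !cylinderP; split=> [h|[hu hv] a i]; last first.
  rewrite size_cat nth_cat; move=> iw; case: ltnP => iu; first exact: hu.
  by rewrite hv ?letter_iter; [congr letter; lia|lia].
split=> a i iw; have := h a.
  by move=> /(_ i); rewrite size_cat nth_cat iw; apply; lia.
by move=> /(_ (size u + i)%N); rewrite size_cat nth_cat letter_iter (ltnNge (size u + i) (size u)) leq_addr /= addKn; apply; lia.
Qed.

Lemma cylinder_nil : cylinder A [::] = setT.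
Proof. by apply/seteqP; split. Qed.

Lemma cylinder1 a x : cylinder A [:: a] x <-> letter x 0 = a.
Proof. by split=> [[]|<-]. Qed.

Lemma mkseq_admissible x n : admissible A (mkseq (letter x) n).
Proof.
by apply/(sortedP (letter x 0)) => i; rewrite size_mkseq => h; rewrite !nth_mkseq ?letterP //; lia.
Qed.

Lemma cylinder_admissible w x : cylinder A w x -> admissible A w.
Proof. by move=> /= <-; exact: mkseq_admissible. Qed.

Lemma admissible_cat u v : admissible A (u ++ v) =
  [&& admissible A u, admissible A v & if v is b :: _ then if u is a :: u' then A (last a u') b else true else true].
Proof.
rewrite /admissible; case: u v => [|a u] [|b v] /=; rewrite ?andbT ?cats0 //.
by rewrite cat_path /= [path A b v && _]andbC.
Qed.

(** Markov property: writing [u] in front of [x] gives a point of the chain as soon as the letters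
    at the junction are compatible. *)
Lemma branch_domP u x : admissible A u -> branch_dom A u x <-> admissible A (u ++ [:: letter x 0]).
Proof.
move=> ua; split=> [[y yu <-]|h].
  apply: (@cylinder_admissible _ y); apply/cylinder_cat; split=> //.
pose f i := if (i < size u)%N then nth (letter x 0) u i else letter x (i - size u).
have [|y ye] := @letter_ext f.
  move=> i; rewrite /f; have := sortedP (letter x 0) h i; rewrite size_cat /= addn1.
  case: (ltnP i.+1 (size u)) => h1.
    by rewrite ifT ?(ltnW h1) // !nth_cat h1 (ltnW h1) => /(_ (ltnW h1)).
  case: (ltnP i (size u)) => h2.
    have e : i.+1 = size u by lia.
    by rewrite !nth_cat h2 e ltnn subnn => /(_ (ltnSn _)).
  by move=> _; rewrite subSn // letterP.
exists y.
  by apply/cylinderP => a i iu; rewrite ye /f iu; apply: set_nth_default.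
apply: letter_inj => i; rewrite letter_iter ye /f ltnNge leq_addr /=; congr letter; lia.
Qed.

Lemma cylinder_sub_branch_dom u b v : admissible A (u ++ b :: v) ->
  cylinder A (b :: v) `<=` branch_dom A u.
Proof.
rewrite admissible_cat => /and3P[ua _ h] x [xb _]; apply/branch_domP => //.
by rewrite admissible_cat ua /= xb.
Qed.

Lemma iter_theta_inj u : {in cylinder A u &, injective (iter (size u) theta)}.
Proof.
move=> x y /set_mem /cylinderP xu /set_mem /cylinderP yu e; apply: letter_inj => i.
case: (ltnP i (size u)) => iu; first by rewrite -(xu (letter x 0)) // (yu (letter x 0)).
by have := congr1 (fun z => letter z (i - size u)) e; rewrite !letter_iter subnKC.
Qed.

Lemma tauP u x : branch_dom A u x ->
  cylinder A u (tau u x) /\ iter (size u) theta (tau u x) = x.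
Proof.
move=> xu; split; last by rewrite /tau pinvK //; apply/mem_set.
by case: xu => y yu <-; rewrite /tau pinvKV //; [exact: iter_theta_inj|apply/mem_set].
Qed.

Lemma tau_iter u y : cylinder A u y -> tau u (iter (size u) theta y) = y.
Proof. by move=> yu; rewrite /tau pinvKV //; [exact: iter_theta_inj|apply/mem_set]. Qed.

Lemma tau_branch_dom u : tau u @` branch_dom A u = cylinder A u.
Proof. exact: (injpinv_image id (@iter_theta_inj u)). Qed.

Lemma tau_cylinder u v : cylinder A v `<=` branch_dom A u ->
  tau u @` cylinder A v = cylinder A (u ++ v).
Proof.
move=> vu; apply/seteqP; split=> [_ [x xv <-]|y /cylinder_cat[yu yv]].
  by have [h1 h2] := tauP (vu x xv); apply/cylinder_cat; rewrite h2.
by exists (iter (size u) theta y) => //; exact: tau_iter.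
Qed.

Lemma cylinder_open w : open (cylinder A w : set (tmc A)).
Proof.
elim/last_ind: w => [|w a IH]; first by rewrite cylinder_nil; exact: openT.
rewrite (_ : cylinder _ _ = cylinder A w `&` (fun x => letter x (size w)) @^-1` [set a]); last first.
  rewrite -cats1; apply/seteqP; split=> x; first by move/cylinder_cat => [? /cylinder1]; rewrite letter_iter addn0.
  by move=> [h1 h2]; apply/cylinder_cat; split=> //; apply/cylinder1; rewrite letter_iter addn0.
apply: openI => //.
have c : continuous (fun x : tmc A => letter x (size w) : discrete_topology alpha).
  move=> x; apply: (@continuous_comp _ _ _ (set_val : tmc A -> {ptws nat -> discrete_topology alpha})
    (fun f => f (size w))); first exact: initial_continuous.
  exact: proj_continuous.
by move/continuousP: c => /(_ [set a]); apply; exact: discrete_open.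
Qed.

Lemma branch_dom_open u : admissible A u -> open (branch_dom A u : set (tmc A)).
Proof.
move=> ua; rewrite (_ : branch_dom A u = \bigcup_(b in [set b | admissible A (u ++ [:: b])]) cylinder A [:: b]).
  by apply: bigcup_open => b _; exact: cylinder_open.
apply/seteqP; split=> x.
  by move=> /(branch_domP _ ua) h; exists (letter x 0) => //; apply/cylinder1.
by move=> [b /= h /cylinder1 e]; apply/branch_domP; rewrite // e.
Qed.

Lemma dist_s_le1 (R : realType) (s : R) x y : 0 < s -> s < 1 -> dist_s s x y <= 1.
Proof.
move=> s0 s1; rewrite /dist_s; case: ifP => _; rewrite ?ler01 //.
by rewrite exprn_ile1 // ltW.
Qed.

End Chain.

(** * Gibbs estimates for cylinders *)

Section Measure.
Variables (R : realType) (alpha : finType) (A : rel alpha).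
Variables (pt : tmc A) (mu : probability (borel pt) R) (phi : seq alpha -> tmc A -> R).
Hypothesis mu_pos : positive_on_cylinders mu.
Hypothesis phi_jac : is_jacobian mu phi.
Hypothesis phi_gm : gibbs_markov phi.
Implicit Types (x y : tmc A) (u v w : seq alpha).

Definition wt u : R := fine (mu (cylinder A u)).

Lemma open_measurable_borel (B : set (tmc A)) : open B -> measurable (B : set (borel pt)).
Proof. exact: sub_gen_smallest. Qed.

Lemma cylinder_measurable w : measurable (cylinder A w : set (borel pt)).
Proof. exact: open_measurable_borel (@cylinder_open _ A w). Qed.

Lemma wtE u : mu (cylinder A u) = (wt u)%:E.
Proof. by rewrite /wt fineK // fin_num_measure //; exact: cylinder_measurable. Qed.

Lemma wt_ge0 u : 0 <= wt u.
Proof. by rewrite -lee_fin -wtE measure_ge0. Qed.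

Lemma wt_gt0 u : admissible A u -> 0 < wt u.
Proof. by move=> ua; rewrite -lte_fin -wtE mu_pos. Qed.

Lemma wt_le1 u : wt u <= 1.
Proof. by rewrite -lee_fin -wtE probability_le1 //; exact: cylinder_measurable. Qed.

Lemma wt_nil : wt [::] = 1.
Proof. by apply: EFin_inj; rewrite -wtE cylinder_nil probability_setT. Qed.

Lemma wt_eq0 u : ~~ admissible A u -> wt u = 0.
Proof.
move=> nu; rewrite /wt (_ : cylinder A u = set0) ?measure0 // -subset0 => x /cylinder_admissible.
by rewrite (negbTE nu).
Qed.

Lemma cylinder_neq0 u : admissible A u -> cylinder A u !=set0.
Proof.
move=> ua; apply/set0P/negP => /eqP e; have := mu_pos ua.
by rewrite e measure0 ltxx.
Qed.

Lemma letter_mass_bound : exists2 M : R, 1 <= M & forall b, 1 <= M * wt [:: b].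
Proof.
exists (1 + \sum_b (wt [:: b])^-1).
  by rewrite lerDl sumr_ge0 // => b _; rewrite invr_ge0 wt_ge0.
move=> b; have b0 : 0 < wt [:: b] by exact: wt_gt0.
rewrite -ler_pdivrMr // div1r (bigD1 b) //= addrCA lerDl addr_ge0 //.
by rewrite sumr_ge0 // => c _; rewrite invr_ge0 wt_ge0.
Qed.

Lemma phi_gt0 u x : admissible A u -> branch_dom A u x -> 0 < phi u x.
Proof. by case: phi_gm => h _; exact: h. Qed.

Lemma phi_distortion : exists2 E : R, 1 <= E & forall u x y, admissible A u ->
  branch_dom A u x -> branch_dom A u y -> phi u y <= E * phi u x.
Proof.
case: phi_gm => pos [C [s [C0 s0 s1 h]]]; exists (expR C).
  by rewrite -[1]expR0 ler_expR ltW.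
move=> u x y ua xu yu; have px := pos _ _ ua xu; have py := pos _ _ ua yu.
rewrite -[phi u y]lnK ?posrE // -[phi u x]lnK ?posrE // -expRD ler_expR -lerBlDr.
apply: le_trans (ler_norm _) _; apply: le_trans (h _ _ _ ua yu xu) _.
by rewrite ler_piMr ?dist_s_le1 // ltW.
Qed.

Lemma mu_tau_bounds E u x (B : set (borel pt)) : admissible A u -> branch_dom A u x ->
  measurable B -> B `<=` branch_dom A u ->
  (forall y, branch_dom A u y -> phi u y <= E * phi u x /\ phi u x <= E * phi u y) -> 0 < E ->
  (mu (tau u @` B) <= (E * phi u x)%:E * mu B)%E /\
  ((phi u x)%:E * mu B <= E%:E * mu (tau u @` B))%E.
Proof.
move=> ua xu mB Bu hE E0; have [_ /(_ B mB Bu) ->] := phi_jac ua.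
have px := phi_gt0 ua xu.
split.
  rewrite -integral_cst //; apply: ge0_le_integral_nomeas => y By; rewrite lee_fin.
    by rewrite ltW ?phi_gt0 //; exact: Bu.
  by have [] := hE y (Bu _ By).
have -> : ((phi u x)%:E = E%:E * (E^-1 * phi u x)%:E)%E by rewrite -EFinM mulVKf // gt_eqF.
rewrite -muleA lee_pmul2l //; rewrite -integral_cst //.
apply: ge0_le_integral_nomeas => y By; rewrite lee_fin /=.
  by rewrite mulr_ge0 ?invr_ge0 ?ltW.
by rewrite ler_pdivrMl //; have [] := hE y (Bu _ By).
Qed.

(** By bounded distortion the jacobian of a branch is almost constant on its domain, which contains
    a cylinder of length one and so has mass bounded below; hence it is comparable to the mass of
    [u]. Integrating it over [v] compares the mass of [uv] with the product. *)
Lemma wt_comparisons : exists2 K : R, 1 <= K & [/\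
  forall u v, wt (u ++ v) <= K * (wt u * wt v),
  forall u v, admissible A (u ++ v) -> wt u * wt v <= K * wt (u ++ v) &
  forall u x, admissible A u -> branch_dom A u x -> phi u x <= K * wt u /\ wt u <= K * phi u x].
Proof.
have [M M1 hM] := letter_mass_bound; have [E E1 hE] := phi_distortion.
have E0 : 0 < E by apply: lt_le_trans E1.
have M0 : 0 < M by apply: lt_le_trans M1.
have phiE u x : admissible A u -> branch_dom A u x ->
    phi u x <= E * M * wt u /\ wt u <= E * phi u x.
  move=> ua xu; have px := phi_gt0 ua xu.
  have mB : measurable (branch_dom A u : set (borel pt)).
    by apply: open_measurable_borel; exact: branch_dom_open.
  have [|] := @mu_tau_bounds E u x _ ua xu mB (@subset_refl _ _) _ E0.
    by move=> y yu; split; exact: hE.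
  rewrite tau_branch_dom wtE => h1 h2; split; last first.
    rewrite -lee_fin; apply: le_trans h1 _; rewrite -[leRHS]mule1 lee_wpmul2l ?probability_le1 //.
    by rewrite lee_fin ltW // mulr_gt0.
  rewrite -lee_fin (_ : E * M * wt u = M * (E * wt u)); last by rewrite mulrCA mulrA.
  rewrite EFinM; apply: le_trans (_ : M%:E * ((phi u x)%:E * mu (branch_dom A u)) <= _)%E.
    rewrite muleCA -[leLHS]mule1 lee_wpmul2l ?lee_fin ?(ltW px) //.
    apply: le_trans (_ : (M * wt [:: letter x 0])%:E <= _)%E; first by rewrite lee_fin.
    rewrite EFinM -wtE lee_pmul2l ?lte_fin // le_measure ?inE //.
      exact: cylinder_measurable.
    apply: cylinder_sub_branch_dom; exact/(branch_domP _ ua).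
  by rewrite lee_pmul2l ?lte_fin // EFinM.
have cat u b v : admissible A (u ++ b :: v) ->
    wt (u ++ b :: v) <= E * E * M * (wt u * wt (b :: v)) /\
    wt u * wt (b :: v) <= E * E * wt (u ++ b :: v).
  move=> a; have vu := cylinder_sub_branch_dom a.
  move: (a); rewrite admissible_cat => /and3P[ua va _].
  have [x /vu xu] := cylinder_neq0 va; have [p1 p2] := phiE u x ua xu.
  have [|] := @mu_tau_bounds E u x _ ua xu (cylinder_measurable _) vu _ E0.
    by move=> y yu; split; exact: hE.
  rewrite (tau_cylinder vu) !wtE -!EFinM !lee_fin => h1 h2; have v0 := wt_ge0 (b :: v); split.
    apply: le_trans h1 _; rewrite mulrA ler_wpM2r // -!mulrA ler_wpM2l ?(ltW E0) //.
    by rewrite !mulrA.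
  apply: le_trans (_ : E * (phi u x * wt (b :: v)) <= _).
    by rewrite mulrA ler_wpM2r.
  by rewrite -mulrA ler_wpM2l // ltW.
have EM : 1 <= E * E * M by rewrite !mulr_ege1.
have EE : E * E <= E * E * M by rewrite ler_peMr // mulr_ge0 // ltW.
have EK : E <= E * E * M by apply: le_trans EE; rewrite ler_peMr // ltW.
have EMK : E * M <= E * E * M by rewrite -mulrA ler_peMl // mulr_ge0 // ltW.
exists (E * E * M) => //; split.
- move=> u [|b v]; first by rewrite cats0 wt_nil mulr1 ler_peMl // wt_ge0.
  have [a|na] := boolP (admissible A (u ++ b :: v)); first by have [] := cat _ _ _ a.
  by rewrite (wt_eq0 na) !mulr_ge0 ?wt_ge0 // ltW.
- move=> u [|b v]; first by rewrite cats0 wt_nil mulr1 => _; rewrite ler_peMl // wt_ge0.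
  move=> a; have [_ h] := cat _ _ _ a; apply: le_trans h _.
  by rewrite ler_wpM2r // wt_ge0.
- move=> u x ua xu; have [h1 h2] := phiE _ _ ua xu; have px := ltW (phi_gt0 ua xu); split.
    by apply: le_trans h1 _; rewrite ler_wpM2r // wt_ge0.
  by apply: le_trans h2 _; rewrite ler_wpM2r.
Qed.

End Measure.

(** * Green functions of the extension *)

Definition words (alpha : finType) (N : nat) : seq (seq alpha) :=
  flatten (mkseq (fun n => [seq tval v | v <- enum {: n.-tuple alpha}]) N).

Lemma wordsS (alpha : finType) N : words alpha N.+1 =
  words alpha N ++ [seq tval v | v <- enum {: N.-tuple alpha}].
Proof. by rewrite /words mkseqS flatten_rcons. Qed.

Lemma mem_words (alpha : finType) N (t : seq alpha) : (t \in words alpha N) = (size t < N)%N.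
Proof.
elim: N => [|N IH]; first by rewrite ltn0.
rewrite wordsS mem_cat IH ltnS [RHS]leq_eqVlt orbC; congr (_ || _).
apply/mapP/eqP => [[v _ ->]|e]; first exact: size_tuple.
by exists (Tuple (introT eqP e)); rewrite ?mem_enum.
Qed.

Lemma uniq_words (alpha : finType) N : uniq (words alpha N).
Proof.
elim: N => [|N IH] //; rewrite wordsS cat_uniq IH map_inj_uniq ?enum_uniq ?andbT //=; last exact: val_inj.
by apply/hasPn => _ /mapP[v _ ->]; rewrite /= mem_words size_tuple ltnn.
Qed.

Lemma sum_words (alpha : finType) (R : realType) N (F : seq alpha -> R) :
  \sum_(t <- words alpha N) F t = \sum_(n < N) \sum_(v : n.-tuple alpha) F v.
Proof.
elim: N => [|N IH]; first by rewrite big_nil big_ord0.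
by rewrite wordsS big_cat IH big_ord_recr /= big_map big_enum.
Qed.

Lemma limn_esup_lt (R : realType) (u : nat -> R) (q : R) :
  (limn_esup (fun n => (u n)%:E) < q%:E)%E -> exists N, forall n, (N <= n)%N -> u n < q.
Proof.
rewrite /limn_esup /limf_esup => /ereal_inf_lt[_ [V [N _ NV] <-] h]; exists N => n Nn.
by rewrite -lte_fin; apply: le_lt_trans h; apply: ereal_sup_ubound; exists n => //; exact: NV.
Qed.

Lemma root_limsup_lt (R : realType) (T : nat -> R) (r : R) : (forall n, 0 <= T n) -> 0 < r ->
  let rho := fine (limn_esup (fun n => (T n `^ n%:R^-1)%:E)) in 0 < rho -> r * rho < 1 ->
  exists q M, [/\ 0 < q, r * q < 1, 0 <= M & forall n, T n <= M * q ^+ n].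
Proof.
move=> T0 r0 rho rho0 rr; pose q := (rho + r^-1) / 2.
have rho_lt : rho < r^-1 by rewrite -[r^-1]mul1r ltr_pdivlMr // mulrC.
have q1 : rho < q by rewrite /q; lra.
have q2 : q < r^-1 by rewrite /q; lra.
have q0 : 0 < q by apply: lt_trans q1.
have [|N hN] := @limn_esup_lt R (fun n => T n `^ n%:R^-1) q.
  (* Positivity of [rho] excludes an infinite limsup, on which [fine] takes the value 0. *)
  move: rho0 q1; rewrite /rho; case: limn_esup => [l| |] //=; rewrite ?ltxx //.
exists q, (1 + \sum_(n < N.+1) T n / q ^+ n).
have s0 : 0 <= \sum_(n < N.+1) T n / q ^+ n.
  by rewrite sumr_ge0 // => n _; rewrite divr_ge0 ?exprn_ge0 // ltW.
split=> //; first by rewrite mulrC -ltr_pdivlMr // div1r.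
  by rewrite addr_ge0.
move=> n; case: (ltnP n N.+1) => nN.
  rewrite -ler_pdivrMr ?exprn_gt0 // (bigD1 (Ordinal nN)) //= addrCA lerDl addr_ge0 //.
  by rewrite sumr_ge0 // => m _; rewrite divr_ge0 ?exprn_ge0 // ltW.
have n0 : n%:R != 0 :> R by rewrite pnatr_eq0; case: n nN.
have e : T n = (T n `^ n%:R^-1) ^+ n.
  by rewrite -powR_mulrn ?powR_ge0 // -powRrM mulVf // powRr1.
rewrite e; apply: le_trans (_ : q ^+ n <= _); last by rewrite ler_peMl ?exprn_ge0 ?lerDl // ltW.
by rewrite lerXn2r ?nnegrE ?powR_ge0 ?(ltW q0) // ltW // hN // ltnW.
Qed.

Lemma arithmetic_geometric_sum_le (R : realType) (y : R) N : 0 <= y -> y < 1 ->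
  \sum_(n < N) n.+1%:R * y ^+ n <= (1 - y) ^- 2.
Proof.
move=> y0 y1; have d0 : 0 < 1 - y by rewrite subr_gt0.
rewrite -[leRHS]mul1r ler_pdivlMr ?exprn_gt0 //.
suff -> : (\sum_(n < N) n.+1%:R * y ^+ n) * (1 - y) ^+ 2 =
    1 - y ^+ N * (1 + N%:R * (1 - y)).
  by rewrite gerBl mulr_ge0 ?exprn_ge0 // addr_ge0 // mulr_ge0 // ltW.
elim: N => [|N IH]; first by rewrite big_ord0; ring.
by rewrite big_ord_recr /= mulrDl IH -natr1 (exprS y N); ring.
Qed.

(** * Connecting words and the weights r^|u| mu([u]) *)

Section Extension.
Variables (R : realType) (alpha : finType) (A : rel alpha).
Variables (pt : tmc A) (mu : probability (borel pt) R) (phi : seq alpha -> tmc A -> R).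
Hypothesis mu_pos : positive_on_cylinders mu.
Hypothesis phi_jac : is_jacobian mu phi.
Hypothesis phi_gm : gibbs_markov phi.
Variables (G : groupType) (kappa : tmc A -> G).
Hypothesis kappa_const : constant_on_letters kappa.
Hypothesis trans : topologically_transitive kappa.
Implicit Types (x y : tmc A) (u v w : seq alpha) (g h : G).

Local Notation wt := (wt mu).

Definition letter_value (a : alpha) : G := kappa (xget pt (cylinder A [:: a])).
Local Notation kw := (kword letter_value).

Lemma letter_valueE x : kappa x = letter_value (letter x 0).
Proof.
apply: (kappa_const (a := letter x 0)); first exact/cylinder1.
by case: xgetP => // /(_ x); case; exact/cylinder1.
Qed.

Lemma kappa_prodE n x : kappa_prod kappa n x = kw (mkseq (letter x) n).
Proof.
rewrite /kappa_prod /kword /mkseq big_map -/(index_iota 0 n) /index_iota subn0.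
by apply: eq_bigr => i _; rewrite letter_valueE letter_iter addn0.
Qed.

Lemma iter_skew n x g : iter n (Defs.skew kappa) (x, g) = (iter n theta x, (g * kappa_prod kappa n x)%g).
Proof.
elim: n => [|n IH]; first by rewrite /kappa_prod big_geq //= mulg1.
by rewrite iterS IH /Defs.skew /= /kappa_prod big_nat_recr //= mulgA.
Qed.

(** Transitivity provides an orbit from [a] to [b], and its itinerary is the word. With [head b t]
    the empty word is covered too: it occurs for a = b. *)
Lemma connecting_word (a b : alpha) g :
  exists t, [/\ kw t = g, admissible A (t ++ [:: b]) & head b t = a].
Proof.
have [n [_ [[[x _]] [/= xa ->] <-]]] := trans a b 1%g g.
rewrite iter_skew mul1g => -[/= /cylinder1 e eg].
move: e; rewrite letter_iter addn0 => e.
exists (mkseq (letter x) n); rewrite -kappa_prodE eg; split=> //.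
  by rewrite -e cats1 -mkseqS; exact: mkseq_admissible.
have xa0 : letter x 0 = a by apply/cylinder1.
by case: n e {eg} => [<-|n _].
Qed.

Definition connector_word a b g := sval (cid (connecting_word a b g)).

Definition conn_words g : seq (seq alpha) :=
  [seq connector_word p.1 p.2 g | p <- enum {: alpha * alpha}].

Lemma conn_wordsP g c : c \in conn_words g -> kw c = g.
Proof. by move=> /mapP[p _ ->]; rewrite /connector_word; case: cid => t []. Qed.

Lemma successor (a : alpha) : exists b, A a b.
Proof.
have [x xa] := cylinder_neq0 mu_pos (isT : admissible A [:: a]).
by exists (letter x 1); move/cylinder1: xa => <-; exact: letterP.
Qed.

Lemma admissible_insert u c v b : admissible A u -> admissible A v -> admissible A (c ++ [:: b]) ->
  (if u is a :: u' then A (last a u') (head b c) else true) -> head b v = b ->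
  admissible A (u ++ c ++ v).
Proof.
move=> ua va; rewrite !admissible_cat ua va /= => /andP[ca cb] uc vb.
rewrite ca /=; apply/andP; split.
  by case: v vb {va} => [|e v] //= ->.
by case: c ca cb uc => [|d c] //=; case: v vb {va} => [|e v] //= ->.
Qed.

Lemma conn_words_admissible g u v : admissible A u -> admissible A v ->
  exists2 c, c \in conn_words g & admissible A (u ++ c ++ v).
Proof.
move=> ua va; pose b := head (letter pt 0) v.
have [a ha] : exists a, if u is a' :: u' then A (last a' u') a else true.
  by case: u {ua} => [|a' u]; [exists b|exact: successor].
exists (connector_word a b g); first by apply/mapP; exists (a, b); rewrite ?mem_enum.
rewrite /connector_word; case: cid => c /= [_ cb ca].
apply: (@admissible_insert _ _ _ b) => //; first by rewrite ca; case: (u) ha.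
by rewrite /b; case: (v).
Qed.

Definition scaled r u : R := r ^+ size u * wt u.

(** Inserting c multiplies the weight by at least r^|c| mu([c]) / K^2, and r^|c| >= 2^(-|c|) for r
    >= 1/2; this makes the constant independent of r. *)
Definition conn_const K g : R := \sum_(c <- conn_words g) K * K * 2 ^+ size c * (wt c)^-1.

Lemma conn_const_ge0 K g : 0 <= K -> 0 <= conn_const K g.
Proof.
by move=> K0; apply: sumr_ge0 => c _; rewrite !mulr_ge0 ?invr_ge0 ?wt_ge0 ?exprn_ge0.
Qed.

Lemma scaled_ge0 r u : 0 <= r -> 0 <= scaled r u.
Proof. by move=> r0; rewrite mulr_ge0 ?exprn_ge0 ?wt_ge0. Qed.

Lemma scaled_quasi_mult K r : 1 <= K ->
  (forall u v, wt (u ++ v) <= K * (wt u * wt v)) ->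
  (forall u v, admissible A (u ++ v) -> wt u * wt v <= K * wt (u ++ v)) ->
  2^-1 <= r -> quasi_mult K conn_words (conn_const K) (scaled r).
Proof.
move=> K1 h1 h2 r2; have r0 : 0 < r by apply: lt_le_trans r2.
have K0 : 0 < K by apply: lt_le_trans K1.
split.
- by move=> u; exact/scaled_ge0/ltW.
- by rewrite /scaled mul1r wt_nil.
- move=> u v; rewrite /scaled size_cat exprD.
  rewrite (_ : K * _ = r ^+ size u * r ^+ size v * (K * (wt u * wt v))); last by ring.
  by rewrite ler_wpM2l ?mulr_ge0 ?exprn_ge0 // ltW.
move=> g u v; have sc0 c : 0 <= scaled r c by apply/scaled_ge0/ltW.
have rhs0 : 0 <= conn_const K g * \sum_(c <- conn_words g) scaled r (u ++ c ++ v).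
  by apply: mulr_ge0; [exact/conn_const_ge0/ltW|exact: sumr_ge0].
have [ua|na] := boolP (admissible A u); last by rewrite {1}/scaled (wt_eq0 _ na) mulr0 mul0r.
have [va|na] := boolP (admissible A v); last by rewrite {2}/scaled (wt_eq0 _ na) !mulr0.
have [c cc cad] := conn_words_admissible g ua va.
have ca : admissible A c by move: cad; rewrite !admissible_cat => /and3P[_ /and3P[]].
have wc := wt_gt0 mu_pos ca.
apply: le_trans (_ : (K * K * 2 ^+ size c * (wt c)^-1) * scaled r (u ++ c ++ v) <= _); last first.
  apply: ler_pM => //; first by rewrite !mulr_ge0 ?invr_ge0 ?wt_ge0 ?exprn_ge0 // ltW.
  rewrite /conn_const (big_rem c) //= lerDl sumr_ge0 // => d _.
    by rewrite !mulr_ge0 ?invr_ge0 ?wt_ge0 ?exprn_ge0 // ltW.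
  by rewrite (big_rem c) //= lerDl sumr_ge0.
rewrite /scaled !size_cat !exprD.
have hu : wt u * (wt c * wt v) <= K * K * wt (u ++ c ++ v).
  apply: le_trans (_ : wt u * (K * wt (c ++ v)) <= _).
    rewrite ler_wpM2l ?wt_ge0 // h2 //; by move: cad; rewrite admissible_cat => /and3P[].
  by rewrite mulrCA -mulrA ler_wpM2l ?(ltW K0) // h2.
have hp : 1 <= 2 ^+ size c * r ^+ size c by rewrite -exprMn exprn_ege1 // -ler_pdivrMl // mulr1.
apply: le_trans (_ : r ^+ size u * r ^+ size v * (wt c)^-1 * (K * K * wt (u ++ c ++ v)) <= _).
  rewrite (_ : r ^+ size u * wt u * (r ^+ size v * wt v) = r ^+ size u * r ^+ size v * (wt u * wt v)); last by ring.
  rewrite -(mulrA _ (wt c)^-1) ler_wpM2l ?mulr_ge0 ?exprn_ge0 ?(ltW r0) // ler_pdivlMl //.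
  by apply: le_trans hu; rewrite mulrCA.
rewrite (_ : K * K * 2 ^+ size c * (wt c)^-1 * (r ^+ size u * (r ^+ size c * r ^+ size v) * wt (u ++ c ++ v)) =
  r ^+ size u * r ^+ size v * (wt c)^-1 * (K * K * wt (u ++ c ++ v)) * (2 ^+ size c * r ^+ size c)); last by ring.
by rewrite ler_peMr // !mulr_ge0 ?exprn_ge0 ?invr_ge0 ?wt_ge0 ?(ltW r0) ?(ltW K0).
Qed.

(** * Green functions of the extension as sums over words *)

Section Comparison.
Variable K : R.
Hypothesis K_ge1 : 1 <= K.
Hypothesis wt_cat : forall u v, wt (u ++ v) <= K * (wt u * wt v).
Hypothesis cat_wt : forall u v, admissible A (u ++ v) -> wt u * wt v <= K * wt (u ++ v).
Hypothesis phi_wt : forall u x, admissible A u -> branch_dom A u x ->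
  phi u x <= K * wt u /\ wt u <= K * phi u x.

Let K_gt0 : 0 < K. Proof. exact: lt_le_trans K_ge1. Qed.

Definition branch_words x g : pred (seq alpha) :=
  [pred t | admissible A (t ++ [:: letter x 0]) && (kw t == g)].

Lemma branch_words_dom x g t : t \in branch_words x g ->
  [/\ admissible A t, branch_dom A t x & kw t = g].
Proof.
rewrite inE => /andP[a /eqP e]; have ta : admissible A t by move: a; rewrite admissible_cat => /and3P[].
by split=> //; exact/branch_domP.
Qed.

(** Along the branch v the group coordinate becomes g kappa_v^-1, which is [h] precisely when
    kappa_v = h^-1 g. *)
Lemma transferE n x g h : transfer kappa phi n (fiber R h) (x, g) =
  \sum_(v : n.-tuple alpha | tval v \in branch_words x (h^-1 * g)%g) phi v x.
Proof.
rewrite /transfer big_mkcond [RHS]big_mkcond; apply: eq_bigr => v _ /=.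
have [va|nva] := boolP (admissible A v); last first.
  by rewrite inE admissible_cat (negbTE nva).
have [xv|nxv] := boolP (x \in branch_dom A v); last first.
  rewrite inE /=; case: ifP => // /andP[/(branch_domP _ va) h1 _].
  by move: nxv; rewrite mem_set.
have [tv _] := tauP (set_mem xv); rewrite inE.
move: xv => /set_mem /(branch_domP _ va) -> /=.
rewrite kappa_prodE (_ : mkseq _ n = v); last first.
  by move: tv; rewrite /cylinder /= size_tuple.
rewrite /fiber indicE; case: eqP => [->|ne].
  by rewrite mem_set ?mulr1 //= invgM invgK mulgA mulgV mul1g.
rewrite memNset ?mulr0 //= => -[_ e]; apply: ne.
by rewrite -e invgM invgK -mulgA mulVg mulg1.
Qed.

Section Green.
Variables (r : R) (x : tmc A) (g h : G).
Hypothesis r_ge : 2^-1 <= r.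
Let g' := (h^-1 * g)%g.
Hypothesis fin : has_sum (scaled r) (loop letter_value g').

Let r_gt0 : 0 < r. Proof. by apply: lt_le_trans r_ge; rewrite invr_gt0. Qed.

Let F t : R := if t \in branch_words x g' then scaled r t else 0.

Let partial N := \sum_(n < N) r ^+ n * transfer kappa phi n (fiber R h) (x, g).

Let F_ge0 t : 0 <= F t.
Proof. by rewrite /F; case: ifP => // _; rewrite scaled_ge0 // ltW. Qed.

Let transfer_bounds n (f := fun v : n.-tuple alpha => F v) :
  r ^+ n * transfer kappa phi n (fiber R h) (x, g) <= K * \sum_v f v /\
  \sum_v f v <= K * (r ^+ n * transfer kappa phi n (fiber R h) (x, g)).
Proof.
rewrite transferE (big_mkcond (fun v : n.-tuple alpha => _)) /= !mulr_sumr.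
have rn : 0 <= r ^+ n by rewrite exprn_ge0 // ltW.
split; rewrite ?mulr_sumr; apply: ler_sum => v _; rewrite /f /F;
  case: ifPn => [/branch_words_dom[va vx _]|_]; rewrite ?mulr0 //;
  have [h1 h2] := phi_wt va vx; rewrite /scaled size_tuple.
  by rewrite mulrCA ler_wpM2l.
by rewrite mulrCA ler_wpM2l.
Qed.

Let partial_le N : partial N <= K * \sum_(t <- words alpha N) F t.
Proof.
rewrite /partial sum_words mulr_sumr; apply: ler_sum => n _; exact: (transfer_bounds n).1.
Qed.

Let le_partial N : \sum_(t <- words alpha N) F t <= K * partial N.
Proof.
rewrite /partial sum_words mulr_sumr; apply: ler_sum => n _; exact: (transfer_bounds n).2.
Qed.

Let partial_ub N : partial N <= K * tsum (scaled r) (loop letter_value g').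
Proof.
apply: le_trans (partial_le N) _; rewrite ler_wpM2l ?(ltW K_gt0) // -big_mkcond -big_filter.
apply: sum_le_tsum; rewrite ?filter_uniq ?uniq_words // => t.
by rewrite mem_filter => /andP[/branch_words_dom[_ _]].
Qed.

(** The Green function at x sees only words that can precede x. Appending a connecting word of value
    1 turns any word into one of these without changing its value. *)
Let insert_bound t : loop letter_value g' t ->
  scaled r t <= conn_const K 1%g * K * \sum_(c <- conn_words 1%g) F (t ++ c).
Proof.
move=> tg; set b := [:: letter x 0].
have ba : admissible A b by [].
have sb : 0 < scaled r b by rewrite mulr_gt0 ?exprn_gt0 ?wt_gt0.
have [_ _ hcat /(_ 1%g t b) hb] := scaled_quasi_mult K_ge1 wt_cat cat_wt r_ge.
rewrite -(ler_pM2r sb); apply: le_trans hb _.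
rewrite -!mulrA ler_wpM2l ?conn_const_ge0 ?(ltW K_gt0) // mulrA mulr_sumr mulr_suml.
rewrite big_seq [leRHS]big_seq; apply: ler_sum => c /conn_wordsP kc.
rewrite catA /F inE kword_cat kc mulg1 tg eqxx andbT; case: ifPn => [_|na].
  by rewrite -mulrA hcat.
by rewrite mulr0 mul0r /scaled wt_eq0 // mulr0.
Qed.

Lemma green_bounds : exists y : R, [/\ green kappa phi r (fiber R h) (x, g) = y%:E, 0 <= y,
  tsum (scaled r) (loop letter_value g') <= conn_const K 1%g * K * (size (conn_words 1%g))%:R * (K * y) &
  y <= K * tsum (scaled r) (loop letter_value g')].
Proof.
have T0 n : 0 <= r ^+ n * transfer kappa phi n (fiber R h) (x, g).
  have [_] := transfer_bounds n; rewrite -ler_pdivrMl // => /(le_trans _); apply.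
  by rewrite mulr_ge0 ?invr_ge0 ?(ltW K_gt0) // sumr_ge0.
have pE N : (\sum_(0 <= n < N) (r ^+ n * transfer kappa phi n (fiber R h) (x, g))%:E)%E = (partial N)%:E.
  by rewrite sumEFin big_mkord.
have ub : (green kappa phi r (fiber R h) (x, g) <= (K * tsum (scaled r) (loop letter_value g'))%:E)%E.
  apply: lime_le; first by apply: is_cvg_nneseries => n _ _; rewrite lee_fin.
  by apply: nearW => N; rewrite pE lee_fin.
have lb N : ((partial N)%:E <= green kappa phi r (fiber R h) (x, g))%E.
  by rewrite -pE; apply: nneseries_lim_ge => n _ _; rewrite lee_fin.
have gfin : green kappa phi r (fiber R h) (x, g) \is a fin_num.
  by rewrite fin_numElt (lt_le_trans _ (lb 0%N)) ?ltNyr //= (le_lt_trans ub) ?ltry.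
have Fs N : \sum_(t <- words alpha N) F t <= K * fine (green kappa phi r (fiber R h) (x, g)).
  apply: le_trans (le_partial N) _; rewrite ler_wpM2l ?(ltW K_gt0) //.
  by rewrite -lee_fin fineK.
have Fb X : uniq X -> \sum_(t <- X) F t <= K * fine (green kappa phi r (fiber R h) (x, g)).
  move=> uX; apply: le_trans (Fs (\max_(t <- X) size t).+1).
  apply: le_sum_sub => // [|t tX]; first exact: uniq_words.
  by rewrite mem_words ltnS; apply: (leq_bigmax_seq (F := size)).
exists (fine (green kappa phi r (fiber R h) (x, g))); split; first by rewrite fineK.
    by rewrite -lee_fin fineK //; have := lb 0%N; rewrite /partial big_ord0.
  have cK : 0 <= conn_const K 1%g * K by rewrite mulr_ge0 ?conn_const_ge0 ?(ltW K_gt0).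
  apply: le_trans (_ : conn_const K 1%g * K * (size (conn_words 1%g))%:R * tsum F (loop letter_value g') <= _).
    apply: (@tsum_inj _ _ _ _ (scaled r) F (conn_words 1%g) (fun c t => t ++ c)) => //.
    - by move=> c t cc tg; rewrite /loop kword_cat (conn_wordsP cc) mulg1.
    - by move=> c t t' _ _ _ e; apply: (cat_size_inj e); have := congr1 size e; rewrite !size_cat; lia.
    - by apply: has_sum_le => X uX _; exact: Fb.
  apply: ler_wpM2l; first by rewrite mulr_ge0.
  by apply: tsum_le => X uX _; exact: Fb.
by rewrite -lee_fin fineK.
Qed.

End Green.

(** Below the radius the root test bounds r^n L^n by a geometric sequence, which stays summable with
    the extra factor n + 1 that the marked cut requires. *)
Lemma scaled_summable r x g h : 2^-1 <= r -> 0 < growth_rate kappa phi x g h ->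
  r * growth_rate kappa phi x g h < 1 -> forall delta : R, 0 < delta ->
  summable_weight letter_value K conn_words (conn_const K) (scaled r).
Proof.
move=> r_ge rho0 rrho delta delta0.
have r0 : 0 < r by apply: lt_le_trans r_ge; rewrite invr_gt0.
have K0 := K_gt0.
pose g' := (g^-1 * h)%g.
pose T n := transfer kappa phi n (fiber R g) (x, h).
pose F t : R := if t \in branch_words x g' then scaled r t else 0.
have F0 t : 0 <= F t by rewrite /F; case: ifP => // _; rewrite scaled_ge0 // ltW.
have FT n : \sum_(v : n.-tuple alpha) F v <= K * (r ^+ n * T n).
  rewrite /T transferE [X in K * (_ * X)]big_mkcond !mulr_sumr.
  apply: ler_sum => v _; rewrite /F.
  case: ifPn => [/branch_words_dom[va vx _]|_]; rewrite ?mulr0 //.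
  rewrite /scaled size_tuple mulrCA ler_wpM2l ?exprn_ge0 ?(ltW r0) //.
  exact: (phi_wt va vx).2.
have T0 n : 0 <= T n.
  have h1 : 0 <= K * (r ^+ n * T n) by apply: le_trans (FT n); rewrite sumr_ge0.
  by move: h1; rewrite pmulr_rge0 // pmulr_rge0 // exprn_gt0.
have [q [M [q0 rq M0 TM]]] := root_limsup_lt T0 r0 rho0 rrho.
have rq0 : 0 <= r * q by rewrite mulr_ge0 // ltW.
set b := letter x 0.
apply: (summable_weight_criterion conn_wordsP (ltW K0) _ delta0 (g0 := g') (a0 := b)).
- by move=> k; apply: conn_const_ge0; exact: ltW.
- exact: scaled_quasi_mult.
- by rewrite mulr_gt0 ?exprn_gt0 ?wt_gt0.
(* The word of the criterion is v followed by one letter, so its size plus one is |v| + 2. *)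
have fin : has_sum (fun v => (size v).+2%:R * F v) (fun=> True).
  apply: (@has_sum_le _ _ _ _ (K * M * (2 * (1 - r * q) ^- 2))) => X uX _.
  pose N := (\max_(t <- X) size t).+1.
  apply: le_trans (_ : \sum_(t <- words alpha N) (size t).+2%:R * F t <= _).
    apply: le_sum_sub => // [t||t tX]; [by rewrite mulr_ge0|exact: uniq_words|].
    by rewrite mem_words ltnS; apply: (leq_bigmax_seq (F := size)).
  rewrite (sum_words N (fun t => (size t).+2%:R * F t)).
  apply: le_trans (_ : \sum_(n < N) K * M * (2 * (n.+1%:R * (r * q) ^+ n)) <= _); last first.
    rewrite -mulr_sumr ler_wpM2l ?mulr_ge0 ?(ltW K0) // -mulr_sumr ler_wpM2l //.
    exact: arithmetic_geometric_sum_le.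
  apply: ler_sum => n _; under eq_bigr do rewrite size_tuple.
  rewrite -mulr_sumr; apply: le_trans (_ : n.+2%:R * (K * (r ^+ n * (M * q ^+ n))) <= _).
    rewrite ler_wpM2l //; apply: le_trans (FT n) _.
    by rewrite ler_wpM2l ?(ltW K0) // ler_wpM2l ?exprn_ge0 ?(ltW r0).
  rewrite exprMn (_ : n.+2%:R * _ = n.+2%:R * (K * M * (r ^+ n * q ^+ n))); last by ring.
  rewrite (_ : K * M * (2 * _) = (2 * n.+1%:R) * (K * M * (r ^+ n * q ^+ n))); last by ring.
  rewrite ler_wpM2r ?mulr_ge0 ?exprn_ge0 ?(ltW K0) ?(ltW r0) ?(ltW q0) //.
  by rewrite -natrM ler_nat mul2n -addnn -[leqLHS]addn1 leq_add2l.
apply: (@has_sum_inj _ _ _ unit _ (fun v => (size v).+2%:R * F v) [:: tt]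
  (fun _ t => take (size t).-1 t) _ (fun=> True) (K * r)) => //.
- by rewrite mulr_ge0 // ltW.
- move=> _ [v -> vg]; rewrite big_seq1 size_cat addn1 /= take_size_cat // [leRHS]mulrCA.
  rewrite ler_wpM2l // /F inE vg eqxx andbT; case: ifPn => [_|na]; last first.
    by rewrite /scaled (wt_eq0 _ na) !mulr0.
  rewrite /scaled size_cat addn1 exprS.
  rewrite (_ : K * r * _ = r * r ^+ size v * (K * wt v)); last by ring.
  rewrite ler_wpM2l ?mulr_ge0 ?exprn_ge0 ?(ltW r0) //.
  apply: le_trans (wt_cat _ _) _; rewrite ler_wpM2l ?(ltW K0) //.
  by rewrite ler_piMr ?wt_ge0 ?wt_le1.
- move=> _ _ _ _ [v -> _] [v' -> _]; rewrite !size_cat !addn1 /= !take_size_cat //.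
  by move=> ->.
Qed.

End Comparison.

End Extension.

(** * Ancona inequalities *)

Section Geodesics.
Variables (G : groupType) (S : seq G).
Hypothesis hS : symmetric_generating S.
Local Notation len := (word_length S).

Lemma path_len_le g p i j : path (cayley_adj S) g p -> (i <= j <= size p)%N ->
  (len ((nth g (g :: p) i)^-1 * nth g (g :: p) j)%g <= j - i)%N.
Proof.
move=> gp /andP[ij jp]; elim: j ij jp => [|j IH] ij jp.
  by move: ij; rewrite leqn0 => /eqP ->; rewrite mulVg len1.
move: ij; rewrite leq_eqVlt => /predU1P[->|ij]; first by rewrite mulVg len1.
have adj : ((nth g (g :: p) j)^-1 * nth g (g :: p) j.+1)%g \in S.
  by move/(pathP g): gp => /(_ j jp).
rewrite (_ : (_ * _)%g = ((nth g (g :: p) i)^-1 * nth g (g :: p) j *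
  ((nth g (g :: p) j)^-1 * nth g (g :: p) j.+1))%g); last by rewrite -mulgA mulVKg.
apply: leq_trans (lenM hS _ _) _; rewrite subSn // -[X in (_ <= X)%N]addn1.
by apply: leq_add; [exact: IH (ltnW jp)|exact: len_gen].
Qed.

(** The geodesic is parametrized backwards, from [h] to [g], since the Green function to be
    estimated is V(h^-1 g). *)
Lemma geodesic_points g h p : geodesic S g h p -> exists2 pt : nat -> G,
  forall i j, (i <= j <= size p)%N -> len ((pt i)^-1 * pt j)%g = (j - i)%N &
  [/\ pt 0%N = h, pt (size p) = g &
    forall y, y \in g :: p -> exists2 s, (s <= size p)%N & pt s = y].
Proof.
move=> [gp <- sp]; pose q i := nth g (g :: p) i.
have q0 : q 0%N = g by [].
have qN : q (size p) = last g p by rewrite (last_nth g).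
have qlen i j : (i <= j <= size p)%N -> len ((q i)^-1 * q j)%g = (j - i)%N.
  move=> /andP[ij jp]; apply/eqP; rewrite eqn_leq path_len_le ?ij //=.
  have h1 : (len ((q 0)^-1 * q i)%g <= i)%N.
    by apply: leq_trans (path_len_le gp _) _; rewrite ?subn0 //= (leq_trans ij).
  have h2 := path_len_le gp (i := j) (j := size p); rewrite jp leqnn in h2.
  have := lenM hS ((q 0)^-1 * q i)%g ((q i)^-1 * q j * ((q j)^-1 * q (size p)))%g.
  have := lenM hS ((q i)^-1 * q j)%g ((q j)^-1 * q (size p))%g.
  rewrite -!mulgA !mulVKg q0 qN -/(word_dist S g (last g p)) -sp.
  move: (h2 isT) h1; rewrite -/(q j) -/(q (size p)) q0 qN.
  by clear -ij jp; lia.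
exists (fun i => q (size p - i)%N) => [i j /andP[ij jp]|].
  by rewrite -(lenV hS) invgM invgK qlen; lia.
split; rewrite ?subn0 ?subnn // => y /(nthP g)[i ip <-].
exists (size p - i)%N; first exact: leq_subr.
by rewrite subKn.
Qed.

End Geodesics.

Lemma bernoulli (R : realType) (x : R) k : 0 <= x -> x <= 1 -> 1 - k%:R * x <= (1 - x) ^+ k.
Proof.
move=> x0 x1; elim: k => [|k IH]; first by rewrite mul0r subr0.
rewrite exprSr; apply: le_trans (ler_wpM2r _ IH); last by rewrite subr_ge0.
rewrite -natr1 -subr_ge0 (_ : _ - _ = k%:R * x ^+ 2); last by ring.
by rewrite mulr_ge0 // exprn_ge0.
Qed.

(** * From weights on words to the Green functions *)

Section Main.
Variables (R : realType) (alpha : finType) (A : rel alpha).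
Variables (pt : tmc A) (mu : probability (borel pt) R) (phi : seq alpha -> tmc A -> R).
Hypothesis mu_pos : positive_on_cylinders mu.
Hypothesis phi_jac : is_jacobian mu phi.
Hypothesis phi_gm : gibbs_markov phi.
Variables (G : groupType) (S : seq G) (kappa : tmc A -> G).
Hypothesis kappa_const : constant_on_letters kappa.
Hypothesis trans : topologically_transitive kappa.
Hypothesis hS : symmetric_generating S.
Variable delta : R.
Hypothesis delta_gt0 : 0 < delta.
Hypothesis hyp : forall x y z, Num.min (gp R S x y) (gp R S y z) - delta <= gp R S x z.
Hypothesis nonel : ~ elementary G.
Variable K : R.
Hypothesis K_ge1 : 1 <= K.
Hypothesis wt_cat : forall u v, wt mu (u ++ v) <= K * (wt mu u * wt mu v).
Hypothesis cat_wt : forall u v, admissible A (u ++ v) ->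
  wt mu u * wt mu v <= K * wt mu (u ++ v).
Hypothesis phi_wt : forall u x, admissible A u -> branch_dom A u x ->
  phi u x <= K * wt mu u /\ wt mu u <= K * phi u x.
Variables (x0 : tmc A) (g0 h0 : G).
Let rho := growth_rate kappa phi x0 g0 h0.
Let radius := rho^-1.
Hypothesis radius_ge1 : 1 <= radius.

Local Notation len := (word_length S).
Local Notation w r := (scaled mu r).
Local Notation lp := (loop (letter_value pt kappa)).
Local Notation V r g := (tsum (w r) (lp g)).
Local Notation conn := (conn_words pt kappa_const trans).
Local Notation Kc := (conn_const mu kappa_const trans K).
Local Notation Gr r h x g := (green kappa phi r (fiber R h) (x, g)).

Let K_gt0 : 0 < K. Proof. exact: lt_le_trans K_ge1. Qed.
Let K_ge0 : 0 <= K. Proof. exact: ltW. Qed.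
Let radius_gt0 : 0 < radius. Proof. exact: lt_le_trans radius_ge1. Qed.
Let half_radius : 2^-1 <= radius. Proof. by apply: le_trans radius_ge1; rewrite invf_le1 ?ler1n. Qed.
Let connP g c : c \in conn g -> kword (letter_value pt kappa) c = g.
Proof. exact: conn_wordsP. Qed.
Let Kc_ge0 g : 0 <= Kc g. Proof. exact: conn_const_ge0. Qed.

Let w_good r : 2^-1 <= r -> quasi_mult K conn Kc (w r).
Proof. exact: scaled_quasi_mult. Qed.

Let w_le r r' u : 0 <= r -> r <= r' -> w r u <= w r' u.
Proof.
by move=> r0 rr; rewrite ler_wpM2r ?wt_ge0 // lerXn2r // nnegrE // (le_trans r0).
Qed.

Lemma radius_limit : (forall g, has_sum (w radius) (lp g)) /\
  exists B, forall k, sphere_sum S (letter_value pt kappa) (w radius) k <= B.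
Proof.
(* The parameters R (1 - 1 / (n + 2)) increase to R and stay at least 1/2, as R >= 1. *)
pose x n : R := n.+2%:R^-1.
have x0' n : 0 <= x n by rewrite invr_ge0.
have x1 n : x n <= 2^-1 by rewrite lef_pV2 ?posrE // ler_nat.
have y0 n : 0 <= 1 - x n by have := x1 n; lra.
have rho_gt0 : 0 < rho by rewrite -invr_gt0.
apply: (weight_limit connP K_ge0 Kc_ge0 hS delta_gt0 hyp nonel
  (wn := fun n => w (radius * (1 - x n)))).
- move=> n; have h1 : 2^-1 <= radius * (1 - x n).
    apply: le_trans (_ : 1 - x n <= _); last by rewrite ler_peMl.
    by have := x1 n; lra.
  apply: (scaled_summable mu_pos kappa_const trans K_ge1 wt_cat cat_wt phi_wt
    (x := x0) (g := g0) (h := h0) h1 _ _ delta_gt0) => //.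
  rewrite -/rho mulrAC mulVf ?gt_eqF // mul1r ltrBlDr ltrDl.
  by rewrite invr_gt0.
- exact: w_good.
- by move=> n u; apply: w_le; rewrite ?mulr_ge0 ?ler_piMr ?gerBl // ltW.
move=> u e e0; have [N hN] := nat_above (w radius u * (size u)%:R / e).
exists N => n Nn; rewrite /scaled exprMn mulrAC -/(w radius u).
have wu : 0 <= w radius u by apply: scaled_ge0; exact: ltW.
apply: le_trans (ler_wpM2l wu (bernoulli (size u) (x0' n) _)); last by have := x1 n; lra.
rewrite mulrBr mulr1 lerD2l lerN2 mulrA /x ler_pdivrMr // -ler_pdivrMl // mulrC.
by apply: le_trans hN _; rewrite ler_nat (leq_trans Nn) // leqW.
Qed.

Let w_fin r g : 2^-1 <= r -> r <= radius -> has_sum (w r) (lp g).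
Proof.
move=> r2 rr; apply: le_has_sum (radius_limit.1 g) => t _; apply: w_le => //.
by apply: le_trans r2; rewrite invr_ge0.
Qed.

Lemma green_comparison : exists2 C : R, 0 <= C & forall r x g h, 2^-1 <= r -> r <= radius ->
  exists y, [/\ Gr r h x g = y%:E, 0 <= y, V r (h^-1 * g)%g <= C * y & y <= C * V r (h^-1 * g)%g].
Proof.
pose c := Kc 1%g * K * (size (conn 1%g))%:R * K.
have c0 : 0 <= c by rewrite !mulr_ge0.
exists (c + K); first by rewrite addr_ge0.
move=> r x g h r2 rr.
have [y [e y0 h1 h2]] := green_bounds mu_pos kappa_const trans K_ge1 wt_cat cat_wt phi_wt x r2 (w_fin (h^-1 * g)%g r2 rr).
exists y; have V0 : 0 <= V r (h^-1 * g)%g.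
  by apply: tsum_ge0 => u; apply: scaled_ge0; apply: le_trans r2; rewrite invr_ge0.
split=> //; first by apply: le_trans h1 _; rewrite mulrA -/c ler_wpM2r // lerDl.
by apply: le_trans h2 _; rewrite ler_wpM2r // lerDr.
Qed.

Hypothesis green_sym : exists2 C0 : R, 1 <= C0 & forall (x : tmc A) (g : G),
  (C0^-1%:E * Gr radius 1%g x g <= Gr radius g x 1%g)%E.

(** Comparing V with the Green function on both sides of the symmetry hypothesis bounds V(g) by a
    multiple of V(g^-1), so V(g)^2 is bounded by the term of the sphere sum at g. *)
Lemma sphere_sq_bound : exists B, forall k, \sum_(g <- sphere S k) V radius g ^+ 2 <= B.
Proof.
have [_ [B hB]] := radius_limit; have [C C0 hC] := green_comparison.
have [c c1 hc] := green_sym; have c0 : 0 < c by apply: lt_le_trans c1.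
exists (C * c * C * B) => k; apply: le_trans (ler_wpM2l _ (hB k)); last by rewrite !mulr_ge0 // ltW.
rewrite /sphere_sum mulr_sumr; apply: ler_sum => g _; rewrite expr2 mulrCA.
apply: ler_wpM2l; first by apply: tsum_ge0 => u; apply: scaled_ge0; exact: ltW.
have [y [e _ h1 _]] := hC radius x0 g 1%g half_radius (lexx _).
have [y' [e' _ _ h2]] := hC radius x0 1%g g half_radius (lexx _).
have := hc x0 g; rewrite e e' -EFinM lee_fin ler_pdivrMl // => yy.
rewrite invg1 mul1g in h1; rewrite mulg1 in h2.
apply: le_trans h1 _; rewrite -!mulrA ler_wpM2l //; apply: le_trans yy _.
by rewrite ler_wpM2l // ltW.
Qed.

Lemma kap_len_bound : exists L, forall a, (len (letter_value pt kappa a) <= L)%N.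
Proof.
exists (\max_a len (letter_value pt kappa a)) => a.
exact: (leq_bigmax (F := fun a => len (letter_value pt kappa a))).
Qed.

Lemma ancona_words (D : R) : exists2 C : R, 0 <= C & forall g z h : G,
  (exists p : seq G, geodesic S g h p /\ exists2 y : G, y \in g :: p & (word_dist S z y)%:R < D) ->
  forall r, 2^-1 <= r -> r <= radius ->
  V r (h^-1 * z)%g * V r (z^-1 * g)%g <= C * V r (h^-1 * g)%g /\
  V r (h^-1 * g)%g <= C * (V r (h^-1 * z)%g * V r (z^-1 * g)%g).
Proof.
have [L hL] := kap_len_bound; have [B hB] := sphere_sq_bound.
have [C C0 hC] := ancona_upper connP K_ge0 Kc_ge0 hS delta_gt0 hyp
  (w_good half_radius) (fun g => w_fin g half_radius (lexx _)) hL hB.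
have [n hn] := nat_above D.
pose H := harnack_const S conn Kc; have H1 : 1 <= H by exact: harnack_const_ge1.
have H0 : 0 <= H by apply: le_trans H1.
have JV0 : 0 <= K * Jc conn Kc 1%g * V radius 1%g.
  rewrite !mulr_ge0 ?Jc_ge0 //; apply: tsum_ge0 => u; apply: scaled_ge0; exact: ltW.
exists (K * Jc conn Kc 1%g * V radius 1%g + C * (H ^+ n * H ^+ n)).
  by rewrite addr_ge0 // !mulr_ge0 // exprn_ge0.
move=> g z h [p [gp [y yp zy]]] r r2 rr.
have r0 : 0 <= r by apply: le_trans r2; rewrite invr_ge0.
have wg := w_good r2; have wf g' := w_fin g' r2 rr.
have V0 g' : 0 <= V r g' by apply: tsum_ge0 => u; exact: scaled_ge0.
split.
  have := V_mul connP K_ge0 Kc_ge0 wg wf (h^-1 * z)%g 1%g (z^-1 * g)%g.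
  rewrite mulg1 -mulgA mulVKg => /le_trans; apply.
  rewrite ler_wpM2r // -[leLHS]addr0 lerD ?mulr_ge0 ?exprn_ge0 //.
  rewrite ler_wpM2l ?mulr_ge0 ?Jc_ge0 //.
  by apply: le_tsum => [u _|]; [exact: w_le|exact: w_fin].
have [q qlen [q0 qN qy]] := geodesic_points hS gp; have [s sN qs] := qy y yp.
have := hC _ wg (fun u => w_le u r0 rr) q (size p) s qlen sN; rewrite q0 qN qs => hV.
have lzy : (len (z^-1 * y)%g <= n)%N.
  by rewrite -(ler_nat R) ltW // (lt_le_trans zy).
have Hn m : (m <= n)%N -> H ^+ m <= H ^+ n by move=> mn; rewrite ler_weXn2l.
(* Replacing the point y of the geodesic by z is a right translation in this factor and a left
   translation in the next one, hence the two forms of the Harnack inequality. *)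
have V1 : V r (h^-1 * y)%g <= H ^+ n * V r (h^-1 * z)%g.
  apply: le_trans (V_harnack connP K_ge0 Kc_ge0 wg wf hS _ (h^-1 * z)%g) _.
  by rewrite ler_wpM2r // Hn // invgM invgK -mulgA mulVKg -(lenV hS) invgM invgK.
have V2 : V r (y^-1 * g)%g <= H ^+ n * V r (z^-1 * g)%g.
  apply: le_trans (V_harnackl connP Kc_ge0 wg wf hS _ (z^-1 * g)%g) _.
  by rewrite ler_wpM2r // Hn // invgM invgK mulgA mulgK.
apply: le_trans hV _.
apply: le_trans (_ : C * (H ^+ n * H ^+ n) * (V r (h^-1 * z)%g * V r (z^-1 * g)%g) <= _).
  by rewrite -mulrA ler_wpM2l // mulrACA ler_pM.
by rewrite ler_wpM2r ?mulr_ge0 // lerDr.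
Qed.

Lemma ancona_green (D : R) : exists2 C : R, 1 <= C & forall g z h : G,
  (exists p : seq G, geodesic S g h p /\ exists2 y : G, y \in g :: p & (word_dist S z y)%:R < D) ->
  forall r, 2^-1 <= r -> r <= radius -> forall x,
    (C^-1%:E * (Gr r h x z * Gr r z x g) <= Gr r h x g)%E /\
    (Gr r h x g <= C%:E * (Gr r h x z * Gr r z x g))%E.
Proof.
have [C C0 hC] := ancona_words D; have [c c0 hc] := green_comparison.
have cC : 0 <= c * (C * (c * c)) by rewrite !mulr_ge0.
exists (1 + c * (C * (c * c))); first by rewrite lerDl.
have E0 : 0 < 1 + c * (C * (c * c)) by rewrite ltr_wpDr.
move=> g z h hp r r2 rr x; have [l u] := hC g z h hp r r2 rr.
have [y1 [-> p1 h1 k1]] := hc r x g h r2 rr.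
have [y2 [-> p2 h2 k2]] := hc r x z h r2 rr.
have [y3 [-> p3 h3 k3]] := hc r x g z r2 rr.
have V0 g' : 0 <= V r g' by apply: tsum_ge0 => t; exact: scaled_ge0.
rewrite -!EFinM !lee_fin ler_pdivrMl //; split.
  apply: le_trans (_ : c * (C * (c * c)) * y1 <= _); last by rewrite ler_wpM2r // lerDr.
  apply: le_trans (ler_pM p2 p3 k2 k3) _; rewrite mulrACA.
  apply: le_trans (ler_wpM2l (mulr_ge0 c0 c0) l) _.
  apply: le_trans (ler_wpM2l (mulr_ge0 c0 c0) (ler_wpM2l C0 h1)) _.
  by rewrite le_eqVlt; apply/orP; left; apply/eqP; ring.
apply: le_trans (_ : c * (C * (c * c)) * (y2 * y3) <= _); last first.
  by rewrite ler_wpM2r ?mulr_ge0 // lerDr.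
apply: le_trans k1 _; rewrite -[leRHS]mulrA ler_wpM2l //; apply: le_trans u _.
by rewrite -[leRHS]mulrA ler_wpM2l // (le_trans (ler_pM _ _ h2 h3)) // mulrACA.
Qed.

End Main.
Theorem theorem1 (R : realType) (alpha : finType) (A : rel alpha)
    (pt : tmc A) (mu : probability (borel pt) R) (phi : seq alpha -> tmc A -> R)
    (G : groupType) (S : seq G) (kappa : tmc A -> G)
    (x0 : tmc A) (g0 h0 : G) :
  topologically_mixing A ->
  ~ bijective (@theta alpha A) ->
  shift_invariant mu ->
  positive_on_cylinders mu ->
  is_jacobian mu phi ->
  gibbs_markov phi ->
  constant_on_letters kappa ->
  symmetric_generating S ->
  hyperbolic S R ->
  ~ elementary G ->
  topologically_transitive kappa ->
  let Gr := fun (r : R) (h : G) (x : tmc A) (g : G) =>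
    green kappa phi r (fiber R h) (x, g) in
  (* by transitivity rho does not depend on the choice of x0, g0, h0 *)
  let rho := growth_rate kappa phi x0 g0 h0 in
  let radius := rho^-1 in
  (exists2 C0 : R, 1 <= C0 & forall (x : tmc A) (g : G),
     ((C0^-1)%:E * Gr radius 1%g x g <= Gr radius g x 1%g)%E /\
     (Gr radius g x 1%g <= C0%:E * Gr radius 1%g x g)%E) ->
  forall D : R, 0 < D ->
  exists2 C : R, 1 <= C & forall g z h : G,
    (exists p : seq G, geodesic S g h p /\
       exists2 y : G, y \in g :: p & (word_dist S z y)%:R < D) ->
    forall r : R, 1 <= r -> r <= radius ->
    forall x : tmc A,
      ((C^-1)%:E * (Gr r h x z * Gr r z x g) <= Gr r h x g)%E /\
      (Gr r h x g <= C%:E * (Gr r h x z * Gr r z x g))%E.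

Proof.
move=> _ _ _ mu_pos phi_jac phi_gm kappa_const hS [delta delta_gt0 hyp] nonel trans.
move=> Gr rho radius [C0 C1 sym] D _.
(* For a radius below 1 the range of r is empty. *)
have [r1|r1] := lerP 1 radius; last first.
  exists 1 => // g z h _ r h1 h2.
  by have := le_lt_trans (le_trans h1 h2) r1; rewrite ltxx.
have [K K1 [wt_cat cat_wt phi_wt]] := wt_comparisons mu_pos phi_jac phi_gm.
have hyp' x y z : Num.min (gp R S x y) (gp R S y z) - delta <= gp R S x z.
  by have := hyp x y z 1%g; rewrite !(gpE R hS) invg1 !mul1g.
have [|C hC1 hC] := ancona_green mu_pos kappa_const trans hS delta_gt0 hyp' nonel K1
  wt_cat cat_wt phi_wt r1 _ D.
  by exists C0 => // x g; case: (sym x g).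
exists C => // g z h hp r hr1 hr2 x; apply: hC => //.
by apply: le_trans hr1; rewrite invf_le1 ?ler1n.
Qed.
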